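(* Let $P,Q$ be real analytic functions in a neighborhood of the origin of $\mathbb{R}^2$ with $j^1P(0)=j^1Q(0)=0$, and consider the system $\dot x = y+P(x,y)$, $\dot y = Q(x,y)$. Suppose that the origin is a monodromic (nilpotent) isolated singular point of this system with odd Andreev number $n$. If $\beta=n-1$, where $\beta$ is the order of vanishing at $x=0$ of the function $\Phi$ defined in the context, then the origin is a (nilpotent) focus of the system.
   Context: $j^lF(0)$ denotes the $l$-jet (Taylor polynomial of degree $l$) of $F$ at the origin. A singular point is monodromic if nearby orbits turn around it, so that a Poincaré first return map is defined on a transversal half-section at the point; for an analytic field a monodromic singular point is either a center (all orbits in some punctured neighborhood are periodic and surround it) or a focus (all orbits in some punctured neighborhood spiral towards it in forward or in backward time). Let $X$ be the vector field of the system $\dot x=y+P$, $\dot y=Q$. Let $y=F(x)$ be the (analytic) solution of $y+P(x,y)=0$ near $(0,0)$ with $F(0)=0$, and set $f(x)=Q(x,F(x))$ and $\Phi(x)=\operatorname{div}X|_{(x,F(x))}$. Write $f(x)=ax^{\alpha}+O(x^{\alpha+1})$ with $a\neq0$ and, if $\Phi\not\equiv0$, $\Phi(x)=bx^{\beta}+O(x^{\beta+1})$ with $b\neq 0$. By Andreev's theorem, the isolated singular point at the origin is monodromic if and only if $a<0$, $\alpha=2n-1$ for some integer $n$, and one of the following holds: (i) $\beta>n-1$; (ii) $\beta=n-1$ and $b^2+4an<0$; (iii) $\Phi\equiv0$. The Andreev number of the singular point is the number $n$ with $f(x)=ax^{2n-1}+O(x^{2n})$, $a\ne 0$. *)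

(* Defs.v *)
(* Stdlib reals with Coquelicot. *)
From Stdlib Require Import Reals.
From Coquelicot Require Import Coquelicot.
Open Scope R_scope.

(* The double series  sum_(i,j) c i j h^i k^j  is summed by total degree; absolute
   convergence makes the order of summation irrelevant. *)
Definition analytic2_at (f : R -> R -> R) (x0 y0 : R) : Prop :=
  exists (c : nat -> nat -> R) (r : R), 0 < r /\
    forall h k : R, Rabs h < r -> Rabs k < r ->
      ex_series (fun m =>
        sum_f_R0 (fun i => Rabs (c i (m - i)%nat * h ^ i * k ^ (m - i))) m) /\
      is_series (fun m =>
        sum_f_R0 (fun i => c i (m - i)%nat * h ^ i * k ^ (m - i)) m)
        (f (x0 + h) (y0 + k)).

Definition analytic2_near0 (f : R -> R -> R) : Prop :=
  locally_2d (analytic2_at f) 0 0.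

Definition analytic1_at (g : R -> R) (x0 : R) : Prop :=
  exists c : nat -> R, locally x0 (fun x => is_pseries c (x - x0) (g x)).

Definition analytic1_near0 (g : R -> R) : Prop :=
  locally 0 (analytic1_at g).

Definition jet_zero (l : nat) (f : R -> R -> R) : Prop :=
  forall x y : R, DL_pol l f 0 0 x y = 0.

(* A planar vector field is given by its two components X1, X2 : R -> R -> R.  They are
   total functions, but only their germs at the origin matter below: every notion refers
   to arbitrarily small neighbourhoods of the origin. *)

Definition divergence (X1 X2 : R -> R -> R) (x y : R) : R :=
  Derive (fun u => X1 u y) x + Derive (fun v => X2 x v) y.

Definition in_ball0 (r x y : R) : Prop := sqrt (x ^ 2 + y ^ 2) < r.

Definition isolated_singular_point (X1 X2 : R -> R -> R) : Prop :=
  X1 0 0 = 0 /\ X2 0 0 = 0 /\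
  exists r : R, 0 < r /\
    forall x y : R, in_ball0 r x y -> (x, y) <> (0, 0) ->
      (X1 x y, X2 x y) <> (0, 0).

Definition solution_at (X1 X2 : R -> R -> R) (x y : R -> R) (t : R) : Prop :=
  is_derive x t (X1 (x t) (y t)) /\ is_derive y t (X2 (x t) (y t)).

(* In particular (x, y) <> (0, 0). *)
Definition polar_angle (theta x y : R) : Prop :=
  exists rho : R, 0 < rho /\ x = rho * cos theta /\ y = rho * sin theta.

(* The section is the set of the points (s1 u, s2 u) with 0 < u <= d; the origin is its
   endpoint u = 0.  psi is a continuous determination of the polar angle along it. *)
Definition half_section (X1 X2 : R -> R -> R) (d : R) (s1 s2 psi : R -> R) : Prop :=
  0 < d /\
  s1 0 = 0 /\ s2 0 = 0 /\
  (forall u, 0 <= u <= d ->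
     ex_derive s1 u /\ ex_derive s2 u /\
     continuous (Derive s1) u /\ continuous (Derive s2) u) /\
  (Derive s1 0, Derive s2 0) <> (0, 0) /\
  (forall u v, 0 <= u <= d -> 0 <= v <= d -> s1 u = s1 v -> s2 u = s2 v -> u = v) /\
  (forall u, 0 < u <= d ->
     X1 (s1 u) (s2 u) * Derive s2 u - X2 (s1 u) (s2 u) * Derive s1 u <> 0) /\
  (forall u, 0 < u <= d -> continuous psi u /\ polar_angle (psi u) (s1 u) (s2 u)).

(* The orbit through the point of parameter u comes back to the section, for the first
   time, at the point of parameter v, staying in the ball of radius eta meanwhile.  The
   closed curve made of this orbit arc and of the piece of the section between its two
   ends winds exactly once around the origin, in either sense. *)
Definition first_return (X1 X2 : R -> R -> R) (d : R) (s1 s2 psi : R -> R)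
    (eta u v : R) : Prop :=
  0 < v <= d /\
  exists (T : R) (x y theta : R -> R),
    0 < T /\
    x 0 = s1 u /\ y 0 = s2 u /\ x T = s1 v /\ y T = s2 v /\
    (forall t, 0 <= t <= T ->
       solution_at X1 X2 x y t /\ in_ball0 eta (x t) (y t) /\
       continuous theta t /\ polar_angle (theta t) (x t) (y t)) /\
    (forall t w, 0 < t < T -> 0 < w <= d -> (x t, y t) <> (s1 w, s2 w)) /\
    theta 0 = psi u /\
    (theta T = psi v + 2 * PI \/ theta T = psi v - 2 * PI).

(* The return arcs have to lie in any prescribed neighbourhood of the origin: otherwise
   a node whose orbits are brought back from far away would qualify. *)
Definition monodromic (X1 X2 : R -> R -> R) : Prop :=
  exists (d : R) (s1 s2 psi : R -> R),
    half_section X1 X2 d s1 s2 psi /\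
    forall eta : R, 0 < eta ->
      exists eps : R, 0 < eps <= d /\
        forall u : R, 0 < u < eps ->
          exists v : R, first_return X1 X2 d s1 s2 psi eta u v.

(* For fields that are locally Lipschitz near the origin, the solution through (x0, y0)
   that remains in a small ball is unique, so "exists" describes the orbit itself. *)
Definition spirals_to_origin (X1 X2 : R -> R -> R) : Prop :=
  forall eta : R, 0 < eta ->
    exists r : R, 0 < r /\
      forall x0 y0 : R, in_ball0 r x0 y0 -> (x0, y0) <> (0, 0) ->
        exists x y theta : R -> R,
          x 0 = x0 /\ y 0 = y0 /\
          (forall t, 0 <= t ->
             solution_at X1 X2 x y t /\ in_ball0 eta (x t) (y t) /\
             continuous theta t /\ polar_angle (theta t) (x t) (y t)) /\
          is_lim x p_infty 0 /\ is_lim y p_infty 0 /\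
          (is_lim theta p_infty p_infty \/ is_lim theta p_infty m_infty).

(* Backward time for X is forward time for -X. *)
Definition focus (X1 X2 : R -> R -> R) : Prop :=
  X1 0 0 = 0 /\ X2 0 0 = 0 /\
  (spirals_to_origin X1 X2 \/
   spirals_to_origin (fun x y => - X1 x y) (fun x y => - X2 x y)).

(* g(x) = a x^k + O(x^(k+1)) as x -> 0, with a <> 0. *)
Definition leading_term (g : R -> R) (a : R) (k : nat) : Prop :=
  a <> 0 /\
  exists C : R, locally 0 (fun x => Rabs (g x - a * x ^ k) <= C * Rabs x ^ (k + 1)).

Definition vanishing_order (g : R -> R) (k : nat) : Prop :=
  exists a : R, leading_term g a k.

Definition field1 (P : R -> R -> R) (x y : R) : R := y + P x y.

Definition implicit_branch (P : R -> R -> R) (F : R -> R) : Prop :=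
  analytic1_near0 F /\ F 0 = 0 /\ locally 0 (fun x => F x + P x (F x) = 0).

Definition f_fun (Q : R -> R -> R) (F : R -> R) (x : R) : R := Q x (F x).

Definition Phi_fun (P Q : R -> R -> R) (F : R -> R) (x : R) : R :=
  divergence (field1 P) Q x (F x).

(* n >= 1 keeps the truncated subtraction 2 * n - 1 meaningful. *)
Definition andreev_number (Q : R -> R -> R) (F : R -> R) (n : nat) : Prop :=
  (1 <= n)%nat /\ vanishing_order (f_fun Q F) (2 * n - 1).

(* Main.v *)
(* With n = m + 1, X = x^n and w = y + P (x, y) = x', the hypotheses say that
   w' = x^m (a X + b w) + O (X^2 + w^2), while X' = n x^m w: up to the factor x^m >= 0
   (m is even) the field is the linear one X' = n w, w' = a X + b w, whose discriminant
   is b^2 + 4 a n.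

   If b^2 + 4 a n >= 0, a curve w = c x^n + k x^(n+1) and a curve w = c' x^n can only be
   crossed in opposite directions, on either side of the y-axis; one of the two sides is
   avoided by the transversal section, and there no orbit can turn around the origin.

   If b^2 + 4 a n < 0, a quadratic form in (X, w) corrected by a multiple of x w |w| is a
   strict Lyapunov function, because b x^m keeps a constant sign, and the orbits
   cross the y-axis infinitely often, always in the same direction. *)
Require Import Defs.
From Stdlib Require Import Reals Lra Lia ZArith Factorial Psatz Classical_Prop.
From Coquelicot Require Import Coquelicot.
Open Scope R_scope.

(** * Power series in two variables *)

(** The choice [X = x^n] is dictated by weights: the remainders of [f] and of Phi, of orders
    [x^(2n)] and [x^n], are [O (X^2)] and [O (X)], and the second one multiplies [w], so every error
    is quadratic in [(X, w)]. The obstacle is that this error does not carry the factor [x^m] of the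
    linear part. Near the y-axis the damping [b x^m w^2] and the angular speed of [(X, w)], of size
    [x^m], both degenerate, while errors of size [|w|^3] persist. The corrector [x w |w|] helps
    because [x' = w] makes its derivative start with [|w|^3], without any factor [x^m]. Rotation
    cannot be read off from a uniform bound on the angular speed either: it is deduced from the fact
    that the Lyapunov function tends to 0, which it could not do on an orbit staying on one side of
    the axis. The implication of Andreev's criterion from monodromy to [b^2 + 4 a n < 0] is proved
    on the way, and it also gives [a < 0]. Orbits are part of the definition of a focus, so they are
    constructed, by Picard iteration for a globally Lipschitz extension of the field. *)

(** What is kept of analyticity: a second-order Taylor bound that is uniform in the base point over
    a whole square. Inside the square it forces [f1] and [f2] to be the partial derivatives. *)
Definition quadratic_expansion (f f1 f2 : R -> R -> R) (r C : R) : Prop :=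
  forall x y x' y' : R,
    Rabs x <= r -> Rabs y <= r -> Rabs x' <= r -> Rabs y' <= r ->
    Rabs (f x' y' - f x y - (f1 x y * (x' - x) + f2 x y * (y' - y)))
      <= C * ((x' - x) ^ 2 + (y' - y) ^ 2).

Lemma Rabs_pow_le (x r : R) (i : nat) : Rabs x <= r -> Rabs (x ^ i) <= r ^ i.
Proof.
  intro H. rewrite <- RPow_abs. apply pow_incr. split; [apply Rabs_pos | exact H].
Qed.

(** The factor [r] on the left stands for the exponent [i - 1] on the right, whose truncation at
    [i = 0] would need a separate case. *)
Lemma pow_diff_bound (r x x' : R) (i : nat) :
  0 < r -> Rabs x <= r -> Rabs x' <= r ->
  r * Rabs (x' ^ i - x ^ i) <= INR i * r ^ i * Rabs (x' - x).
Proof.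
  intros Hr Hx Hx'. induction i as [|i IH].
  - simpl. rewrite Rminus_diag, Rabs_R0. lra.
  - rewrite S_INR. simpl pow.
    replace (x' * x' ^ i - x * x ^ i) with (x' * (x' ^ i - x ^ i) + (x' - x) * x ^ i) by ring.
    eapply Rle_trans; [apply Rmult_le_compat_l; [lra | apply Rabs_triang]|].
    rewrite !Rabs_mult.
    pose proof (Rabs_pow_le x r i Hx) as H1.
    pose proof (Rabs_pos (x' ^ i - x ^ i)) as H2.
    pose proof (Rabs_pos (x' - x)) as H3.
    assert (r * (Rabs x' * Rabs (x' ^ i - x ^ i)) <= r * (INR i * r ^ i * Rabs (x' - x))).
    { eapply Rle_trans; [|apply Rmult_le_compat_l; [lra | exact IH]].
      assert (Rabs x' * Rabs (x' ^ i - x ^ i) <= r * Rabs (x' ^ i - x ^ i))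
        by (apply Rmult_le_compat_r; lra).
      apply Rmult_le_compat_l; lra. }
    assert (Rabs (x' - x) * Rabs (x ^ i) <= Rabs (x' - x) * r ^ i)
      by (apply Rmult_le_compat_l; lra).
    assert (r * (Rabs (x' - x) * Rabs (x ^ i)) <= r * (Rabs (x' - x) * r ^ i))
      by (apply Rmult_le_compat_l; lra).
    nra.
Qed.

Lemma pow_deriv_bound (r x : R) (i : nat) :
  0 < r -> Rabs x <= r -> r * Rabs (INR i * x ^ pred i) <= INR i * r ^ i.
Proof.
  intros Hr Hx. destruct i as [|i].
  - simpl. rewrite !Rmult_0_l, Rabs_R0. lra.
  - rewrite Rabs_mult, (Rabs_pos_eq (INR (S i))) by apply pos_INR.
    change (pred (S i)) with i. simpl pow.
    pose proof (Rabs_pow_le x r i Hx). pose proof (pos_INR (S i)).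
    assert (INR (S i) * Rabs (x ^ i) <= INR (S i) * r ^ i) by (apply Rmult_le_compat_l; lra).
    assert (r * (INR (S i) * Rabs (x ^ i)) <= r * (INR (S i) * r ^ i)) by (apply Rmult_le_compat_l; lra).
    lra.
Qed.

(** The remainder for [i + 1] is [x] times the one for [i] plus [(x' - x) (x'^i - x^i)]; the
    constants add up because [i^2 + i <= (i + 1)^2]. *)
Lemma pow_taylor_bound (r x x' : R) (i : nat) :
  0 < r -> Rabs x <= r -> Rabs x' <= r ->
  r ^ 2 * Rabs (x' ^ i - x ^ i - INR i * x ^ pred i * (x' - x))
    <= INR i ^ 2 * r ^ i * (x' - x) ^ 2.
Proof.
  intros Hr Hx Hx'. induction i as [|i IH].
  - simpl. replace (1 - 1 - 0 * 1 * (x' - x)) with 0 by ring. rewrite Rabs_R0. lra.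
  - assert (E : x' ^ S i - x ^ S i - INR (S i) * x ^ pred (S i) * (x' - x)
      = x * (x' ^ i - x ^ i - INR i * x ^ pred i * (x' - x)) + (x' - x) * (x' ^ i - x ^ i)).
    { destruct i as [|i]; [simpl; ring|].
      rewrite (S_INR (S i)). change (pred (S (S i))) with (S i). change (pred (S i)) with i.
      simpl pow. ring. }
    rewrite E. clear E.
    set (A := x' ^ i - x ^ i - INR i * x ^ pred i * (x' - x)) in *.
    pose proof (pow_diff_bound r x x' i Hr Hx Hx') as HB.
    set (B := x' ^ i - x ^ i) in *.
    pose proof (Rabs_triang (x * A) ((x' - x) * B)) as HT. rewrite !Rabs_mult in HT.
    assert (HA0 := Rabs_pos A). assert (HB0 := Rabs_pos B). assert (HD0 := Rabs_pos (x' - x)).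
    pose proof (pos_INR i). assert (0 <= r ^ i) by (apply pow_le; lra).
    rewrite <- (pow2_abs (x' - x)) in IH |- *. rewrite S_INR. simpl (r ^ S i).
    set (D := Rabs (x' - x)) in *. set (p := r ^ i) in *. set (n := INR i) in *.
    assert (r ^ 2 * (Rabs x * Rabs A) <= r * (n ^ 2 * p * D ^ 2)).
    { replace (r ^ 2 * (Rabs x * Rabs A)) with (Rabs x * (r ^ 2 * Rabs A)) by ring.
      apply Rmult_le_compat; try assumption; [apply Rabs_pos |]. apply Rmult_le_pos; [apply pow2_ge_0|apply Rabs_pos]. }
    assert (r ^ 2 * (D * Rabs B) <= r * (n * p * D ^ 2)).
    { replace (r ^ 2 * (D * Rabs B)) with (r * D * (r * Rabs B)) by ring.
      replace (r * (n * p * D ^ 2)) with (r * D * (n * p * D)) by ring.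
      apply Rmult_le_compat_l; [nra | exact HB]. }
    assert (0 <= r * p * D ^ 2 * (n + 1)).
    { repeat apply Rmult_le_pos; try lra. }
    assert (r ^ 2 * Rabs (x * A + (x' - x) * B) <= r ^ 2 * (Rabs x * Rabs A + D * Rabs B))
      by (apply Rmult_le_compat_l; [nra | exact HT]).
    nra.
Qed.

(** The remainder splits into a one-variable remainder in [x], a mixed product of first-order
    increments and a one-variable remainder in [y]. The three constants fit into [(i + j)^2], which
    depends only on the total degree, the index along which the double series is summed. *)
Lemma monomial_taylor_bound (r x y x' y' : R) (i j : nat) :
  0 < r -> Rabs x <= r -> Rabs y <= r -> Rabs x' <= r -> Rabs y' <= r ->
  r ^ 2 * Rabs (x' ^ i * y' ^ j - x ^ i * y ^ j
                - (INR i * x ^ pred i * y ^ j * (x' - x) + x ^ i * (INR j * y ^ pred j) * (y' - y)))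
    <= INR (i + j) ^ 2 * r ^ (i + j) * ((x' - x) ^ 2 + (y' - y) ^ 2).
Proof.
  intros Hr Hx Hy Hx' Hy'.
  pose proof (pow_taylor_bound r x x' i Hr Hx Hx') as T1.
  pose proof (pow_taylor_bound r y y' j Hr Hy Hy') as T2.
  pose proof (pow_diff_bound r y y' j Hr Hy Hy') as D2.
  pose proof (pow_deriv_bound r x i Hr Hx) as D1.
  pose proof (Rabs_pow_le y' r j Hy') as B1.
  pose proof (Rabs_pow_le x r i Hx) as B2.
  replace (x' ^ i * y' ^ j - x ^ i * y ^ j
                - (INR i * x ^ pred i * y ^ j * (x' - x) + x ^ i * (INR j * y ^ pred j) * (y' - y)))
   with ((x' ^ i - x ^ i - INR i * x ^ pred i * (x' - x)) * y' ^ j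
      + (INR i * x ^ pred i) * (y' ^ j - y ^ j) * (x' - x)
      + x ^ i * (y' ^ j - y ^ j - INR j * y ^ pred j * (y' - y))) by ring.
  set (A := x' ^ i - x ^ i - INR i * x ^ pred i * (x' - x)) in *.
  set (B := y' ^ j - y ^ j - INR j * y ^ pred j * (y' - y)) in *.
  set (G := INR i * x ^ pred i) in *. set (H := y' ^ j - y ^ j) in *.
  rewrite plus_INR, pow_add.
  pose proof (pos_INR i) as Hi. pose proof (pos_INR j) as Hj.
  assert (Pi : 0 <= r ^ i) by (apply pow_le; lra). assert (Pj : 0 <= r ^ j) by (apply pow_le; lra).
  rewrite <- (pow2_abs (x' - x)), <- (pow2_abs (y' - y)) in *.
  assert (HT : Rabs (A * y' ^ j + G * H * (x' - x) + x ^ i * B)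
     <= Rabs A * Rabs (y' ^ j) + Rabs G * Rabs H * Rabs (x' - x) + Rabs (x ^ i) * Rabs B).
  { rewrite <- !Rabs_mult. eapply Rle_trans; [apply Rabs_triang|].
    apply Rplus_le_compat_r, Rabs_triang. }
  set (dx := Rabs (x' - x)) in *. set (dy := Rabs (y' - y)) in *.
  assert (0 <= dx) by apply Rabs_pos. assert (0 <= dy) by apply Rabs_pos.
  set (p := r ^ i) in *. set (q := r ^ j) in *. set (n := INR i) in *. set (m := INR j) in *.
  assert (E1 : r ^ 2 * (Rabs A * Rabs (y' ^ j)) <= (n ^ 2 * p * dx ^ 2) * q).
  { rewrite <- Rmult_assoc. apply Rmult_le_compat; auto using Rabs_pos.
    apply Rmult_le_pos; [nra | apply Rabs_pos]. }
  assert (E3 : r ^ 2 * (Rabs (x ^ i) * Rabs B) <= p * (m ^ 2 * q * dy ^ 2)).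
  { replace (r ^ 2 * (Rabs (x ^ i) * Rabs B)) with (Rabs (x ^ i) * (r ^ 2 * Rabs B)) by ring.
    apply Rmult_le_compat; auto using Rabs_pos.
    apply Rmult_le_pos; [nra | apply Rabs_pos]. }
  assert (E2 : r ^ 2 * (Rabs G * Rabs H * dx) <= (n * p) * (m * q * dy) * dx).
  { replace (r ^ 2 * (Rabs G * Rabs H * dx)) with ((r * Rabs G) * (r * Rabs H) * dx) by ring.
    apply Rmult_le_compat_r; [assumption|].
    apply Rmult_le_compat; auto; apply Rmult_le_pos; auto using Rabs_pos; lra. }
  eapply Rle_trans; [apply Rmult_le_compat_l; [nra | exact HT]|].
  assert (0 <= p * q) by nra.
  assert (Q : n ^ 2 * dx ^ 2 + n * m * dy * dx + m ^ 2 * dy ^ 2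
     <= (n + m) ^ 2 * (dx ^ 2 + dy ^ 2)).
  { assert (0 <= n * m) by nra. assert (0 <= dx ^ 2 + dy ^ 2 - dx * dy) by nra.
    assert (0 <= n * m * (dx ^ 2 + dy ^ 2 - dx * dy)) by (apply Rmult_le_pos; assumption).
    assert (0 <= n * m * (dx ^ 2 + dy ^ 2)) by (apply Rmult_le_pos; nra).
    nra. }
  pose proof (Rmult_le_compat_l (p * q) _ _ H2 Q). nra.
Qed.

Lemma INR_le_pow2 (m : nat) : INR m <= 2 ^ m.
Proof.
  induction m as [|m IH]; [simpl; lra|].
  rewrite S_INR. simpl pow. pose proof (pow_R1_Rle 2 m ltac:(lra)). lra.
Qed.

Lemma sum_f_R0_Rabs_le (t u : nat -> R) (m : nat) :
  (forall i, (i <= m)%nat -> Rabs (t i) <= u i) -> Rabs (sum_f_R0 t m) <= sum_f_R0 u m.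
Proof.
  intro H. eapply Rle_trans; [apply Rsum_abs|]. apply sum_Rle. auto.
Qed.

Lemma Series_Rabs_le (t u : nat -> R) (l : R) :
  (forall m, Rabs (t m) <= u m) -> ex_series u -> is_series t l -> Rabs l <= Series u.
Proof.
  intros H Hu Ht. rewrite <- (is_series_unique _ _ Ht).
  assert (ex_series (fun m => Rabs (t m))).
  { apply (ex_series_le (fun m => Rabs (t m)) u); [|exact Hu].
    intro m. unfold norm; simpl; unfold abs; simpl. rewrite Rabs_Rabsolu. apply H. }
  eapply Rle_trans; [apply Series_Rabs; assumption|].
  apply Series_le; [|exact Hu]. intro m. split; [apply Rabs_pos | apply H].
Qed.

Lemma analytic2_quadratic_expansion (f : R -> R -> R) :
  analytic2_at f 0 0 ->
  exists (f1 f2 : R -> R -> R) (r C : R), 0 < r /\ quadratic_expansion f f1 f2 r C.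
Proof.
  intros (c & r0 & Hr0 & Hc).
  (* The series converges absolutely at [(s, s)]. The ratio 4 is [2^2]: since [m <= 2^m], it gives
     [m^2 r^m <= s^m], which absorbs the factor [m^2] of the monomial bound. *)
  set (s := r0 / 2). set (r := s / 4).
  assert (Hr : 0 < r) by (unfold r, s; lra).
  assert (Hs : 0 < s) by (unfold s; lra).
  destruct (Hc s s) as [Hsum _]; try (rewrite Rabs_pos_eq; unfold s; lra).
  set (A := fun m => sum_f_R0 (fun i => Rabs (c i (m - i)%nat * s ^ i * s ^ (m - i))) m) in *.
  (* Termwise partial derivatives, grouped by total degree; at [i = 0] the value of [pred] is
     harmless because of the factor [INR i]. *)
  set (g1 := fun x y m => sum_f_R0 (fun i => c i (m - i)%nat * (INR i * x ^ pred i * y ^ (m - i))) m).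
  set (g2 := fun x y m => sum_f_R0 (fun i => c i (m - i)%nat * (x ^ i * (INR (m - i) * y ^ pred (m - i)))) m).
  assert (Hpow : forall m, INR m * r ^ m <= s ^ m /\ INR m ^ 2 * r ^ m <= s ^ m).
  { intro m. pose proof (INR_le_pow2 m) as H2. pose proof (pos_INR m).
    replace s with ((2 * 2) * r) by (unfold r; lra). rewrite !Rpow_mult_distr.
    assert (0 <= r ^ m) by (apply pow_le; lra).
    assert (1 <= 2 ^ m) by (apply pow_R1_Rle; lra).
    split; apply Rmult_le_compat_r; nra. }
  assert (Habs : forall m i, (i <= m)%nat ->
     Rabs (c i (m - i)%nat) * s ^ m = Rabs (c i (m - i)%nat * s ^ i * s ^ (m - i))).
  { intros m i Hi. rewrite Rmult_assoc, <- pow_add. replace (i + (m - i))%nat with m by lia.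
    rewrite Rabs_mult, (Rabs_pos_eq (s ^ m)); [reflexivity | apply pow_le; lra]. }
  assert (Hg1 : forall x y, Rabs x <= r -> Rabs y <= r -> ex_series (g1 x y)).
  { intros x y Hx Hy.
    apply (ex_series_le (g1 x y) (fun m => / r * A m)); [|apply (ex_series_scal_l (V := R_NormedModule)); exact Hsum].
    intro m. unfold norm; simpl; unfold abs; simpl. unfold g1, A.
    rewrite scal_sum. apply sum_f_R0_Rabs_le. intros i Hi. rewrite <- Habs by exact Hi.
    apply Rle_div_r; [exact Hr|].
    rewrite !Rabs_mult. pose proof (pow_deriv_bound r x i Hr Hx) as H1.
    pose proof (Rabs_pow_le y r (m - i) Hy) as H2. rewrite Rabs_mult in H1.
    destruct (Hpow m) as [H3 _].
    assert (INR i * r ^ m <= s ^ m).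
    { eapply Rle_trans; [apply Rmult_le_compat_r; [apply pow_le; lra | apply le_INR, Hi] | exact H3]. }
    pose proof (Rmult_le_compat _ _ _ _
       (Rmult_le_pos _ _ (Rlt_le _ _ Hr) (Rmult_le_pos _ _ (Rabs_pos (INR i)) (Rabs_pos (x ^ pred i))))
       (Rabs_pos _) H1 H2) as H4.
    assert (Epow : r ^ i * r ^ (m - i) = r ^ m) by (rewrite <- pow_add; f_equal; lia).
    rewrite (Rmult_assoc (INR i) (r ^ i)), Epow in H4.
    pose proof (Rabs_pos (c i (m - i)%nat)).
    match goal with |- ?L <= _ => replace L
      with (Rabs (c i (m - i)%nat) * (r * (Rabs (INR i) * Rabs (x ^ pred i)) * Rabs (y ^ (m - i)))) by ring end.
    apply Rmult_le_compat_l; lra. }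
  assert (Hg2 : forall x y, Rabs x <= r -> Rabs y <= r -> ex_series (g2 x y)).
  { intros x y Hx Hy.
    apply (ex_series_le (g2 x y) (fun m => / r * A m)); [|apply (ex_series_scal_l (V := R_NormedModule)); exact Hsum].
    intro m. unfold norm; simpl; unfold abs; simpl. unfold g2, A.
    rewrite scal_sum. apply sum_f_R0_Rabs_le. intros i Hi. rewrite <- Habs by exact Hi.
    apply Rle_div_r; [exact Hr|].
    rewrite !Rabs_mult. pose proof (pow_deriv_bound r y (m - i) Hr Hy) as H1.
    pose proof (Rabs_pow_le x r i Hx) as H2. rewrite Rabs_mult in H1.
    destruct (Hpow m) as [H3 _].
    assert (INR (m - i) * r ^ m <= s ^ m).
    { eapply Rle_trans; [apply Rmult_le_compat_r; [apply pow_le; lra | apply (le_INR (m - i) m); lia] | exact H3]. }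
    pose proof (Rmult_le_compat _ _ _ _
       (Rmult_le_pos _ _ (Rlt_le _ _ Hr) (Rmult_le_pos _ _ (Rabs_pos (INR (m - i))) (Rabs_pos (y ^ pred (m - i)))))
       (Rabs_pos _) H1 H2) as H4.
    assert (Epow : r ^ (m - i) * r ^ i = r ^ m) by (rewrite <- pow_add; f_equal; lia).
    rewrite (Rmult_assoc (INR (m - i)) (r ^ (m - i))), Epow in H4.
    pose proof (Rabs_pos (c i (m - i)%nat)).
    match goal with |- ?L <= _ => replace L
      with (Rabs (c i (m - i)%nat) * (r * (Rabs (INR (m - i)) * Rabs (y ^ pred (m - i))) * Rabs (x ^ i))) by ring end.
    apply Rmult_le_compat_l; lra. }
  exists (fun x y => Series (g1 x y)), (fun x y => Series (g2 x y)), r, (Series A / r ^ 2).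
  split; [exact Hr|].
  intros x y x' y' Hx Hy Hx' Hy'.
  assert (Hlt : forall z, Rabs z <= r -> Rabs z < r0) by (intros; unfold r, s in *; lra).
  destruct (Hc x y) as [_ Sf]; auto. destruct (Hc x' y') as [_ Sf']; auto.
  rewrite Rplus_0_l, Rplus_0_l in Sf, Sf'.
  pose proof (is_series_scal_r (x' - x) _ _ (Series_correct _ (Hg1 x y Hx Hy))) as S1.
  pose proof (is_series_scal_r (y' - y) _ _ (Series_correct _ (Hg2 x y Hx Hy))) as S2.
  pose proof (is_series_minus _ _ _ _ (is_series_minus _ _ _ _ Sf' Sf) (is_series_plus _ _ _ _ S1 S2)) as S.
  set (q := (x' - x) ^ 2 + (y' - y) ^ 2).
  replace (Series A / r ^ 2 * q) with (Series (fun m => q / r ^ 2 * A m))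
    by (rewrite Series_scal_l; field; lra).
  eapply Series_Rabs_le; [| apply (ex_series_scal_l (V := R_NormedModule)); exact Hsum | exact S].
  intro m. unfold minus, plus, opp; simpl. unfold g1, g2, A, Rdiv.
  rewrite <- !Rmult_assoc.
  rewrite (Rmult_comm (sum_f_R0 _ _) (x' - x)), (Rmult_comm (sum_f_R0 _ _) (y' - y)).
  rewrite !scal_sum. rewrite <- sum_plus. rewrite <- !Rminus_def, <- !minus_sum.
  apply sum_f_R0_Rabs_le. intros i Hi. rewrite <- Habs by exact Hi.
  pose proof (monomial_taylor_bound r x y x' y' i (m - i) Hr Hx Hy Hx' Hy') as M.
  replace (i + (m - i))%nat with m in M by lia. destruct (Hpow m) as [_ H3].
  fold q in M. assert (0 <= q) by (apply Rplus_le_le_0_compat; apply pow2_ge_0).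
  match type of M with _ * Rabs ?t <= _ => match goal with |- Rabs ?u <= _ =>
     replace u with (c i (m - i)%nat * t) by ring end end.
  rewrite Rabs_mult. apply Rmult_le_reg_l with (r ^ 2); [apply pow_lt; lra|].
  match goal with |- _ <= ?u => replace u with (Rabs (c i (m - i)%nat) * (s ^ m * q)) by (field; lra) end.
  rewrite <- Rmult_assoc, (Rmult_comm (r ^ 2)), Rmult_assoc.
  apply Rmult_le_compat_l; [apply Rabs_pos|]. eapply Rle_trans; [exact M|].
  apply Rmult_le_compat_r; assumption.
Qed.

(** * Lipschitz gradients and germs with vanishing 1-jet *)

Definition lipschitz2 (f : R -> R -> R) (r L : R) : Prop :=
  forall x y x' y' : R,
    Rabs x <= r -> Rabs y <= r -> Rabs x' <= r -> Rabs y' <= r ->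
    Rabs (f x' y' - f x y) <= L * (Rabs (x' - x) + Rabs (y' - y)).

Lemma quadratic_expansion_weaken (f f1 f2 : R -> R -> R) (r C r' C' : R) :
  r' <= r -> C <= C' -> quadratic_expansion f f1 f2 r C -> quadratic_expansion f f1 f2 r' C'.
Proof.
  intros Hr HC H x y x' y' Hx Hy Hx' Hy'.
  eapply Rle_trans; [apply H; lra|]. apply Rmult_le_compat_r; [|exact HC].
  apply Rplus_le_le_0_compat; apply pow2_ge_0.
Qed.

Lemma lipschitz2_weaken (f : R -> R -> R) (r L r' L' : R) :
  r' <= r -> L <= L' -> lipschitz2 f r L -> lipschitz2 f r' L'.
Proof.
  intros Hr HC H x y x' y' Hx Hy Hx' Hy'.
  eapply Rle_trans; [apply H; lra|]. apply Rmult_le_compat_r; [|exact HC].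
  apply Rplus_le_le_0_compat; apply Rabs_pos.
Qed.

Lemma quadratic_expansion_swap (f f1 f2 : R -> R -> R) (r C : R) :
  quadratic_expansion f f1 f2 r C ->
  quadratic_expansion (fun x y => f y x) (fun x y => f2 y x) (fun x y => f1 y x) r C.
Proof.
  intros H x y x' y' Hx Hy Hx' Hy'. specialize (H y x y' x' Hy Hx Hy' Hx').
  rewrite (Rplus_comm (f2 y x * _)), (Rplus_comm ((x' - x) ^ 2)). exact H.
Qed.

(** The value at [(x' + d, y')] is reached from [(x, y)] directly and through [(x', y')], where [d]
    is the distance of the two points in the sum norm; the two ways differ by
    [(f1 x' y' - f1 x y) d]. The errors [5 C d^2], [C d^2] and [C d^2] give the 7, and the radius
    [r / 8] leaves room for the shifted point. *)
Lemma gradient_lipschitz1 (f f1 f2 : R -> R -> R) (r C : R) :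
  0 <= C -> quadratic_expansion f f1 f2 r C -> lipschitz2 f1 (r / 8) (7 * C).
Proof.
  intros HC H x y x' y' Hx Hy Hx' Hy'.
  set (d := Rabs (x' - x) + Rabs (y' - y)).
  assert (Hdx := Rabs_pos (x' - x)). assert (Hdy := Rabs_pos (y' - y)).
  assert (Hd : d <= r / 2).
  { unfold d. pose proof (Rabs_triang x' (- x)). pose proof (Rabs_triang y' (- y)).
    rewrite Rabs_Ropp in *. unfold Rminus. lra. }
  destruct (Req_dec d 0) as [Hd0|Hd0].
  { rewrite Hd0, Rmult_0_r. unfold d in Hd0.
    assert (x' = x) by (apply Rminus_diag_uniq; apply Rabs_eq_0; lra).
    assert (y' = y) by (apply Rminus_diag_uniq; apply Rabs_eq_0; lra). subst.
    rewrite Rminus_diag, Rabs_R0. lra. }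
  assert (Hdp : 0 < d) by (unfold d in *; lra).
  assert (Hxd : Rabs (x' + d) <= r).
  { eapply Rle_trans; [apply Rabs_triang|]. rewrite (Rabs_pos_eq d); lra. }
  assert (Hr : 0 <= r) by (pose proof (Rabs_pos x); lra).
  pose proof (H x' y' (x' + d) y' ltac:(lra) ltac:(lra) ltac:(lra) ltac:(lra)) as E1.
  pose proof (H x y (x' + d) y' ltac:(lra) ltac:(lra) ltac:(lra) ltac:(lra)) as E2.
  pose proof (H x y x' y' ltac:(lra) ltac:(lra) ltac:(lra) ltac:(lra)) as E3.
  replace ((x' + d - x') ^ 2 + (y' - y') ^ 2) with (d ^ 2) in E1 by ring.
  assert (Q1 : (x' - x) ^ 2 <= d ^ 2 /\ (y' - y) ^ 2 <= d ^ 2 /\ (x' - x) ^ 2 + (y' - y) ^ 2 <= d ^ 2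
     /\ (x' + d - x) ^ 2 <= 4 * d ^ 2).
  { rewrite <- (pow2_abs (x' - x)), <- (pow2_abs (y' - y)), <- (pow2_abs (x' + d - x)).
    replace (x' + d - x) with ((x' - x) + d) by ring.
    pose proof (Rabs_triang (x' - x) d) as HT. rewrite (Rabs_pos_eq d) in HT by lra.
    pose proof (Rabs_pos (x' - x + d)).
    assert (d = Rabs (x' - x) + Rabs (y' - y)) by reflexivity.
    repeat split; nra. }
  destruct Q1 as (Q1 & Q2 & Q3 & Q4).
  pose proof (Rmult_le_compat_l C _ _ HC Q3) as R3.
  assert (R2 : C * ((x' + d - x) ^ 2 + (y' - y) ^ 2) <= C * (5 * d ^ 2))
    by (apply Rmult_le_compat_l; lra).
  assert (Hfin : Rabs ((f1 x' y' - f1 x y) * d) <= 7 * C * d * d).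
  { apply Rabs_le_between in E1, E2, E3. apply Rabs_le. nra. }
  rewrite Rabs_mult, (Rabs_pos_eq d) in Hfin by lra.
  apply Rmult_le_reg_r with d; assumption.
Qed.

Lemma gradient_lipschitz2 (f f1 f2 : R -> R -> R) (r C : R) :
  0 <= C -> quadratic_expansion f f1 f2 r C -> lipschitz2 f2 (r / 8) (7 * C).
Proof.
  intros HC H x y x' y' Hx Hy Hx' Hy'. rewrite Rplus_comm.
  exact (gradient_lipschitz1 _ _ _ r C HC (quadratic_expansion_swap _ _ _ _ _ H) y x y' x' Hy Hx Hy' Hx').
Qed.

Lemma quadratic_expansion_differentiable (f f1 f2 : R -> R -> R) (r C x y : R) :
  quadratic_expansion f f1 f2 r C -> Rabs x < r -> Rabs y < r ->
  differentiable_pt_lim f x y (f1 x y) (f2 x y).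
Proof.
  intros H Hx Hy eps.
  assert (HC := Rabs_pos C). assert (He := cond_pos eps).
  assert (Hd : 0 < Rmin (eps / (2 * (Rabs C + 1))) (Rmin (r - Rabs x) (r - Rabs y))).
  { repeat apply Rmin_pos; try lra. apply Rdiv_lt_0_compat; lra. }
  exists (mkposreal _ Hd). simpl. intros u v Hu Hv.
  pose proof (Rmin_l (eps / (2 * (Rabs C + 1))) (Rmin (r - Rabs x) (r - Rabs y))) as M1.
  pose proof (Rmin_r (eps / (2 * (Rabs C + 1))) (Rmin (r - Rabs x) (r - Rabs y))) as M2.
  pose proof (Rmin_l (r - Rabs x) (r - Rabs y)). pose proof (Rmin_r (r - Rabs x) (r - Rabs y)).
  assert (Rabs u <= r).
  { replace u with ((u - x) + x) by ring. eapply Rle_trans; [apply Rabs_triang|]. lra. }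
  assert (Rabs v <= r).
  { replace v with ((v - y) + y) by ring. eapply Rle_trans; [apply Rabs_triang|]. lra. }
  eapply Rle_trans; [apply (H x y u v); lra|].
  set (m := Rmax (Rabs (u - x)) (Rabs (v - y))).
  assert (Hm1 : Rabs (u - x) <= m) by apply Rmax_l.
  assert (Hm2 : Rabs (v - y) <= m) by apply Rmax_r.
  assert (Hm3 : m <= eps / (2 * (Rabs C + 1))) by (apply Rmax_lub; lra).
  rewrite <- (pow2_abs (u - x)), <- (pow2_abs (v - y)).
  assert (Hux := Rabs_pos (u - x)). assert (Hvy := Rabs_pos (v - y)).
  assert (HCm : 2 * Rabs C * m <= eps).
  { apply (Rmult_le_compat_l (2 * (Rabs C + 1))) in Hm3; [|lra].
    replace (2 * (Rabs C + 1) * (eps / (2 * (Rabs C + 1)))) with (pos eps) in Hm3 by (field; lra). nra. }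
  pose proof (RRle_abs C).
  assert (Rabs (u - x) ^ 2 + Rabs (v - y) ^ 2 <= 2 * m * m) by nra.
  assert (0 <= Rabs (u - x) ^ 2 + Rabs (v - y) ^ 2) by nra.
  nra.
Qed.

Lemma quadratic_expansion_derive1 (f f1 f2 : R -> R -> R) (r C x y : R) :
  quadratic_expansion f f1 f2 r C -> Rabs x < r -> Rabs y < r ->
  is_derive (fun u => f u y) x (f1 x y).
Proof.
  intros H Hx Hy. apply is_derive_Reals.
  replace (f1 x y) with (f1 x y * 1 + f2 x y * 0) by ring.
  apply (derivable_pt_lim_comp_2d f (fun u => u) (fun _ => y)).
  - apply (quadratic_expansion_differentiable f f1 f2 r C); assumption.
  - apply derivable_pt_lim_id.
  - apply derivable_pt_lim_const.
Qed.

Lemma quadratic_expansion_derive2 (f f1 f2 : R -> R -> R) (r C x y : R) :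
  quadratic_expansion f f1 f2 r C -> Rabs x < r -> Rabs y < r ->
  is_derive (fun v => f x v) y (f2 x y).
Proof.
  intros H Hx Hy. apply quadratic_expansion_swap in H.
  exact (quadratic_expansion_derive1 _ _ _ r C y x H Hy Hx).
Qed.

Lemma jet_zero_1 (f f1 f2 : R -> R -> R) (r C : R) :
  0 < r -> quadratic_expansion f f1 f2 r C -> jet_zero 1 f ->
  f 0 0 = 0 /\ f1 0 0 = 0 /\ f2 0 0 = 0.
Proof.
  intros Hr H Hj.
  assert (H0 : Rabs 0 < r) by (rewrite Rabs_R0; exact Hr).
  assert (D1 : Derive (fun u => f u 0) 0 = f1 0 0)
    by (apply is_derive_unique, (quadratic_expansion_derive1 f f1 f2 r C); assumption).
  assert (D2 : Derive (fun v => f 0 v) 0 = f2 0 0)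
    by (apply is_derive_unique, (quadratic_expansion_derive2 f f1 f2 r C); assumption).
  assert (E : forall x y, DL_pol 1 f 0 0 x y = f 0 0 + f2 0 0 * y + f1 0 0 * x).
  { intros x y. rewrite <- D1, <- D2. unfold DL_pol, differential, partial_derive; simpl.
    unfold Binomial.C; simpl. field. }
  pose proof (Hj 0 0) as E0. pose proof (Hj 1 0) as E1. pose proof (Hj 0 1) as E2.
  rewrite E in E0, E1, E2. lra.
Qed.

(** One radius and one constant serve all the bounds, so that [P] and [Q] can share them after
    weakening. *)
Definition flat_germ (f f1 f2 : R -> R -> R) (r C : R) : Prop :=
  quadratic_expansion f f1 f2 r C /\ lipschitz2 f1 r C /\ lipschitz2 f2 r C /\
  f 0 0 = 0 /\ f1 0 0 = 0 /\ f2 0 0 = 0.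

Lemma flat_germ_weaken (f f1 f2 : R -> R -> R) (r C r' C' : R) :
  r' <= r -> C <= C' -> flat_germ f f1 f2 r C -> flat_germ f f1 f2 r' C'.
Proof.
  intros Hr HC (H1 & H2 & H3 & H4).
  split; [|split; [|split]]; try assumption.
  - eapply quadratic_expansion_weaken; eassumption.
  - eapply lipschitz2_weaken; eassumption.
  - eapply lipschitz2_weaken; eassumption.
Qed.

Lemma analytic2_flat_germ (f : R -> R -> R) :
  analytic2_near0 f -> jet_zero 1 f ->
  exists (f1 f2 : R -> R -> R) (r C : R), 0 < r /\ 0 < C /\ flat_germ f f1 f2 r C.
Proof.
  intros Ha Hj. apply locally_2d_singleton in Ha.
  destruct (analytic2_quadratic_expansion f Ha) as (f1 & f2 & r & C & Hr & H).
  pose proof (Rabs_pos C). pose proof (RRle_abs C).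
  assert (H' : quadratic_expansion f f1 f2 r (Rabs C))
    by (apply (quadratic_expansion_weaken f f1 f2 r C); [apply Rle_refl | assumption | exact H]).
  exists f1, f2, (r / 8), (7 * Rabs C + 1). split; [lra|]. split; [lra|]. repeat apply conj.
  - apply (quadratic_expansion_weaken f f1 f2 r (Rabs C)); [lra | lra | exact H'].
  - apply (lipschitz2_weaken f1 (r / 8) (7 * Rabs C)); [apply Rle_refl | lra |].
    apply (gradient_lipschitz1 f f1 f2); assumption.
  - apply (lipschitz2_weaken f2 (r / 8) (7 * Rabs C)); [apply Rle_refl | lra |].
    apply (gradient_lipschitz2 f f1 f2); assumption.
  - apply (jet_zero_1 f f1 f2 r C); assumption.
  - apply (jet_zero_1 f f1 f2 r C); assumption.
  - apply (jet_zero_1 f f1 f2 r C); assumption.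
Qed.

(** * Expansion of the field along the curve [x' = 0] *)

Lemma Rabs_mult_le (a b A B : R) : Rabs a <= A -> Rabs b <= B -> Rabs (a * b) <= A * B.
Proof.
  intros Ha Hb. rewrite Rabs_mult. apply Rmult_le_compat; auto using Rabs_pos.
Qed.

Lemma Rabs_plus_le (a b A B : R) : Rabs a <= A -> Rabs b <= B -> Rabs (a + b) <= A + B.
Proof.
  intros Ha Hb. eapply Rle_trans; [apply Rabs_triang|]. lra.
Qed.

(** Convergence at [e / 2] already makes the radius of convergence positive, so the sum of the
    series, which coincides with [F] nearby, is continuous at 0. *)
Lemma analytic1_continuous (F : R -> R) : analytic1_near0 F -> continuous F 0.
Proof.
  intro H. apply locally_singleton in H. destruct H as (c & e & He).
  assert (Hc : forall x, Rabs x < e -> is_pseries c x (F x)).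
  { intros x Hx. rewrite <- (Rminus_0_r x) at 1. apply He.
    unfold ball; simpl; unfold AbsRing_ball, abs, minus, plus, opp; simpl.
    rewrite Ropp_0, Rplus_0_r. exact Hx. }
  assert (Hp := cond_pos e).
  assert (Hrad : Rbar_lt (Rabs 0) (CV_radius c)).
  { rewrite Rabs_R0. apply Rbar_lt_le_trans with (Rabs (e / 2)).
    - simpl. rewrite Rabs_pos_eq; lra.
    - apply Rbar_not_lt_le. intro Hlt. apply (CV_disk_outside c (e / 2) Hlt).
      apply ex_series_lim_0. exists (F (e / 2)).
      assert (Hs := Hc (e / 2)). rewrite Rabs_pos_eq in Hs by lra.
      apply (proj1 (is_pseries_R c (e / 2) (F (e / 2)))). apply Hs. lra. }
  apply continuous_ext_loc with (PSeries c).
  - exists e. intros x Hx. apply is_pseries_unique, Hc.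
    revert Hx. unfold ball; simpl; unfold AbsRing_ball, abs, minus, plus, opp; simpl.
    rewrite Ropp_0, Rplus_0_r. exact (fun h => h).
  - apply continuity_pt_filterlim, PSeries_continuity, Hrad.
Qed.

Lemma locally_0_Rabs (A : R -> Prop) :
  locally 0 A -> exists r : R, 0 < r /\ forall x, Rabs x < r -> A x.
Proof.
  intros (e & He). exists e. split; [apply cond_pos|]. intros x Hx. apply He.
  unfold ball; simpl; unfold AbsRing_ball, abs, minus, plus, opp; simpl.
  rewrite Ropp_0, Rplus_0_r. exact Hx.
Qed.

Lemma flat_germ_bound (f f1 f2 : R -> R -> R) (r C x y : R) :
  flat_germ f f1 f2 r C -> Rabs x <= r -> Rabs y <= r -> Rabs (f x y) <= C * (x ^ 2 + y ^ 2).
Proof.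
  intros (H & _ & _ & H0 & H1 & H2) Hx Hy.
  assert (Hr : Rabs 0 <= r) by (rewrite Rabs_R0; pose proof (Rabs_pos x); lra).
  specialize (H 0 0 x y Hr Hr Hx Hy). rewrite H0, H1, H2 in H.
  replace (f x y - 0 - (0 * (x - 0) + 0 * (y - 0))) with (f x y) in H by ring.
  rewrite !Rminus_0_r in H. exact H.
Qed.

Lemma flat_germ_gradient_bound (f f1 f2 : R -> R -> R) (r C x y : R) :
  flat_germ f f1 f2 r C -> Rabs x <= r -> Rabs y <= r ->
  Rabs (f1 x y) <= C * (Rabs x + Rabs y) /\ Rabs (f2 x y) <= C * (Rabs x + Rabs y).
Proof.
  intros (_ & L1 & L2 & _ & H1 & H2) Hx Hy.
  assert (Hr : Rabs 0 <= r) by (rewrite Rabs_R0; pose proof (Rabs_pos x); lra).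
  specialize (L1 0 0 x y Hr Hr Hx Hy). specialize (L2 0 0 x y Hr Hr Hx Hy).
  rewrite H1, !Rminus_0_r in L1. rewrite H2, !Rminus_0_r in L2. split; assumption.
Qed.

(** From [F = - P (x, F)] follows [|F| <= C (x^2 + F^2)], and [C z^2 <= z / 2] for
    [0 <= z < 1 / (2 C)] turns this into [|F| <= |x| / 2 + |F| / 2]. Continuity of [F] at 0 brings
    [|F|] below that threshold. *)
Lemma implicit_branch_bound (P P1 P2 : R -> R -> R) (F : R -> R) (r C : R) :
  0 < r -> 0 < C -> flat_germ P P1 P2 r C -> implicit_branch P F ->
  exists r' : R, 0 < r' /\ forall x, Rabs x < r' -> Rabs (F x) <= Rabs x /\ F x + P x (F x) = 0.
Proof.
  intros Hr HC HP (HF & HF0 & HE).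
  apply locally_0_Rabs in HE. destruct HE as (r1 & Hr1 & HE).
  pose proof (analytic1_continuous F HF) as Hc. unfold continuous in Hc. rewrite HF0 in Hc.
  assert (Hm : 0 < Rmin r (/ (2 * C))).
  { apply Rmin_pos; [exact Hr|]. apply Rinv_0_lt_compat. lra. }
  assert (HL := Hc (fun z => Rabs z < Rmin r (/ (2 * C)))).
  assert (Hloc : locally 0 (fun z : R => Rabs z < Rmin r (/ (2 * C)))).
  { exists (mkposreal _ Hm). intros z Hz. revert Hz.
    unfold ball; simpl; unfold AbsRing_ball, abs, minus, plus, opp; simpl.
    rewrite Ropp_0, Rplus_0_r. exact (fun h => h). }
  apply HL, locally_0_Rabs in Hloc. destruct Hloc as (r2 & Hr2 & HB).
  exists (Rmin (Rmin r1 r2) (Rmin r (/ (2 * C)))). split.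
  { repeat apply Rmin_pos; assumption || (apply Rinv_0_lt_compat; lra). }
  intros x Hx.
  apply Rmin_Rgt in Hx. destruct Hx as [Hx12 Hx34].
  apply Rmin_Rgt in Hx12. destruct Hx12 as [Hx1 Hx2].
  apply Rmin_Rgt in Hx34. destruct Hx34 as [Hx3 Hx4].
  specialize (HE x Hx1). specialize (HB x Hx2). simpl in HB.
  apply Rmin_Rgt in HB. destruct HB as [HB1 HB2].
  split; [|exact HE].
  pose proof (flat_germ_bound P P1 P2 r C x (F x) HP ltac:(lra) ltac:(lra)) as Hb.
  replace (P x (F x)) with (- F x) in Hb by lra. rewrite Rabs_Ropp in Hb.
  rewrite <- (pow2_abs x), <- (pow2_abs (F x)) in Hb.
  assert (HFp := Rabs_pos (F x)). assert (Hxp := Rabs_pos x).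
  assert (E : forall z, 0 <= z -> z < / (2 * C) -> C * z ^ 2 <= z / 2).
  { intros z Hz Hz'. apply (Rmult_lt_compat_l C) in Hz'; [|exact HC].
    replace (C * / (2 * C)) with (1 / 2) in Hz' by (field; lra). nra. }
  pose proof (E _ HFp HB2). pose proof (E _ Hxp Hx4). lra.
Qed.

Lemma pow_le_1 (x : R) (k : nat) : Rabs x <= 1 -> Rabs (x ^ k) <= 1.
Proof.
  intro H. eapply Rle_trans; [apply Rabs_pow_le, H|]. rewrite pow1. lra.
Qed.

Lemma exists_small5 (a b c d e : R) :
  0 < a -> 0 < b -> 0 < c -> 0 < d -> 0 < e ->
  exists r : R, 0 < r /\ r <= a /\ r <= b /\ r <= c /\ r <= d /\ r <= e.
Proof.
  intros Ha Hb Hc Hd He.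
  exists (Rmin a (Rmin b (Rmin c (Rmin d e)))).
  assert (M := Rmin_l). assert (N := Rmin_r).
  split; [repeat apply Rmin_pos; assumption|].
  repeat split; eauto 6 using Rle_trans.
Qed.

(* In the coordinates [X = x^(m+1)] and [w = y + P x y = x'] the field is, up to the
   factor [x^m], linear with an error that is quadratic in [(X, w)]. *)
Lemma field_expansion (P P1 P2 Q Q1 Q2 : R -> R -> R) (F : R -> R) (r C a b : R) (m : nat) :
  0 < r -> 0 < C -> flat_germ P P1 P2 r C -> flat_germ Q Q1 Q2 r C -> implicit_branch P F ->
  leading_term (f_fun Q F) a (2 * S m - 1) -> leading_term (Phi_fun P Q F) b m ->
  exists r' K : R, 0 < r' /\ 0 < K /\
    forall x y w, Rabs x <= r' -> Rabs y <= r' -> w = y + P x y ->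
      Rabs (P1 x y * w + (1 + P2 x y) * Q x y - x ^ m * (a * x ^ S m + b * w))
        <= K * ((x ^ S m) ^ 2 + w ^ 2).
Proof.
  intros Hr HC HP HQ HF (_ & Cf & Hf) (_ & Cp & Hp).
  destruct (implicit_branch_bound P P1 P2 F r C Hr HC HP HF) as (r1 & Hr1 & HF').
  apply locally_0_Rabs in Hf. destruct Hf as (r2 & Hr2 & Hf).
  apply locally_0_Rabs in Hp. destruct Hp as (r3 & Hr3 & Hp).
  assert (HC8 : 0 < / (8 * C)) by (apply Rinv_0_lt_compat; lra).
  destruct (exists_small5 (r1 / 2) (r2 / 2) (r3 / 2) (Rmin (r / 2) 1) (/ (8 * C)))
    as (r' & Hr' & L1 & L2 & L3 & L4 & L5); try lra.
  { apply Rmin_pos; lra. }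
  assert (L6 := Rle_trans _ _ _ L4 (Rmin_r _ _)). apply Rle_trans with (2 := Rmin_l _ _) in L4.
  clear HC8.
  assert (HCr : C * r' <= 1 / 8).
  { apply (Rmult_le_compat_l C) in L5; [|lra].
    replace (C * / (8 * C)) with (1 / 8) in L5 by (field; lra). exact L5. }
  set (A := Rabs a). set (Df := Rabs Cf). set (Dp := Rabs Cp).
  assert (HA : 0 <= A) by apply Rabs_pos. assert (HDf : 0 <= Df) by apply Rabs_pos.
  assert (HDp : 0 <= Dp) by apply Rabs_pos.
  exists r', (Df + 2 * C * A + 2 * C * Df + Dp + 20 * C + 2 * C * (A + Df) + 1).
  split; [exact Hr'|]. split; [nra|].
  intros x y w Hx Hy Hw.
  destruct (HF' x ltac:(lra)) as [HFx HFe]. specialize (Hf x ltac:(lra)). specialize (Hp x ltac:(lra)).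
  set (X := x ^ S m) in *. set (mu := x ^ m) in *.
  assert (HX : X = x * mu) by reflexivity.
  assert (Hmu : Rabs mu <= 1) by (apply pow_le_1; lra).
  assert (HX1 : Rabs X <= Rabs x) by (rewrite HX, Rabs_mult; pose proof (Rabs_pos x); nra).
  (* The leading term [a x^(2n-1)] becomes [a mu X], and the remainders of [f] and of Phi become
     multiples of [X^2] and of [|X|]. *)
  replace (2 * S m - 1)%nat with (m + S m)%nat in Hf by lia.
  replace (m + S m + 1)%nat with (S m + S m)%nat in Hf by lia.
  rewrite pow_add, pow_add, !RPow_abs in Hf. fold mu X in Hf.
  rewrite RPow_abs in Hp. replace (m + 1)%nat with (S m) in Hp by lia. fold X in Hp.
  unfold f_fun in Hf. set (f := Q x (F x)) in *.
  (* All expansions are taken vertically from the point [(x, F x)] of the curve [x' = 0]. There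
     [w = 0], and [e] will be bounded by [2 |w|]. *)
  set (e := y - F x).
  assert (HPhi : Phi_fun P Q F x = P1 x (F x) + Q2 x (F x)).
  { unfold Phi_fun, divergence, field1. f_equal.
    - apply is_derive_unique. rewrite <- (Rplus_0_l (P1 x (F x))).
      apply (is_derive_plus (fun _ => F x) (fun u => P u (F x))); [apply @is_derive_const|].
      apply (quadratic_expansion_derive1 P P1 P2 r C); [apply HP | lra | lra].
    - apply is_derive_unique.
      apply (quadratic_expansion_derive2 Q Q1 Q2 r C); [apply HQ | lra | lra]. }
  rewrite HPhi in Hp. clear HPhi.
  destruct (flat_germ_gradient_bound P P1 P2 r C x (F x) HP ltac:(lra) ltac:(lra)) as [_ Hp2].
  destruct (flat_germ_gradient_bound Q Q1 Q2 r C x (F x) HQ ltac:(lra) ltac:(lra)) as [_ Hq2].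
  destruct HP as (HPq & HPl1 & HPl2 & _). destruct HQ as (HQq & _).
  specialize (HPq x (F x) x y ltac:(lra) ltac:(lra) ltac:(lra) ltac:(lra)).
  specialize (HQq x (F x) x y ltac:(lra) ltac:(lra) ltac:(lra) ltac:(lra)).
  specialize (HPl1 x (F x) x y ltac:(lra) ltac:(lra) ltac:(lra) ltac:(lra)).
  specialize (HPl2 x (F x) x y ltac:(lra) ltac:(lra) ltac:(lra) ltac:(lra)).
  rewrite Rminus_diag, Rabs_R0, Rplus_0_l in HPl1, HPl2.
  rewrite Rminus_diag in HPq, HQq. fold e in HPq, HQq, HPl1, HPl2. fold f in HQq.
  set (p1 := P1 x (F x)) in *. set (p2 := P2 x (F x)) in *. set (q2 := Q2 x (F x)) in *.
  set (E := Rabs e) in *. assert (HE : 0 <= E) by apply Rabs_pos.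
  assert (HEr : E <= 2 * r').
  { unfold E, e, Rminus. eapply Rle_trans; [apply Rabs_triang|]. rewrite Rabs_Ropp. lra. }
  assert (Hsq : 0 ^ 2 + e ^ 2 = E ^ 2) by (unfold E; rewrite pow2_abs; ring).
  rewrite Hsq in HPq, HQq.
  replace (P x y - P x (F x) - (p1 * 0 + p2 * e)) with (w - (1 + p2) * e) in HPq
    by (rewrite Hw; unfold e; lra).
  replace (Q x y - f - (Q1 x (F x) * 0 + q2 * e)) with (Q x y - f - q2 * e) in HQq by ring.
  assert (Hx0 := Rabs_pos x). assert (HXp := Rabs_pos X). assert (Hwp := Rabs_pos w).
  assert (Hp2' : Rabs p2 <= 2 * C * Rabs x) by nra.
  assert (Hp2'' : Rabs p2 <= 1 / 4) by nra.
  assert (Hq2'' : Rabs q2 <= 1 / 4) by nra.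
  (* Here [w = (1 + p2) e + O (e^2)], where [|p2| <= 1 / 4] and the quadratic term is at most
     [|e| / 4]. *)
  assert (HEw : E <= 2 * Rabs w).
  { assert (C * E ^ 2 <= 1 / 4 * E) by nra.
    assert (Rabs ((1 + p2) * e) >= 3 / 4 * E).
    { rewrite Rabs_mult. fold E. apply Rle_ge, Rmult_le_compat_r; [exact HE|].
      apply Rabs_le_between in Hp2''. rewrite Rabs_pos_eq; lra. }
    pose proof (Rabs_triang w (- (w - (1 + p2) * e))) as HT.
    rewrite Rabs_Ropp in HT. replace (w + - (w - (1 + p2) * e)) with ((1 + p2) * e) in HT by ring.
    lra. }
  assert (HX2 : Rabs X ^ 2 = X ^ 2) by apply pow2_abs. assert (Hw2 : Rabs w ^ 2 = w ^ 2) by apply pow2_abs.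
  assert (HCf : Cf <= Df) by apply RRle_abs. assert (HCp : Cp <= Dp) by apply RRle_abs.
  assert (HXsq : Rabs X ^ 2 <= Rabs X) by (assert (Rabs X <= 1) by lra; nra).
  assert (T1 : Rabs (f - a * (mu * X)) <= Df * Rabs X ^ 2).
  { eapply Rle_trans; [exact Hf|]. replace (Rabs X ^ 2) with (Rabs X * Rabs X) by ring. nra. }
  assert (Hamu : Rabs (a * (mu * X)) <= A * Rabs X).
  { rewrite !Rabs_mult. fold A. apply Rmult_le_compat_l; [exact HA|]. nra. }
  assert (Hfb : Rabs f <= (A + Df) * Rabs X).
  { replace f with ((f - a * (mu * X)) + a * (mu * X)) by ring.
    eapply Rle_trans; [apply Rabs_plus_le; eassumption|]. nra. }
  (* Since [p2 = O (x)] and the main part of [f] is [a mu X], the identity [x mu = X] makes the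
     product quadratic in [X]; the cruder bound [f = O (X)] would not suffice. *)
  assert (T2 : Rabs (p2 * f) <= 2 * C * (A + Df) * Rabs X ^ 2).
  { rewrite Rabs_mult.
    assert (Hfx : Rabs x * Rabs f <= (A + Df) * Rabs X ^ 2).
    { assert (Hff : Rabs f <= A * (Rabs mu * Rabs X) + Df * Rabs X ^ 2).
      { replace f with ((f - a * (mu * X)) + a * (mu * X)) by ring.
        eapply Rle_trans; [apply Rabs_plus_le; [exact T1 | apply Rle_refl]|].
        rewrite !Rabs_mult. fold A. lra. }
      assert (Rabs X = Rabs x * Rabs mu) by (rewrite HX; apply Rabs_mult).
      assert (Rabs x * (Df * Rabs X ^ 2) <= Df * Rabs X ^ 2).
      { rewrite <- (Rmult_1_l (Df * Rabs X ^ 2)) at 2. apply Rmult_le_compat_r; [nra | lra]. }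
      assert (Rabs x * (A * (Rabs mu * Rabs X)) = A * Rabs X ^ 2) by (rewrite H; ring).
      nra. }
    assert (0 <= Rabs f) by apply Rabs_pos.
    assert (Rabs p2 * Rabs f <= 2 * C * Rabs x * Rabs f) by (apply Rmult_le_compat_r; assumption).
    nra. }
  assert (T3 : Rabs ((p1 + q2 - b * mu) * w) <= Dp * Rabs X * Rabs w).
  { apply Rabs_mult_le; [|lra]. eapply Rle_trans; [exact Hp|]. nra. }
  assert (T4 : Rabs ((P1 x y - p1) * w) <= C * E * Rabs w) by (apply Rabs_mult_le; lra).
  assert (HQb : Rabs (Q x y) <= (A + Df) * Rabs X + E).
  { replace (Q x y) with (f + (q2 * e + (Q x y - f - q2 * e))) by ring.
    apply Rabs_plus_le; [exact Hfb|].
    assert (Rabs (q2 * e) <= 1 / 4 * E) by (apply Rabs_mult_le; [exact Hq2'' | apply Rle_refl]).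
    eapply Rle_trans; [apply Rabs_plus_le; eassumption|].
    assert (C * E ^ 2 <= 1 / 4 * E) by nra. lra. }
  assert (T5 : Rabs ((P2 x y - p2) * Q x y) <= C * E * ((A + Df) * Rabs X + E))
    by (apply Rabs_mult_le; lra).
  assert (T6 : Rabs ((1 + p2) * (Q x y - f - q2 * e)) <= 2 * (C * E ^ 2)).
  { apply Rabs_mult_le; [|exact HQq]. apply Rabs_le_between in Hp2''. rewrite Rabs_pos_eq; lra. }
  assert (T7 : Rabs (q2 * - (w - (1 + p2) * e)) <= 1 / 4 * (C * E ^ 2))
    by (apply Rabs_mult_le; [|rewrite Rabs_Ropp]; assumption).
  (* Seven errors: the remainder of [f], the product [p2 f], the remainder of Phi, the variations of
     [P1] and [P2] along the vertical segment, and the Taylor remainders of [Q] and [P]. *)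
  replace (P1 x y * w + (1 + P2 x y) * Q x y - mu * (a * X + b * w)) with
    ((f - a * (mu * X)) + (p2 * f + ((p1 + q2 - b * mu) * w + ((P1 x y - p1) * w +
     ((P2 x y - p2) * Q x y + ((1 + p2) * (Q x y - f - q2 * e) + q2 * - (w - (1 + p2) * e)))))))
    by ring.
  eapply Rle_trans; [repeat (apply Rabs_plus_le; [eassumption|]); eassumption|].
  rewrite <- HX2, <- Hw2.
  set (u := Rabs X) in *. set (v := Rabs w) in *.
  assert (Hg : 0 <= u ^ 2 + v ^ 2) by nra.
  assert (U1 : u * v <= u ^ 2 + v ^ 2) by nra.
  assert (U2 : E * v <= 2 * (u ^ 2 + v ^ 2)) by nra.
  assert (U3 : E ^ 2 <= 4 * (u ^ 2 + v ^ 2)) by nra.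
  assert (U4 : E * u <= 2 * (u ^ 2 + v ^ 2)) by (clear - U1 HEw HXp; fold u in HXp; nra).
  assert (Hu2 : u ^ 2 <= u ^ 2 + v ^ 2) by nra.
  assert (HCA : 0 <= C * (A + Df)) by (apply Rmult_le_pos; lra).
  pose proof (Rmult_le_compat_l _ _ _ (Rlt_le _ _ HC) U2).
  pose proof (Rmult_le_compat_l _ _ _ (Rlt_le _ _ HC) U3).
  pose proof (Rmult_le_compat_l _ _ _ HCA U4).
  pose proof (Rmult_le_compat_l _ _ _ HDp U1).
  pose proof (Rmult_le_compat_l _ _ _ HDf Hu2).
  pose proof (Rmult_le_compat_l _ _ _ HCA Hu2).
  pose proof (Rmult_le_pos _ _ (Rlt_le _ _ HC) Hg).
  pose proof (Rmult_le_pos _ _ HCA Hg).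
  lra.
Qed.

(** * One-variable calculus *)

Lemma continuous_eps (g : R -> R) (t e : R) :
  continuous g t -> 0 < e ->
  exists d : R, 0 < d /\ forall s, Rabs (s - t) < d -> Rabs (g s - g t) < e.
Proof.
  intros H He. destruct (proj1 (filterlim_locally g (g t)) H (mkposreal e He)) as (d & Hd).
  exists d. split; [apply cond_pos|]. intros s Hs. apply Hd. exact Hs.
Qed.

(** The point is the supremum of the times at which [g <= 0]; continuity excludes both strict signs
    there. *)
Lemma last_zero (g : R -> R) (a b : R) :
  a <= b -> (forall t, a <= t <= b -> continuous g t) -> g a <= 0 -> 0 < g b ->
  exists c, a <= c < b /\ g c = 0 /\ forall t, c < t <= b -> 0 < g t.
Proof.
  intros Hab Hc Ha Hb.
  destruct (completeness (fun t => a <= t <= b /\ g t <= 0)) as (c & Hub & Hlub).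
  { exists b. intros t [Ht _]. lra. }
  { exists a. split; [lra | exact Ha]. }
  assert (Hac : a <= c) by (apply Hub; split; [lra | exact Ha]).
  assert (Hcb : c <= b) by (apply Hlub; intros t [Ht _]; lra).
  assert (Hafter : forall t, c < t <= b -> 0 < g t).
  { intros t Ht. apply Rnot_le_lt. intro Hn.
    assert (t <= c) by (apply Hub; split; [lra | exact Hn]). lra. }
  assert (Hle : g c <= 0).
  { apply Rnot_lt_le. intro Hp.
    destruct (continuous_eps g c (g c) (Hc c (conj Hac Hcb)) Hp) as (d & Hd & H).
    assert (c <= c - d); [|lra].
    apply Hlub. intros t [Ht Hgt]. apply Rnot_lt_le. intro Hlt.
    assert (t <= c) by (apply Hub; split; assumption).
    specialize (H t). rewrite Rabs_left1 in H by lra.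
    specialize (H ltac:(lra)). apply Rabs_lt_between in H. lra. }
  assert (Hcb' : c < b) by (destruct (Req_dec c b) as [->|]; lra).
  exists c. split; [lra|]. split; [|exact Hafter].
  apply Rle_antisym; [exact Hle|]. apply Rnot_lt_le. intro Hn.
  destruct (continuous_eps g c (- g c) (Hc c (conj Hac Hcb)) ltac:(lra)) as (d & Hd & H).
  pose proof (Rmin_l (c + d / 2) b). pose proof (Rmin_r (c + d / 2) b).
  assert (c < Rmin (c + d / 2) b) by (apply Rmin_glb_lt; lra).
  set (t := Rmin (c + d / 2) b) in *.
  specialize (Hafter t ltac:(lra)). specialize (H t).
  rewrite Rabs_pos_eq in H by lra. specialize (H ltac:(lra)). apply Rabs_lt_between in H. lra.
Qed.

Lemma first_zero (g : R -> R) (a b : R) :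
  a <= b -> (forall t, a <= t <= b -> continuous g t) -> 0 < g a -> g b <= 0 ->
  exists c, a < c <= b /\ g c = 0 /\ forall t, a <= t < c -> 0 < g t.
Proof.
  intros Hab Hc Ha Hb.
  destruct (last_zero (fun s => g (- s)) (- b) (- a)) as (c & Hcab & Hgc & Haft).
  - lra.
  - intros t Ht. apply (continuous_comp Ropp g); [|apply Hc; lra].
    apply (continuous_opp (fun x : R => x)). apply continuous_id.
  - rewrite Ropp_involutive. exact Hb.
  - rewrite Ropp_involutive. exact Ha.
  - exists (- c). split; [lra|]. split; [exact Hgc|].
    intros t Ht. rewrite <- (Ropp_involutive t). apply Haft. lra.
Qed.

Lemma derive_pos_sign (g : R -> R) (t l : R) :
  is_derive g t l -> 0 < l -> g t = 0 ->
  exists d : R, 0 < d /\ (forall s, t < s < t + d -> 0 < g s) /\ (forall s, t - d < s < t -> g s < 0).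
Proof.
  intros H Hl H0. apply is_derive_Reals in H.
  destruct (H l Hl) as (d & Hd). exists d. split; [apply cond_pos|].
  assert (K : forall s, s <> t -> Rabs (s - t) < d -> 0 < g s / (s - t)).
  { intros s Hs Hsd. specialize (Hd (s - t) ltac:(lra) Hsd).
    replace (t + (s - t)) with s in Hd by ring. rewrite H0, Rminus_0_r in Hd.
    apply Rabs_lt_between in Hd. lra. }
  split; intros s Hs.
  - specialize (K s ltac:(lra)). rewrite Rabs_pos_eq in K by lra. specialize (K ltac:(lra)).
    replace (g s) with (g s / (s - t) * (s - t)) by (field; lra).
    apply Rmult_lt_0_compat; lra.
  - specialize (K s ltac:(lra)). rewrite Rabs_left1 in K by lra. specialize (K ltac:(lra)).
    replace (g s) with (- (g s / (s - t) * (t - s))) by (field; lra).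
    apply Ropp_lt_gt_0_contravar, Rmult_lt_0_compat; lra.
Qed.

(** A negative value would be preceded by a last zero with negative values right after it, against
    the positive derivative there; a zero after [a] would be preceded by negative values. This is
    why a start at 0 is allowed although the conclusion is strict. *)
Lemma crosses_upward_only (g : R -> R) (a b : R) :
  (forall t, a <= t <= b -> continuous g t) ->
  (forall t, a <= t <= b -> g t = 0 -> exists l, 0 < l /\ is_derive g t l) ->
  0 <= g a -> forall t, a < t <= b -> 0 < g t.
Proof.
  intros Hc Hd Ha.
  assert (Hnn : forall t, a <= t <= b -> 0 <= g t).
  { intros t Ht. apply Rnot_lt_le. intro Hn.
    destruct (last_zero (fun s => - g s) a t) as (c & Hcat & Hgc & Haft); try lra.
    - intros s Hs. apply (continuous_opp g). apply Hc. lra.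
    - destruct (Hd c ltac:(lra) ltac:(lra)) as (l & Hl & Hdl).
      destruct (derive_pos_sign g c l Hdl Hl ltac:(lra)) as (d & Hd0 & Hr & _).
      pose proof (Rmin_l (c + d / 2) t). pose proof (Rmin_r (c + d / 2) t).
      assert (c < Rmin (c + d / 2) t) by (apply Rmin_glb_lt; lra).
      specialize (Hr (Rmin (c + d / 2) t) ltac:(lra)).
      specialize (Haft (Rmin (c + d / 2) t) ltac:(lra)). lra. }
  intros t Ht. destruct (Rle_lt_or_eq_dec _ _ (Hnn t ltac:(lra))) as [|E]; [assumption|].
  exfalso. destruct (Hd t ltac:(lra) (eq_sym E)) as (l & Hl & Hdl).
  destruct (derive_pos_sign g t l Hdl Hl (eq_sym E)) as (d & Hd0 & _ & Hr).
  pose proof (Rmax_l (t - d / 2) ((a + t) / 2)). pose proof (Rmax_r (t - d / 2) ((a + t) / 2)).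
  assert (Rmax (t - d / 2) ((a + t) / 2) < t) by (apply Rmax_lub_lt; lra).
  specialize (Hr (Rmax (t - d / 2) ((a + t) / 2)) ltac:(lra)).
  specialize (Hnn (Rmax (t - d / 2) ((a + t) / 2)) ltac:(lra)). lra.
Qed.

(** The times are the last passage through [lo] and the first passage through [hi] after it. *)
Lemma crossing_window (th : R -> R) (T lo hi : R) :
  0 <= T -> (forall t, 0 <= t <= T -> continuous th t) ->
  th 0 <= lo -> lo < hi -> hi <= th T ->
  exists t1 t2, 0 <= t1 /\ t1 < t2 /\ t2 <= T /\ th t1 = lo /\ th t2 = hi /\
    forall t, t1 <= t <= t2 -> lo <= th t <= hi.
Proof.
  intros HT Hc H0 Hlh HTh.
  assert (Hcc : forall k t, 0 <= t <= T -> continuous (fun s => th s - k) t).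
  { intros k t Ht. apply (continuous_minus th (fun _ => k)); [apply Hc, Ht | apply continuous_const]. }
  destruct (last_zero (fun s => th s - lo) 0 T) as (t1 & Ht1 & E1 & A1); try lra.
  { intros t Ht. apply Hcc, Ht. }
  destruct (first_zero (fun s => - (th s - hi)) t1 T) as (t2 & Ht2 & E2 & A2); try lra.
  { intros t Ht. apply (continuous_opp (fun s => th s - hi)). apply Hcc. lra. }
  exists t1, t2. repeat split; try lra.
  - destruct (Req_dec t t1) as [->|]; [lra|]. specialize (A1 t ltac:(lra)). lra.
  - destruct (Req_dec t t2) as [->|]; [lra|]. specialize (A2 t ltac:(lra)). lra.
Qed.

(** Continuous induction: at the first time with [N = M] the hypothesis yields the strict
    inequality. Estimates valid only inside a region can thus show that the region is never left. *)
Lemma trapping (N : R -> R) (M : R) :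
  (forall t, 0 <= t -> continuous N t) -> N 0 < M ->
  (forall t, 0 <= t -> (forall s, 0 <= s <= t -> N s <= M) -> N t < M) ->
  forall t, 0 <= t -> N t < M.
Proof.
  intros Hc H0 Hstep t Ht. apply Rnot_le_lt. intro Hn.
  destruct (first_zero (fun s => M - N s) 0 t) as (c & Hc0 & Ec & Ac); try lra.
  - intros s Hs. apply (continuous_minus (fun _ => M) N); [apply continuous_const | apply Hc; lra].
  - assert (N c < M); [|lra]. apply Hstep; [lra|]. intros s Hs.
    destruct (Req_dec s c) as [->|]; [lra|]. specialize (Ac s ltac:(lra)). lra.
Qed.

Lemma derive_nonneg_le (g : R -> R) (a b : R) :
  a <= b -> (forall t, a <= t <= b -> exists l, 0 <= l /\ is_derive g t l) -> g a <= g b.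
Proof.
  intros Hab Hd.
  destruct (MVT_gen g a b (Derive g)) as (c & Hc & E).
  - intros t Ht. rewrite Rmin_left, Rmax_right in Ht by lra.
    destruct (Hd t ltac:(lra)) as (l & _ & Hl). apply Derive_correct. exists l. exact Hl.
  - intros t Ht. rewrite Rmin_left, Rmax_right in Ht by lra.
    destruct (Hd t ltac:(lra)) as (l & _ & Hl).
    apply continuity_pt_filterlim. apply @ex_derive_continuous. exists l. exact Hl.
  - rewrite Rmin_left, Rmax_right in Hc by lra.
    destruct (Hd c Hc) as (l & Hl & Hdl). rewrite (is_derive_unique _ _ _ Hdl) in E. nra.
Qed.

(** * Global solutions of Lipschitz fields *)

(** One step of the Picard estimate: integrating [A |s|^k / k!] gives [A |t|^(k+1) / (k+1)!]. The
    integration is done by comparing derivatives, and negative times follow by reflection. *)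
Lemma primitive_power_bound (f df : R -> R) (A t : R) (k : nat) :
  0 <= A -> f 0 = 0 -> (forall s, is_derive f s (df s)) ->
  (forall s, Rabs (df s) <= A * Rabs s ^ k / INR (fact k)) ->
  Rabs (f t) <= A * Rabs t ^ S k / INR (fact (S k)).
Proof.
  intros HA.
  assert (Hpos : forall (f df : R -> R) t, 0 <= t -> f 0 = 0 -> (forall s, is_derive f s (df s)) ->
    (forall s, Rabs (df s) <= A * Rabs s ^ k / INR (fact k)) ->
    f t <= A * t ^ S k / INR (fact (S k))).
  { clear f df t. intros f df t Ht H0 Hd Hb.
    set (g := fun s => A * s ^ S k / INR (fact (S k)) - f s).
    assert (Hg : g 0 <= g t).
    { apply derive_nonneg_le; [exact Ht|]. intros s Hs.
      exists (A * s ^ k / INR (fact k) - df s). split.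
      - specialize (Hb s). rewrite (Rabs_pos_eq s) in Hb by lra.
        pose proof (RRle_abs (df s)). lra.
      - apply (is_derive_minus (fun s => A * s ^ S k / INR (fact (S k))) f); [|apply Hd].
        replace (A * s ^ k / INR (fact k)) with (A / INR (fact (S k)) * (INR (S k) * 1 * s ^ pred (S k))).
        + apply (is_derive_ext (fun s => A / INR (fact (S k)) * s ^ S k)).
          * intro u. match goal with |- @eq _ ?p ?q => change (@eq R p q) end.
            field. apply (INR_fact_neq_0 (S k)).
          * apply is_derive_scal. apply (is_derive_pow (fun x : R => x) (S k) s 1). apply @is_derive_id.
        + change (fact (S k)) with (S k * fact k)%nat. rewrite mult_INR. simpl pred. field.
          split; [apply INR_fact_neq_0 | apply not_0_INR; lia]. }
    unfold g in Hg. rewrite H0 in Hg. simpl pow in Hg. rewrite Rmult_0_l, Rmult_0_r in Hg.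
    unfold Rdiv in Hg at 1. rewrite Rmult_0_l in Hg. simpl pow. lra. }
  assert (Habs : forall (f df : R -> R) t, 0 <= t -> f 0 = 0 -> (forall s, is_derive f s (df s)) ->
    (forall s, Rabs (df s) <= A * Rabs s ^ k / INR (fact k)) ->
    Rabs (f t) <= A * t ^ S k / INR (fact (S k))).
  { clear f df t. intros f df t Ht H0 Hd Hb. apply Rabs_le. split.
    - enough (- f t <= A * t ^ S k / INR (fact (S k))) by lra.
      apply (Hpos (fun s => - f s) (fun s => - df s)); [exact Ht | lra | |].
      + intro s. apply (is_derive_opp f). apply Hd.
      + intro s. rewrite Rabs_Ropp. apply Hb.
    - apply (Hpos f df); assumption. }
  intros H0 Hd Hb. destruct (Rle_or_lt 0 t) as [Ht|Ht].
  - rewrite (Rabs_pos_eq t) by exact Ht. apply (Habs f df); assumption.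
  - rewrite (Rabs_left t) by exact Ht. rewrite <- (Ropp_involutive t) at 1.
    apply (Habs (fun s => f (- s)) (fun s => - df (- s))).
    + lra.
    + rewrite Ropp_0. exact H0.
    + intro s. replace (- df (- s)) with (scal (- 1) (df (- s))) by (unfold scal; simpl; unfold mult; simpl; ring).
      apply (is_derive_comp f Ropp); [apply Hd|]. apply (is_derive_opp (fun x : R => x)). apply @is_derive_id.
    + intro s. rewrite Rabs_Ropp, <- (Rabs_Ropp s). apply Hb.
Qed.

Definition lipschitz_plane (f : R -> R -> R) (L : R) : Prop :=
  forall x y x' y' : R, Rabs (f x' y' - f x y) <= L * (Rabs (x' - x) + Rabs (y' - y)).

Lemma lipschitz_plane_continuous (f : R -> R -> R) (L : R) (x y : R -> R) (t : R) :
  0 < L -> lipschitz_plane f L -> continuous x t -> continuous y t ->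
  continuous (fun s => f (x s) (y s)) t.
Proof.
  intros HL Hf Hx Hy. apply (proj2 (filterlim_locally _ _)). intro e.
  assert (He : 0 < e / (2 * L)) by (apply Rdiv_lt_0_compat; [apply cond_pos | lra]).
  destruct (continuous_eps x t _ Hx He) as (d1 & Hd1 & H1).
  destruct (continuous_eps y t _ Hy He) as (d2 & Hd2 & H2).
  assert (Hd : 0 < Rmin d1 d2) by (apply Rmin_pos; assumption).
  exists (mkposreal _ Hd). intros s Hs.
  assert (Hs' : Rabs (s - t) < Rmin d1 d2) by exact Hs.
  apply Rmin_Rgt in Hs'. destruct Hs' as [Hs1 Hs2].
  specialize (H1 s Hs1). specialize (H2 s Hs2).
  change (Rabs (f (x s) (y s) - f (x t) (y t)) < e).
  eapply Rle_lt_trans; [apply Hf|].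
  apply Rlt_le_trans with (L * (e / (2 * L) + e / (2 * L))); [apply Rmult_lt_compat_l; lra|].
  right. field. lra.
Qed.

Fixpoint picard (X1 X2 : R -> R -> R) (x0 y0 : R) (k : nat) : (R -> R) * (R -> R) :=
  match k with
  | O => (fun _ => x0, fun _ => y0)
  | S k => let p := picard X1 X2 x0 y0 k in
      (fun t => x0 + RInt (fun s => X1 (fst p s) (snd p s)) 0 t,
       fun t => y0 + RInt (fun s => X2 (fst p s) (snd p s)) 0 t)
  end.

Lemma is_derive_primitive (g : R -> R) (c t : R) :
  (forall s, continuous g s) -> is_derive (fun t => c + RInt g 0 t) t (g t).
Proof.
  intro Hg. rewrite <- (Rplus_0_l (g t)).
  apply (is_derive_plus (fun _ => c) (fun t => RInt g 0 t)); [apply @is_derive_const|].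
  apply (is_derive_RInt g (fun t => RInt g 0 t) 0 t); [|apply Hg].
  exists (mkposreal 1 Rlt_0_1). intros u _. apply (@RInt_correct R_CompleteNormedModule).
  apply (@ex_RInt_continuous R_CompleteNormedModule). intros z _. apply Hg.
Qed.

(** Since [sum_f_R0] includes its last index, the right-hand side is the sum of [u k] over
    [n <= k < m]. *)
Lemma cauchy_majorant (u : nat -> R) (a : nat -> R) :
  (forall k, Rabs (a (S k) - a k) <= u k) ->
  forall n m, (n <= m)%nat -> Rabs (a m - a n) <= sum_f_R0 u m - sum_f_R0 u n + u n - u m.
Proof.
  intros H n m Hnm. induction Hnm as [|m Hnm IH].
  - rewrite Rminus_diag, Rabs_R0. lra.
  - replace (a (S m) - a n) with ((a (S m) - a m) + (a m - a n)) by ring.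
    eapply Rle_trans; [apply Rabs_triang|]. specialize (H m). simpl sum_f_R0. lra.
Qed.

Lemma uniform_cauchy_of_majorant (D : R -> Prop) (a : nat -> R -> R) (u : nat -> R) :
  (forall k t, D t -> Rabs (a (S k) t - a k t) <= u k) -> ex_series u -> CVU_cauchy a D.
Proof.
  intros H Hu eps.
  assert (Hlim : ex_finite_lim_seq (fun m => sum_f_R0 u m - u m)).
  { destruct Hu as [l Hl]. exists (l - 0). apply is_lim_seq_minus'.
    - apply (is_lim_seq_ext (sum_n u)); [intro n; apply sum_n_Reals | exact Hl].
    - apply ex_series_lim_0. exists l. exact Hl. }
  apply ex_lim_seq_cauchy_corr in Hlim. destruct (Hlim eps) as [N HN].
  exists N. intros n m t Ht Hn Hm.
  destruct (Nat.le_ge_cases n m) as [Hnm|Hnm].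
  - pose proof (cauchy_majorant u (fun k => a k t) (fun k => H k t Ht) n m Hnm) as B.
    rewrite Rabs_minus_sym. specialize (HN n m Hn Hm). apply Rabs_lt_between in HN. simpl in B. lra.
  - pose proof (cauchy_majorant u (fun k => a k t) (fun k => H k t Ht) m n Hnm) as B.
    specialize (HN n m Hn Hm). apply Rabs_lt_between in HN. simpl in B. lra.
Qed.

Lemma CVU_cauchy_is_lim (D : R -> Prop) (a : nat -> R -> R) (t : R) :
  CVU_cauchy a D -> D t -> is_lim_seq (fun n => a n t) (real (Lim_seq (fun n => a n t))).
Proof.
  intros H Ht. assert (E : ex_finite_lim_seq (fun n => a n t)).
  { apply ex_lim_seq_cauchy_corr. intro eps. destruct (H eps) as [N HN]. exists N.
    intros n m Hn Hm. apply HN; assumption. }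
  destruct E as [l Hl]. rewrite (is_lim_seq_unique _ _ Hl). exact Hl.
Qed.

(** The factorial bound on successive Picard iterates holds at every time, so the iterates and their
    derivatives converge uniformly on each bounded interval, which gives the solution on the whole
    line at once. *)
Lemma ode_global_solution (X1 X2 : R -> R -> R) (L x0 y0 : R) :
  0 < L -> lipschitz_plane X1 L -> lipschitz_plane X2 L ->
  exists x y : R -> R, x 0 = x0 /\ y 0 = y0 /\ forall t, solution_at X1 X2 x y t.
Proof.
  intros HL H1 H2.
  set (xs := fun k => fst (picard X1 X2 x0 y0 k)). set (ys := fun k => snd (picard X1 X2 x0 y0 k)).
  set (M := Rabs (X1 x0 y0) + Rabs (X2 x0 y0)).
  assert (HM : 0 <= M) by (apply Rplus_le_le_0_compat; apply Rabs_pos).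
  assert (Hcont : forall k s, continuous (xs k) s /\ continuous (ys k) s).
  { induction k as [|k IH]; intro s.
    - split; apply continuous_const.
    - split.
      + apply (ex_derive_continuous (xs (S k))). eexists.
        apply (is_derive_primitive (fun s => X1 (xs k s) (ys k s))).
        intro u. apply (lipschitz_plane_continuous X1 L); auto; apply IH.
      + apply (ex_derive_continuous (ys (S k))). eexists.
        apply (is_derive_primitive (fun s => X2 (xs k s) (ys k s))).
        intro u. apply (lipschitz_plane_continuous X2 L); auto; apply IH. }
  assert (Hc1 : forall k s, continuous (fun s => X1 (xs k s) (ys k s)) s)
    by (intros k s; apply (lipschitz_plane_continuous X1 L); auto; apply Hcont).
  assert (Hc2 : forall k s, continuous (fun s => X2 (xs k s) (ys k s)) s)
    by (intros k s; apply (lipschitz_plane_continuous X2 L); auto; apply Hcont).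
  assert (Hdx : forall k s, is_derive (xs (S k)) s (X1 (xs k s) (ys k s)))
    by (intros k s; apply (is_derive_primitive (fun s => X1 (xs k s) (ys k s))), Hc1).
  assert (Hdy : forall k s, is_derive (ys (S k)) s (X2 (xs k s) (ys k s)))
    by (intros k s; apply (is_derive_primitive (fun s => X2 (xs k s) (ys k s))), Hc2).
  assert (Hx0 : forall k, xs k 0 = x0).
  { intros [|k]; [reflexivity|]. unfold xs; simpl. rewrite RInt_point. unfold zero; simpl. ring. }
  assert (Hy0 : forall k, ys k 0 = y0).
  { intros [|k]; [reflexivity|]. unfold ys; simpl. rewrite RInt_point. unfold zero; simpl. ring. }
  (* The factor 2 in [2 * L] comes from the two coordinates, whose differences are added in the
     Lipschitz bound. *)
  assert (Hb : forall k t,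
     Rabs (xs (S k) t - xs k t) <= M * (2 * L) ^ k * Rabs t ^ S k / INR (fact (S k)) /\
     Rabs (ys (S k) t - ys k t) <= M * (2 * L) ^ k * Rabs t ^ S k / INR (fact (S k))).
  { assert (HA : forall k, 0 <= M * (2 * L) ^ k)
      by (intro k; apply Rmult_le_pos; [exact HM | apply pow_le; lra]).
    induction k as [|k IH]; intro t.
    - assert (HX1 := Rabs_pos (X1 x0 y0)). assert (HX2 := Rabs_pos (X2 x0 y0)).
      split.
      + apply (primitive_power_bound (fun t => xs 1%nat t - xs 0%nat t) (fun s => X1 x0 y0 - 0)); auto.
        * rewrite !Hx0. ring.
        * intro s. apply (is_derive_minus (xs 1%nat) (xs 0%nat)); [apply (Hdx 0%nat) | exact (@is_derive_const R_AbsRing R_NormedModule x0 s)].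
        * intro s. rewrite Rminus_0_r. simpl. unfold M. lra.
      + apply (primitive_power_bound (fun t => ys 1%nat t - ys 0%nat t) (fun s => X2 x0 y0 - 0)); auto.
        * rewrite !Hy0. ring.
        * intro s. apply (is_derive_minus (ys 1%nat) (ys 0%nat)); [apply (Hdy 0%nat) | exact (@is_derive_const R_AbsRing R_NormedModule y0 s)].
        * intro s. rewrite Rminus_0_r. simpl. unfold M. lra.
    - assert (Hstep : forall s, L * (Rabs (xs (S k) s - xs k s) + Rabs (ys (S k) s - ys k s))
         <= M * (2 * L) ^ S k * Rabs s ^ S k / INR (fact (S k))).
      { intro s. destruct (IH s) as [I1 I2].
        replace (M * (2 * L) ^ S k * Rabs s ^ S k / INR (fact (S k))) with
          (L * (M * (2 * L) ^ k * Rabs s ^ S k / INR (fact (S k)) + M * (2 * L) ^ k * Rabs s ^ S k / INR (fact (S k))))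
          by (simpl; field; apply (INR_fact_neq_0 (S k))).
        apply Rmult_le_compat_l; lra. }
      split.
      + apply (primitive_power_bound (fun t => xs (S (S k)) t - xs (S k) t)
           (fun s => X1 (xs (S k) s) (ys (S k) s) - X1 (xs k s) (ys k s))); auto.
        * rewrite !Hx0. ring.
        * intro s. apply (is_derive_minus (xs (S (S k))) (xs (S k))); apply Hdx.
        * intro s. eapply Rle_trans; [apply H1 | apply Hstep].
      + apply (primitive_power_bound (fun t => ys (S (S k)) t - ys (S k) t)
           (fun s => X2 (xs (S k) s) (ys (S k) s) - X2 (xs k s) (ys k s))); auto.
        * rewrite !Hy0. ring.
        * intro s. apply (is_derive_minus (ys (S (S k))) (ys (S k))); apply Hdy.
        * intro s. eapply Rle_trans; [apply H2 | apply Hstep]. }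
  assert (Hcauchy : forall T, 0 < T ->
     CVU_cauchy xs (fun t => Rabs t < T) /\ CVU_cauchy ys (fun t => Rabs t < T)).
  (* Replacing [(k+1)!] by [k!] gives a majorant whose series is a multiple of that of
     [exp (2 L T)]. *)
  { intros T HT. set (u := fun k => M * T * (/ INR (fact k) * (2 * L * T) ^ k)).
    assert (Hu : ex_series u).
    { apply (ex_series_scal_l (V := R_NormedModule)). exists (exp (2 * L * T)).
      apply (is_series_ext (fun k => (2 * L * T) ^ k * / INR (fact k))).
      - intro k. apply Rmult_comm.
      - apply (is_series_ext (fun k => scal (pow_n (2 * L * T) k) (/ INR (fact k)))).
        + intro k. rewrite pow_n_pow. reflexivity.
        + apply (is_exp_Reals (2 * L * T)). }
    assert (Hle : forall k t, Rabs t < T -> M * (2 * L) ^ k * Rabs t ^ S k / INR (fact (S k)) <= u k).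
    { intros k t Ht. unfold u. rewrite (Rpow_mult_distr (2 * L) T).
      assert (Hf : 0 < INR (fact k)) by apply INR_fact_lt_0.
      assert (Hf' : / INR (fact (S k)) <= / INR (fact k)).
      { apply Rinv_le_contravar; [exact Hf|]. apply le_INR. simpl. lia. }
      assert (Hp : Rabs t ^ S k <= T ^ S k) by (apply pow_incr; split; [apply Rabs_pos | lra]).
      assert (0 < / INR (fact (S k))) by (apply Rinv_0_lt_compat, INR_fact_lt_0).
      assert (HA : 0 <= M * (2 * L) ^ k) by (apply Rmult_le_pos; [exact HM | apply pow_le; lra]).
      replace (M * T * (/ INR (fact k) * ((2 * L) ^ k * T ^ k)))
        with (M * (2 * L) ^ k * T ^ S k * / INR (fact k)) by (simpl; ring).
      unfold Rdiv. apply Rmult_le_compat; try lra.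
      - apply Rmult_le_pos; [exact HA | apply pow_le, Rabs_pos].
      - apply Rmult_le_compat_l; assumption. }
    split; apply (uniform_cauchy_of_majorant _ _ u); try exact Hu;
      intros k t Ht; (eapply Rle_trans; [apply Hb | apply Hle, Ht]). }
  set (x := fun t => real (Lim_seq (fun n => xs n t))). set (y := fun t => real (Lim_seq (fun n => ys n t))).
  assert (Hxl : forall t, is_lim_seq (fun n => xs n t) (x t)).
  { intro t. pose proof (Rabs_pos t). destruct (Hcauchy (Rabs t + 1) ltac:(lra)) as [Hc _].
    apply (CVU_cauchy_is_lim _ _ _ Hc). lra. }
  assert (Hyl : forall t, is_lim_seq (fun n => ys n t) (y t)).
  { intro t. pose proof (Rabs_pos t). destruct (Hcauchy (Rabs t + 1) ltac:(lra)) as [_ Hc].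
    apply (CVU_cauchy_is_lim _ _ _ Hc). lra. }
  assert (Hgen : forall (X : R -> R -> R) (zs : nat -> R -> R) (z : R -> R),
     lipschitz_plane X L -> (forall k s, continuous (fun s => X (xs k s) (ys k s)) s) ->
     (forall k s, is_derive (zs (S k)) s (X (xs k s) (ys k s))) ->
     (forall T, 0 < T -> CVU_cauchy zs (fun t => Rabs t < T)) ->
     (forall t, is_lim_seq (fun n => zs n t) (z t)) ->
     forall t, is_derive z t (X (x t) (y t))).
  { intros X zs z HX HcX Hdz Hcz Hzl t. pose proof (Rabs_pos t).
    set (T := Rabs t + 1). set (D := fun t => Rabs t < T).
    assert (HT : 0 < T) by (unfold T; lra).
    assert (HDer : forall n s, Derive (zs (S n)) s = X (xs n s) (ys n s))
      by (intros; apply is_derive_unique, Hdz).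
    assert (HlimX : forall s, is_lim_seq (fun n => X (xs n s) (ys n s)) (X (x s) (y s))).
    { intro s. apply is_lim_seq_spec. intro eps.
      assert (He : 0 < eps / (2 * L)) by (apply Rdiv_lt_0_compat; [apply cond_pos | lra]).
      pose proof (proj2 (is_lim_seq_spec _ _) (Hxl s) (mkposreal _ He)) as [N1 HN1].
      pose proof (proj2 (is_lim_seq_spec _ _) (Hyl s) (mkposreal _ He)) as [N2 HN2].
      exists (Nat.max N1 N2). intros n Hn.
      specialize (HN1 n ltac:(lia)). specialize (HN2 n ltac:(lia)). simpl in HN1, HN2.
      eapply Rle_lt_trans; [apply HX|].
      apply Rlt_le_trans with (L * (eps / (2 * L) + eps / (2 * L))); [apply Rmult_lt_compat_l; lra|].
      right. field. lra. }
    (* The sequence is shifted by one because only the iterates [zs (S n)] have the field along the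
       preceding iterate as derivative. *)
    assert (HD := CVU_Derive (fun n => zs (S n)) D).
    assert (Hop : open D).
    { intros s Hs. assert (Hp : 0 < T - Rabs s) by (unfold D in Hs; lra).
      exists (mkposreal _ Hp). intros v Hv.
      assert (Hv' : Rabs (v - s) < T - Rabs s) by exact Hv. unfold D.
      replace v with ((v - s) + s) by ring. eapply Rle_lt_trans; [apply Rabs_triang|]. lra. }
    assert (Hconn : is_connected D).
    { intros p q s Hp Hq Hs. unfold D in *. apply Rabs_lt_between in Hp, Hq. apply Rabs_lt_between. lra. }
    assert (HcS : CVU_cauchy (fun n => zs (S n)) D).
    { intro eps. destruct (Hcz T HT eps) as [N HN]. exists N. intros n k s Hs Hn Hk.
      apply HN; [exact Hs | lia | lia]. }
    assert (HcD : CVU_cauchy (fun n s => Derive (zs (S n)) s) D).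
    { intro eps. assert (He : 0 < eps / (2 * L)) by (apply Rdiv_lt_0_compat; [apply cond_pos | lra]).
      destruct (Hcauchy T HT) as [Ca Cb].
      destruct (Ca (mkposreal _ He)) as [N1 HN1]. destruct (Cb (mkposreal _ He)) as [N2 HN2].
      exists (Nat.max N1 N2). intros n k s Hs Hn Hk. rewrite !HDer.
      specialize (HN1 n k s Hs ltac:(lia) ltac:(lia)). specialize (HN2 n k s Hs ltac:(lia) ltac:(lia)).
      simpl in HN1, HN2. eapply Rle_lt_trans; [apply HX|].
      apply Rlt_le_trans with (L * (eps / (2 * L) + eps / (2 * L))); [apply Rmult_lt_compat_l; lra|].
      right. field. lra. }
    assert (Hfin := HD Hop Hconn (proj2 (CVU_dom_cauchy _ _) HcS)
      (fun n s _ => ex_intro _ _ (Hdz n s))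
      (fun n s _ => proj2 (continuity_pt_filterlim _ _)
          (continuous_ext _ _ s (fun u => eq_sym (HDer n u)) (HcX n s)))
      (proj2 (CVU_dom_cauchy _ _) HcD) t ltac:(unfold D, T; lra)).
    assert (E : real (Lim_seq (fun n => Derive (zs (S n)) t)) = X (x t) (y t)).
    { rewrite (Lim_seq_ext _ _ (fun n => HDer n t)), (is_lim_seq_unique _ _ (HlimX t)). reflexivity. }
    change (is_derive (fun s => real (Lim_seq (fun n => zs (S n) s))) t
              (real (Lim_seq (fun n => Derive (zs (S n)) t)))) in Hfin.
    rewrite E in Hfin. eapply is_derive_ext; [|exact Hfin].
    intro s. simpl. rewrite (Lim_seq_incr_1 (fun n => zs n s)), (is_lim_seq_unique _ _ (Hzl s)). reflexivity. }
  exists x, y. split; [|split; [|intro t; split]].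
  - unfold x. rewrite (Lim_seq_ext _ (fun _ => x0) Hx0), Lim_seq_const. reflexivity.
  - unfold y. rewrite (Lim_seq_ext _ (fun _ => y0) Hy0), Lim_seq_const. reflexivity.
  - apply (Hgen X1 xs x H1 Hc1 Hdx); [|exact Hxl]. intros T HT. apply (Hcauchy T HT).
  - apply (Hgen X2 ys y H2 Hc2 Hdy); [|exact Hyl]. intros T HT. apply (Hcauchy T HT).
Qed.

(** * A non-negative discriminant excludes monodromy *)

Lemma is_derive_along (P P1 P2 : R -> R -> R) (r C : R) (x y : R -> R) (t dx dy : R) :
  quadratic_expansion P P1 P2 r C -> Rabs (x t) < r -> Rabs (y t) < r ->
  is_derive x t dx -> is_derive y t dy ->
  is_derive (fun s => y s + P (x s) (y s)) t (P1 (x t) (y t) * dx + (1 + P2 (x t) (y t)) * dy).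
Proof.
  intros HP Hx Hy Hdx Hdy.
  replace (P1 (x t) (y t) * dx + (1 + P2 (x t) (y t)) * dy)
    with (dy + (P1 (x t) (y t) * dx + P2 (x t) (y t) * dy)) by ring.
  apply (is_derive_plus y (fun s => P (x s) (y s))); [exact Hdy|].
  apply is_derive_Reals. apply (derivable_pt_lim_comp_2d P x y).
  - apply (quadratic_expansion_differentiable P P1 P2 r C); assumption.
  - apply is_derive_Reals, Hdx.
  - apply is_derive_Reals, Hdy.
Qed.

Lemma is_derive_power (x : R -> R) (t dx : R) (m : nat) :
  is_derive x t dx -> is_derive (fun s => x s ^ S m) t (INR (S m) * dx * x t ^ m).
Proof. intro H. exact (is_derive_pow x (S m) t dx H). Qed.

Lemma is_derive_curve_gap (x w : R -> R) (t dx dw c k : R) (m : nat) :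
  is_derive x t dx -> is_derive w t dw ->
  is_derive (fun s => w s - x s ^ S m * (c + k * x s)) t
    (dw - (INR (S m) * c * x t ^ m + INR (S (S m)) * k * x t ^ S m) * dx).
Proof.
  intros Hx Hw.
  apply (is_derive_ext (fun s => w s - (c * x s ^ S m + k * x s ^ S (S m)))).
  { intro s. match goal with |- @eq _ ?p ?q => change (@eq R p q) end. simpl. ring. }
  replace (dw - (INR (S m) * c * x t ^ m + INR (S (S m)) * k * x t ^ S m) * dx)
    with (dw - (c * (INR (S m) * dx * x t ^ m) + k * (INR (S (S m)) * dx * x t ^ S m))) by ring.
  apply (is_derive_minus w (fun s => c * x s ^ S m + k * x s ^ S (S m))); [exact Hw|].
  apply (is_derive_plus (fun s => c * x s ^ S m) (fun s => k * x s ^ S (S m)));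
    apply is_derive_scal, is_derive_power, Hx.
Qed.

(** On the curve [w = c X] the derivative of [w - c X], multiplied by [x], is [p X^2] with
    [p = a + b c - n c^2], up to [|x| K (1 + c^2) X^2]. The factor [x] completes [mu X] to a square
    and records that the sense of crossing depends on the side. The terms with coefficient 0 only
    give the curve the form used in [barrier_inner]. *)
Lemma barrier_outer (a b c K : R) (m : nat) :
  0 < K -> a + b * c - INR (S m) * c ^ 2 < 0 ->
  exists r : R, 0 < r /\ forall x w G : R,
    0 < Rabs x < r -> w = x ^ S m * (c + 0 * x) ->
    Rabs (G - x ^ m * (a * x ^ S m + b * w)) <= K * ((x ^ S m) ^ 2 + w ^ 2) ->
    x * (G - (INR (S m) * c * x ^ m + INR (S (S m)) * 0 * x ^ S m) * w) < 0.
Proof.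
  intros HK Hp. set (p := a + b * c - INR (S m) * c ^ 2) in *.
  assert (HM : 0 < K * (1 + c ^ 2)) by (apply Rmult_lt_0_compat; nra).
  exists (- p / (K * (1 + c ^ 2))). split.
  { apply Rdiv_lt_0_compat; lra. }
  intros x w G [Hx0 Hx] Hw HG.
  assert (Hxm : x * x ^ m = x ^ S m) by reflexivity.
  assert (HX0 : x ^ S m <> 0).
  { apply pow_nonzero. intro E. rewrite E, Rabs_R0 in Hx0. lra. }
  set (X := x ^ S m) in *. set (mu := x ^ m) in *.
  replace (c + 0 * x) with c in Hw by ring.
  set (e := G - mu * (a * X + b * w)) in *.
  assert (He : Rabs (x * e) <= Rabs x * (K * (1 + c ^ 2)) * X ^ 2).
  { rewrite Rabs_mult, Rmult_assoc. apply Rmult_le_compat_l; [apply Rabs_pos|].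
    rewrite Hw in HG. lra. }
  assert (HX2 : 0 < X ^ 2) by (apply pow2_gt_0; exact HX0).
  replace (x * (G - (INR (S m) * c * mu + INR (S (S m)) * 0 * X) * w)) with (p * X ^ 2 + x * e)
    by (unfold e, p; rewrite Hw, <- Hxm; ring).
  apply (Rmult_lt_compat_r (K * (1 + c ^ 2))) in Hx; [|exact HM].
  unfold Rdiv in Hx. rewrite Rmult_assoc, Rinv_l, Rmult_1_r in Hx by lra.
  pose proof (RRle_abs (x * e)). nra.
Qed.

(* For the double root [c = b / (2n)] the leading terms cancel on the curve [w = c x^n];
   the term [k x^(n+1)] contributes [- c k x] and outweighs the error. *)
Lemma barrier_inner (a b K tau : R) (m : nat) :
  0 < K -> b <> 0 -> 0 <= b ^ 2 + 4 * a * INR (S m) -> tau = 1 \/ tau = - 1 ->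
  exists c k r : R, 0 < r /\ forall x w G : R,
    0 < Rabs x < r -> 0 < tau * x -> w = x ^ S m * (c + k * x) ->
    Rabs (G - x ^ m * (a * x ^ S m + b * w)) <= K * ((x ^ S m) ^ 2 + w ^ 2) ->
    0 < x * (G - (INR (S m) * c * x ^ m + INR (S (S m)) * k * x ^ S m) * w).
Proof.
  intros HK Hb Hdisc Htau.
  assert (Hn : 0 < INR (S m)) by (apply lt_0_INR; lia).
  set (n := INR (S m)) in *.
  (* This [c] maximizes [a + b c - n c^2]; the maximum is the discriminant divided by [4 n], which
     may be 0. *)
  set (c := b / (2 * n)). assert (Hbc : b = 2 * n * c) by (unfold c; field; lra).
  assert (Hc : c <> 0) by (intro E; rewrite E in Hbc; lra).
  assert (Hp : 0 <= a + b * c - n * c ^ 2).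
  { rewrite Hbc in Hdisc |- *. apply Rmult_le_reg_l with (4 * n); [lra|]. nra. }
  set (p := a + b * c - n * c ^ 2) in *.
  (* [M |x| X^2] bounds the error as long as [|k x| <= 1]. The choice [k c = - tau (M + 1)]
     contributes [(M + 1) |x| X^2] on the side [tau x > 0]; the surplus [|x| X^2] absorbs the term
     in [k^2]. *)
  set (M := K * (1 + (Rabs c + 1) ^ 2)).
  set (k := - tau * (M + 1) / c).
  assert (Hkc : k * c = - tau * (M + 1)) by (unfold k; field; exact Hc).
  assert (HM : 0 < M) by (apply Rmult_lt_0_compat; nra).
  assert (Hk0 := Rabs_pos k).
  exists c, k, (/ ((n + 1) * (k ^ 2 + Rabs k + 1))). split.
  { apply Rinv_0_lt_compat. apply Rmult_lt_0_compat; nra. }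
  intros x w G [Hx0 Hx] Htx Hw HG.
  rewrite S_INR. fold n.
  assert (Hxm : x * x ^ m = x ^ S m) by reflexivity.
  assert (HX0 : x ^ S m <> 0).
  { apply pow_nonzero. intro E. rewrite E, Rabs_R0 in Hx0. lra. }
  set (X := x ^ S m) in *. set (mu := x ^ m) in *.
  set (e := G - mu * (a * X + b * w)) in *.
  assert (Hsmall : Rabs x * ((n + 1) * (k ^ 2 + Rabs k + 1)) < 1).
  { apply (Rmult_lt_compat_r ((n + 1) * (k ^ 2 + Rabs k + 1))) in Hx; [|apply Rmult_lt_0_compat; nra].
    rewrite Rinv_l in Hx; [exact Hx|]. apply Rgt_not_eq, Rmult_lt_0_compat; nra. }
  assert (Hk2 := pow2_ge_0 k).
  assert (P1 : 0 <= Rabs x * (n * k ^ 2)) by (apply Rmult_le_pos; nra).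
  assert (P2 : 0 <= Rabs x * (n * Rabs k)) by (apply Rmult_le_pos; nra).
  assert (P3 : 0 <= Rabs x * n) by nra.
  assert (P4 : 0 <= Rabs x * k ^ 2) by nra.
  assert (P5 : 0 <= Rabs x * Rabs k) by nra.
  assert (Hkx : Rabs (k * x) <= 1) by (rewrite Rabs_mult; nra).
  assert (Hkx2 : (n + 1) * k ^ 2 * Rabs x < 1) by nra.
  assert (Hcx : (c + k * x) ^ 2 <= (Rabs c + 1) ^ 2).
  { rewrite <- (pow2_abs (c + k * x)). apply pow_incr. split; [apply Rabs_pos|].
    eapply Rle_trans; [apply Rabs_triang|]. lra. }
  assert (He : Rabs (x * e) <= Rabs x * M * X ^ 2).
  { rewrite Rabs_mult, Rmult_assoc. apply Rmult_le_compat_l; [apply Rabs_pos|].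
    eapply Rle_trans; [exact HG|]. unfold M. rewrite Hw, Rmult_assoc, Rpow_mult_distr.
    apply Rmult_le_compat_l; [lra|]. pose proof (pow2_ge_0 X). nra. }
  assert (HX2 : 0 < X ^ 2) by (apply pow2_gt_0; exact HX0).
  assert (Habs : tau * x = Rabs x).
  { destruct Htau as [-> | ->]; [rewrite Rabs_pos_eq | rewrite Rabs_left]; lra. }
  assert (E : x * (G - (n * c * mu + (n + 1) * k * X) * w)
     = (p + (M + 1) * Rabs x - (n + 1) * k ^ 2 * Rabs x ^ 2) * X ^ 2 + x * e).
  { rewrite pow2_abs, <- Habs.
    replace (p + (M + 1) * (tau * x) - (n + 1) * k ^ 2 * x ^ 2)
      with (p - (k * c) * x - (n + 1) * k ^ 2 * x ^ 2) by (rewrite Hkc; ring).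
    unfold e, p. rewrite Hw, <- Hxm, Hbc. ring. }
  rewrite E. pose proof (Rabs_le_between (x * e) (Rabs x * M * X ^ 2)) as [B _]. specialize (B He).
  assert (0 < Rabs x * (1 - (n + 1) * k ^ 2 * Rabs x)) by (apply Rmult_lt_0_compat; lra).
  nra.
Qed.

(** * Polar angles, the cone around the negative x-axis and the section *)

Lemma small_angle_cone (d : R) : - (PI / 4) <= d <= PI / 4 -> 0 < cos d /\ Rabs (sin d) <= cos d.
Proof.
  intro Hd. pose proof PI_RGT_0.
  assert (H0 : 0 < cos d) by (apply cos_gt_0; lra).
  split; [exact H0|]. apply Rabs_le.
  assert (Hd' : cos (PI / 4) <= cos d).
  { destruct (Rle_or_lt 0 d).
    - apply cos_decr_1; lra.
    - rewrite <- (cos_neg d). apply cos_decr_1; lra. }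
  assert (E : sin (PI / 4) = cos (PI / 4)) by apply sin_cos_PI4.
  assert (sin d <= sin (PI / 4)) by (apply sin_incr_1; lra).
  assert (sin (- (PI / 4)) <= sin d) by (apply sin_incr_1; lra).
  rewrite sin_neg in *. lra.
Qed.

Lemma polar_angle_cone (th x y : R) :
  3 * (PI / 4) <= th <= 5 * (PI / 4) -> polar_angle th x y -> x < 0 /\ Rabs y <= - x.
Proof.
  intros Ht (rho & Hr & -> & ->).
  destruct (small_angle_cone (th - PI)) as [H1 H2]; [lra|].
  replace (th - PI) with (- (PI - th)) in H1, H2 by ring.
  rewrite cos_neg in H1, H2. rewrite sin_neg, Rabs_Ropp in H2.
  rewrite Rtrigo_facts.cos_pi_minus in H1, H2. rewrite sin_PI_x in H2.
  rewrite Rabs_mult, (Rabs_pos_eq rho) by lra. nra.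
Qed.

Lemma polar_angle_shift (th x y : R) (k : Z) :
  polar_angle th x y -> polar_angle (th - 2 * IZR k * PI) x y.
Proof.
  intros (rho & Hr & -> & ->). exists rho.
  assert (E : cos (th - 2 * IZR k * PI) = cos th /\ sin (th - 2 * IZR k * PI) = sin th).
  { destruct (Z_le_gt_dec 0 k) as [Hk|Hk].
    - rewrite <- (Z2Nat.id k) by exact Hk. rewrite <- INR_IZR_INZ.
      rewrite <- (cos_period (th - _) (Z.to_nat k)), <- (sin_period (th - _) (Z.to_nat k)).
      split; f_equal; ring.
    - replace (IZR k) with (- INR (Z.to_nat (- k))).
      + rewrite <- (cos_period th (Z.to_nat (- k))), <- (sin_period th (Z.to_nat (- k))).
        split; f_equal; ring.
      + rewrite INR_IZR_INZ, Z2Nat.id by lia. rewrite opp_IZR. ring. }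
  destruct E as [-> ->]. repeat split; exact Hr.
Qed.

Lemma polar_angle_opp (th x y : R) : polar_angle th x y -> polar_angle (th + PI) (- x) (- y).
Proof.
  intros (rho & Hr & -> & ->). exists rho. rewrite neg_cos, neg_sin.
  split; [exact Hr|]. split; ring.
Qed.

Lemma exists_angle_reduction (th : R) : exists k : Z, - PI <= th - 2 * IZR k * PI <= PI.
Proof.
  pose proof PI_RGT_0 as Hpi.
  set (z := th / (2 * PI) + 1 / 2). destruct (archimed z) as [H1 H2].
  exists (up z - 1)%Z. rewrite minus_IZR.
  assert (E : th = (z - 1 / 2) * (2 * PI)) by (unfold z; field; lra).
  rewrite E. split; nra.
Qed.

(** Along the section [psi] stays between [- 3 pi / 4] and [3 pi / 4], since to leave this interval
    it would have to take a boundary value, which is an angle of the cone. A lift that starts there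
    and ends [2 pi] beyond such a value sweeps the interval from [3 pi / 4] to [5 pi / 4] or its
    opposite. *)
Lemma arc_crosses_cone_reduced (u1 u v T : R) (s1 s2 psi x y th : R -> R) :
  (forall w, 0 < w <= u1 ->
     continuous psi w /\ polar_angle (psi w) (s1 w) (s2 w) /\ 0 < s1 w + Rabs (s2 w)) ->
  0 < u <= u1 -> 0 < v <= u1 -> 0 < T ->
  (forall t, 0 <= t <= T -> continuous th t /\ polar_angle (th t) (x t) (y t)) ->
  th 0 = psi u -> th T = psi v + 2 * PI \/ th T = psi v - 2 * PI ->
  - PI <= psi u <= PI ->
  exists t1 t2, 0 <= t1 /\ t1 < t2 /\ t2 <= T /\
    (forall t, t1 <= t <= t2 -> x t < 0 /\ Rabs (y t) <= - x t) /\
    ((y t1 = - x t1 /\ y t2 = x t2) \/ (y t1 = x t1 /\ y t2 = - x t2)).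
Proof.
  intros Hs Hu Hv HT Hth H0 HTv Hpsi. pose proof PI_RGT_0 as Hpi.
  assert (Hno : forall w, 0 < w <= u1 ->
     ~ 3 * (PI / 4) <= psi w <= 5 * (PI / 4) /\ ~ - (5 * (PI / 4)) <= psi w <= - (3 * (PI / 4))).
  { intros w Hw. destruct (Hs w Hw) as (_ & Hp & Hc). split; intro Hr.
    - destruct (polar_angle_cone _ _ _ Hr Hp). lra.
    - apply (polar_angle_shift _ _ _ (- 1)) in Hp.
      apply polar_angle_cone in Hp; lra. }
  assert (Hu' : - (3 * (PI / 4)) < psi u < 3 * (PI / 4)).
  { destruct (Hno u Hu) as [N1 N2]. split; apply Rnot_le_lt; intro; [apply N2 | apply N1]; lra. }
  assert (Hivt : forall (g : R -> R), (forall w, 0 < w <= u1 -> continuous g w) ->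
     0 < g u -> g v <= 0 -> exists w, 0 < w <= u1 /\ g w = 0).
  { intros g Hg Hgu Hgv. destruct (Rle_or_lt u v) as [Huv|Huv].
    - destruct (first_zero g u v) as (w & Hw & E & _); try assumption.
      + intros; apply Hg; lra.
      + exists w. split; [lra | exact E].
    - destruct (last_zero g v u) as (w & Hw & E & _); try lra.
      + intros; apply Hg; lra.
      + exists w. split; [lra | exact E]. }
  assert (Hv' : - (3 * (PI / 4)) < psi v < 3 * (PI / 4)).
  { split; apply Rnot_le_lt; intro Hn.
    - destruct (Hivt (fun w => psi w - - (3 * (PI / 4)))) as (w & Hw & E); try lra.
      + intros w Hw. apply (continuous_minus psi (fun _ => _)); [apply Hs, Hw | apply continuous_const].
      + destruct (Hno w Hw) as [_ N]. apply N. lra.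
    - destruct (Hivt (fun w => 3 * (PI / 4) - psi w)) as (w & Hw & E); try lra.
      + intros w Hw. apply (continuous_minus (fun _ => _) psi); [apply continuous_const | apply Hs, Hw].
      + destruct (Hno w Hw) as [N _]. apply N. lra. }
  destruct HTv as [HTv|HTv].
  - destruct (crossing_window th T (3 * (PI / 4)) (5 * (PI / 4)))
      as (t1 & t2 & L1 & L2 & L3 & E1 & E2 & Hw); try lra.
    { intros t Ht. apply Hth, Ht. }
    exists t1, t2. split; [exact L1|]. split; [exact L2|]. split; [exact L3|]. split.
    + intros t Ht. apply (polar_angle_cone (th t)); [apply Hw, Ht | apply Hth; lra].
    + left. destruct (Hth t1 ltac:(lra)) as [_ (r1 & _ & -> & ->)].
      destruct (Hth t2 ltac:(lra)) as [_ (r2 & _ & -> & ->)]. rewrite E1, E2.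
      rewrite cos_3PI4, sin_3PI4, cos_5PI4, sin_5PI4. split; field; apply sqrt2_neq_0.
  - destruct (crossing_window (fun t => - th t) T (3 * (PI / 4)) (5 * (PI / 4)))
      as (t1 & t2 & L1 & L2 & L3 & E1 & E2 & Hw); try lra.
    { intros t Ht. apply (continuous_opp th). apply Hth, Ht. }
    exists t1, t2. split; [exact L1|]. split; [exact L2|]. split; [exact L3|]. split.
    + intros t Ht. destruct (Hth t ltac:(lra)) as [_ (r & Hr & Hx & Hy)].
      destruct (polar_angle_cone (- th t) (x t) (- y t)) as [C1 C2].
      * apply Hw, Ht.
      * exists r. rewrite cos_neg, sin_neg. split; [exact Hr|]. split; [exact Hx | rewrite Hy; ring].
      * rewrite Rabs_Ropp in C2. split; assumption.
    + right. destruct (Hth t1 ltac:(lra)) as [_ (r1 & _ & -> & ->)].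
      destruct (Hth t2 ltac:(lra)) as [_ (r2 & _ & -> & ->)].
      replace (th t1) with (- (3 * (PI / 4))) by lra. replace (th t2) with (- (5 * (PI / 4))) by lra.
      rewrite !cos_neg, !sin_neg, cos_3PI4, sin_3PI4, cos_5PI4, sin_5PI4.
      split; field; apply sqrt2_neq_0.
Qed.

(* An arc that winds once between two points of a section lying off the cone
   [|y| <= - x] has to sweep the cone from one edge to the other. *)
Lemma arc_crosses_cone (u1 u v T : R) (s1 s2 psi x y th : R -> R) :
  (forall w, 0 < w <= u1 ->
     continuous psi w /\ polar_angle (psi w) (s1 w) (s2 w) /\ 0 < s1 w + Rabs (s2 w)) ->
  0 < u <= u1 -> 0 < v <= u1 -> 0 < T ->
  (forall t, 0 <= t <= T -> continuous th t /\ polar_angle (th t) (x t) (y t)) ->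
  th 0 = psi u -> th T = psi v + 2 * PI \/ th T = psi v - 2 * PI ->
  exists t1 t2, 0 <= t1 /\ t1 < t2 /\ t2 <= T /\
    (forall t, t1 <= t <= t2 -> x t < 0 /\ Rabs (y t) <= - x t) /\
    ((y t1 = - x t1 /\ y t2 = x t2) \/ (y t1 = x t1 /\ y t2 = - x t2)).
Proof.
  intros Hs Hu Hv HT Hth H0 HTv.
  destruct (exists_angle_reduction (psi u)) as [k Hk].
  assert (Hc : forall (g : R -> R) t, continuous g t -> continuous (fun s => g s - 2 * IZR k * PI) t).
  { intros g t Hg. apply (continuous_minus g (fun _ => _)); [exact Hg | apply continuous_const]. }
  apply (arc_crosses_cone_reduced u1 u v T s1 s2 (fun w => psi w - 2 * IZR k * PI) x y
           (fun t => th t - 2 * IZR k * PI)); try assumption.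
  - intros w Hw. destruct (Hs w Hw) as (A & B & D).
    split; [apply Hc, A|]. split; [apply polar_angle_shift, B | exact D].
  - intros t Ht. destruct (Hth t Ht) as (A & B).
    split; [apply Hc, A | apply polar_angle_shift, B].
  - rewrite H0. reflexivity.
  - destruct HTv as [-> | ->]; [left | right]; ring.
Qed.

Lemma derive_at_0 (s : R -> R) (p e : R) :
  s 0 = 0 -> is_derive s 0 p -> 0 < e ->
  exists d : R, 0 < d /\ forall w, 0 < w < d -> Rabs (s w - p * w) <= e * w.
Proof.
  intros H0 H He. apply is_derive_Reals in H. destruct (H e He) as (d & Hd).
  exists d. split; [apply cond_pos|]. intros w Hw.
  specialize (Hd w ltac:(lra)). rewrite Rabs_pos_eq in Hd by lra. specialize (Hd ltac:(lra)).
  rewrite Rplus_0_l, H0, Rminus_0_r in Hd.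
  replace (s w - p * w) with ((s w / w - p) * w) by (field; lra).
  rewrite Rabs_mult, (Rabs_pos_eq w) by lra. apply Rmult_le_compat_r; lra.
Qed.

(** The tangent vector [(p, q)] of the section at the origin is nonzero with [sg p >= 0], so
    [sg p + |q| > 0]. An error of a quarter of this quantity in each coordinate leaves half of
    it. *)
Lemma section_off_cone (X1 X2 : R -> R -> R) (d sg : R) (s1 s2 psi : R -> R) :
  half_section X1 X2 d s1 s2 psi -> 0 <= sg * Derive s1 0 -> sg = 1 \/ sg = - 1 ->
  exists u1, 0 < u1 <= d /\ forall w, 0 < w <= u1 -> 0 < sg * s1 w + Rabs (sg * s2 w).
Proof.
  intros (Hd & H1 & H2 & Hreg & Hnz & _) Hp Hsg.
  destruct (Hreg 0 ltac:(lra)) as (E1 & E2 & _).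
  apply Derive_correct in E1, E2.
  set (p := Derive s1 0) in *. set (q := Derive s2 0) in *.
  assert (Habs : forall z, Rabs (sg * z) = Rabs z).
  { intro z. rewrite Rabs_mult. replace (Rabs sg) with 1; [ring|].
    destruct Hsg as [-> | ->]; [rewrite Rabs_pos_eq | rewrite Rabs_left]; lra. }
  assert (Hq : 0 < sg * p + Rabs q).
  { destruct (Req_dec q 0) as [Eq|Nq].
    - assert (sg * p <> 0).
      { intro E. apply Hnz. rewrite Eq. f_equal. destruct Hsg as [-> | ->]; lra. }
      rewrite Eq, Rabs_R0. lra.
    - apply Rabs_pos_lt in Nq. lra. }
  set (e := (sg * p + Rabs q) / 4). assert (He : 0 < e) by (unfold e; lra).
  destruct (derive_at_0 s1 p e H1 E1 He) as (d1 & Hd1 & B1).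
  destruct (derive_at_0 s2 q e H2 E2 He) as (d2 & Hd2 & B2).
  exists (Rmin d (Rmin (d1 / 2) (d2 / 2))).
  pose proof (Rmin_l d (Rmin (d1 / 2) (d2 / 2))). pose proof (Rmin_r d (Rmin (d1 / 2) (d2 / 2))).
  pose proof (Rmin_l (d1 / 2) (d2 / 2)). pose proof (Rmin_r (d1 / 2) (d2 / 2)).
  split; [split; [repeat apply Rmin_pos; lra | assumption]|].
  intros w Hw. specialize (B1 w ltac:(lra)). specialize (B2 w ltac:(lra)).
  rewrite <- (Habs (s1 w - p * w)) in B1. apply Rabs_le_between in B1.
  pose proof (Rabs_triang (s2 w) (- (s2 w - q * w))) as HT. rewrite Rabs_Ropp in HT.
  replace (s2 w + - (s2 w - q * w)) with (q * w) in HT by ring.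
  rewrite Rabs_mult, (Rabs_pos_eq w) in HT by lra. rewrite Habs.
  assert (4 * e * w = (sg * p + Rabs q) * w) by (unfold e; field). nra.
Qed.

(** The return point is only known to lie somewhere on the section. By compactness and injectivity,
    the part of the section beyond [u1] keeps a positive distance from the origin, so return arcs in
    a small ball end on the initial part. *)
Lemma section_away (X1 X2 : R -> R -> R) (d u1 : R) (s1 s2 psi : R -> R) :
  half_section X1 X2 d s1 s2 psi -> 0 < u1 <= d ->
  exists eta, 0 < eta /\ forall v, 0 < v <= d -> in_ball0 eta (s1 v) (s2 v) -> v <= u1.
Proof.
  intros (Hd & H1 & H2 & Hreg & _ & Hinj & _) Hu.
  set (N := fun u => s1 u ^ 2 + s2 u ^ 2).
  destruct (continuity_ab_min N u1 d) as (mx & Hmin & Hmx); [lra | |].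
  { intros c Hc. destruct (Hreg c ltac:(lra)) as (E1 & E2 & _).
    apply continuity_pt_filterlim. apply (ex_derive_continuous N). unfold N. auto_derive. tauto. }
  assert (Hpos : 0 < N mx).
  { assert (A := pow2_ge_0 (s1 mx)). assert (B := pow2_ge_0 (s2 mx)).
    destruct (Req_dec (N mx) 0) as [E|E]; [|unfold N in *; lra].
    assert (s1 mx = 0 /\ s2 mx = 0) as [Z1 Z2] by (unfold N in E; split; nra).
    assert (mx = 0); [|lra]. apply Hinj; lra. }
  exists (sqrt (N mx)). split; [apply sqrt_lt_R0, Hpos|].
  intros v Hv Hb. apply Rnot_lt_le. intro Hlt. unfold in_ball0 in Hb.
  apply sqrt_lt_0_alt in Hb. specialize (Hmin v ltac:(lra)). unfold N in *. lra.
Qed.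

Lemma in_ball0_Rabs (eta x y : R) : in_ball0 eta x y -> Rabs x < eta /\ Rabs y < eta.
Proof.
  unfold in_ball0. intro H.
  assert (A := pow2_ge_0 x). assert (B := pow2_ge_0 y).
  assert (sqrt (x ^ 2) <= sqrt (x ^ 2 + y ^ 2)) by (apply sqrt_le_1_alt; lra).
  assert (sqrt (y ^ 2) <= sqrt (x ^ 2 + y ^ 2)) by (apply sqrt_le_1_alt; lra).
  rewrite <- (pow2_abs x) in H0 at 1. rewrite sqrt_pow2 in H0 by apply Rabs_pos.
  rewrite <- (pow2_abs y) in H1 at 1. rewrite sqrt_pow2 in H1 by apply Rabs_pos. lra.
Qed.

(** On the edges [|y| = |x|] of the cone both [P] and [x^(m+1)] are [O (x^2)], the latter because
    [m >= 1]. The side of the barrier curve on which a point of an edge lies is therefore given by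
    the sign of [y]. *)
Lemma gap_sign (P P1 P2 : R -> R -> R) (r C c k : R) (m : nat) :
  0 < r -> 0 < C -> (1 <= m)%nat -> flat_germ P P1 P2 r C ->
  exists r0, 0 < r0 /\ forall x y, 0 < Rabs x < r0 -> Rabs y = Rabs x ->
    Rabs (P x y - x ^ S m * (c + k * x)) < Rabs y.
Proof.
  intros Hr HC Hm HP. assert (Hc := Rabs_pos c). assert (Hk := Rabs_pos k).
  set (M := 2 * C + Rabs c + Rabs k). assert (HM : 0 < M) by (unfold M; lra).
  destruct (exists_small5 r 1 (/ (2 * M)) 1 1) as (r0 & H0 & L1 & L2 & L3 & _); try lra.
  { apply Rinv_0_lt_compat; lra. }
  exists r0. split; [exact H0|]. intros x y Hx Hy.
  assert (HB := flat_germ_bound P P1 P2 r C x y HP ltac:(lra) ltac:(lra)).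
  rewrite <- (pow2_abs x), <- (pow2_abs y), Hy in HB.
  assert (HX : Rabs (x ^ S m) <= Rabs x ^ 2).
  { destruct m as [|m]; [lia|]. replace (x ^ S (S m)) with (x ^ 2 * x ^ m) by (simpl; ring).
    rewrite Rabs_mult, <- RPow_abs. pose proof (pow_le_1 x m ltac:(lra)).
    pose proof (pow2_ge_0 (Rabs x)). nra. }
  assert (HG : Rabs (x ^ S m * (c + k * x)) <= Rabs x ^ 2 * (Rabs c + Rabs k)).
  { apply Rabs_mult_le; [exact HX|]. apply Rabs_plus_le; [lra|].
    rewrite Rabs_mult. nra. }
  unfold Rminus. eapply Rle_lt_trans; [apply Rabs_plus_le; [exact HB | rewrite Rabs_Ropp; exact HG]|].
  rewrite Hy.
  assert (HxM : Rabs x * M < 1).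
  { apply Rlt_le_trans with (/ (2 * M) * M); [apply Rmult_lt_compat_r; lra|].
    replace (/ (2 * M) * M) with (1 / 2) by (field; lra). lra. }
  replace (C * (Rabs x ^ 2 + Rabs x ^ 2) + Rabs x ^ 2 * (Rabs c + Rabs k)) with (Rabs x * (Rabs x * M))
    by (unfold M; ring).
  nra.
Qed.

Definition nilpotent_expansion (P P1 P2 Q : R -> R -> R) (a b : R) (m : nat) (r K : R) : Prop :=
  forall x y w, Rabs x <= r -> Rabs y <= r -> w = y + P x y ->
    Rabs (P1 x y * w + (1 + P2 x y) * Q x y - x ^ m * (a * x ^ S m + b * w))
      <= K * ((x ^ S m) ^ 2 + w ^ 2).

(** An arc that swept the cone from the edge with [sg y > 0] to the other one would have to change
    sides of the curve, which [crosses_upward_only] forbids for the gap multiplied by [sg]. *)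
Lemma barrier_blocks (P P1 P2 Q : R -> R -> R) (r C rho sg c k t1 t2 : R) (m : nat) (x y : R -> R) :
  flat_germ P P1 P2 r C -> sg = 1 \/ sg = - 1 -> t1 < t2 ->
  (forall t, t1 <= t <= t2 -> solution_at (field1 P) Q x y t /\ 0 < Rabs (x t) < rho /\
     Rabs (x t) < r /\ Rabs (y t) < r) ->
  (forall x y, 0 < Rabs x < rho -> Rabs y = Rabs x -> Rabs (P x y - x ^ S m * (c + k * x)) < Rabs y) ->
  (forall t, t1 <= t <= t2 ->
     let w := y t + P (x t) (y t) in w = x t ^ S m * (c + k * x t) ->
     0 < sg * ((P1 (x t) (y t) * w + (1 + P2 (x t) (y t)) * Q (x t) (y t))
               - (INR (S m) * c * x t ^ m + INR (S (S m)) * k * x t ^ S m) * w)) ->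
  0 < sg * y t1 -> Rabs (y t1) = Rabs (x t1) -> Rabs (y t2) = Rabs (x t2) -> 0 < sg * y t2.
Proof.
  intros HP Hsg Ht Hsol Hgap Hbar Hy1 Hc1 Hc2.
  set (w := fun t => y t + P (x t) (y t)).
  set (h := fun t => sg * (w t - x t ^ S m * (c + k * x t))).
  assert (Hdh : forall t, t1 <= t <= t2 -> is_derive h t
    (sg * ((P1 (x t) (y t) * w t + (1 + P2 (x t) (y t)) * Q (x t) (y t))
               - (INR (S m) * c * x t ^ m + INR (S (S m)) * k * x t ^ S m) * w t))).
  { intros t Htt. destruct (Hsol t Htt) as ((Dx & Dy) & _ & Hx & Hy).
    apply is_derive_scal. apply (is_derive_curve_gap x w); [exact Dx|].
    apply (is_derive_along P P1 P2 r C); try assumption. apply HP. }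
  assert (Hsign : forall t, t1 <= t <= t2 -> Rabs (y t) = Rabs (x t) ->
     (0 < sg * y t <-> 0 < h t)).
  { intros t Htt E. destruct (Hsol t Htt) as (_ & Hx & _).
    specialize (Hgap (x t) (y t) Hx E). unfold h, w.
    destruct Hsg as [-> | ->]; apply Rabs_lt_between in Hgap;
      unfold Rabs in Hgap; destruct (Rcase_abs (y t)); split; intro; lra. }
  apply (Hsign t2); [lra | exact Hc2 |].
  apply (crosses_upward_only h t1 t2).
  - intros t Htt. apply (ex_derive_continuous h). eexists. apply Hdh, Htt.
  - intros t Htt Hz. eexists. split; [|apply Hdh, Htt]. apply (Hbar t Htt).
    unfold h, w in Hz. destruct Hsg as [-> | ->]; lra.
  - apply Rlt_le, Hsign; [lra | exact Hc1 | exact Hy1].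
  - lra.
Qed.

Lemma monodromic_discriminant (P P1 P2 Q : R -> R -> R) (r C a b r' K : R) (m : nat) :
  0 < r -> 0 < C -> 0 < r' -> 0 < K -> (1 <= m)%nat -> b <> 0 ->
  flat_germ P P1 P2 r C -> nilpotent_expansion P P1 P2 Q a b m r' K ->
  monodromic (field1 P) Q -> b ^ 2 + 4 * a * INR (S m) < 0.
Proof.
  intros Hr HC Hr' HK Hm Hb HP Hexp (d & s1 & s2 & psi & Hsec & Hret).
  apply Rnot_le_lt. intro Hdisc.
  assert (Hsg : exists sg, (sg = 1 \/ sg = - 1) /\ 0 <= sg * Derive s1 0).
  { destruct (Rle_or_lt 0 (Derive s1 0)); [exists 1 | exists (- 1)]; split; auto; lra. }
  destruct Hsg as (sg & Hsg & Hside).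
  destruct (section_off_cone _ _ d sg s1 s2 psi Hsec Hside Hsg) as (u1 & Hu1 & Hoff).
  destruct (section_away _ _ d u1 s1 s2 psi Hsec Hu1) as (eta1 & He1 & Haway).
  (* Large enough for [- n c0^2] to dominate, since [c0^2 = c0 (|a| + |b| + 1)] and [c0 >= 1]. *)
  set (c0 := Rabs a + Rabs b + 1).
  assert (Hc0 : a + b * c0 - INR (S m) * c0 ^ 2 < 0).
  { assert (1 <= INR (S m)) by (apply (le_INR 1); lia).
    pose proof (RRle_abs a). pose proof (RRle_abs b). pose proof (Rabs_pos a). pose proof (Rabs_pos b).
    assert (1 <= c0) by (unfold c0; lra).
    assert (c0 ^ 2 = c0 * Rabs a + c0 * Rabs b + c0) by (unfold c0; ring). nra. }
  destruct (barrier_outer a b c0 K m HK Hc0) as (rA & HrA & HA).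
  (* The cone that the section avoids lies on the side [sg x < 0], hence the sign [- sg]. *)
  destruct (barrier_inner a b K (- sg) m HK Hb Hdisc) as (c & k & rB & HrB & HB); [lra|].
  destruct (gap_sign P P1 P2 r C c0 0 m Hr HC Hm HP) as (rC & HrC & HgA).
  destruct (gap_sign P P1 P2 r C c k m Hr HC Hm HP) as (rD & HrD & HgB).
  destruct (exists_small5 eta1 (Rmin r r') (Rmin rA rB) rC rD)
    as (eta & Heta & L1 & L2 & L3 & L4 & L5); try assumption;
    try (apply Rmin_pos; assumption).
  assert (L6 := Rle_trans _ _ _ L2 (Rmin_r _ _)). assert (L7 := Rle_trans _ _ _ L3 (Rmin_r _ _)).
  apply Rle_trans with (2 := Rmin_l _ _) in L2, L3.
  destruct (Hret eta Heta) as (eps & Heps & Hfr).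
  set (u := Rmin (eps / 2) u1).
  assert (Hu : 0 < u <= u1 /\ u < eps).
  { pose proof (Rmin_l (eps / 2) u1). pose proof (Rmin_r (eps / 2) u1).
    assert (0 < u) by (apply Rmin_pos; lra). unfold u in *. lra. }
  destruct (Hfr u ltac:(lra)) as
    (v & Hv & T & x & y & th & HT & _ & _ & ExT & EyT & Harc & _ & Hth0 & HthT).
  assert (Hvu : v <= u1).
  { apply Haway; [exact Hv|]. rewrite <- ExT, <- EyT.
    apply Rlt_le_trans with (2 := L1). apply (Harc T). lra. }
  assert (Hpolar : exists sh, forall th x y, polar_angle th x y -> polar_angle (th + sh) (sg * x) (sg * y)).
  { destruct Hsg as [-> | ->].
    - exists 0. intros. rewrite Rplus_0_r, !Rmult_1_l. assumption.
    - exists PI. intros. replace (-1 * x0) with (- x0) by ring. replace (-1 * y0) with (- y0) by ring.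
      apply polar_angle_opp. assumption. }
  destruct Hpolar as (sh & Hsh).
  assert (Hcsh : forall (g : R -> R) t, continuous g t -> continuous (fun s => g s + sh) t).
  { intros g t Hg. apply (continuous_plus g (fun _ => _)); [exact Hg | apply continuous_const]. }
  destruct Hsec as (_ & _ & _ & _ & _ & _ & _ & Hpsi).
  destruct (arc_crosses_cone u1 u v T (fun w => sg * s1 w) (fun w => sg * s2 w) (fun w => psi w + sh)
    (fun t => sg * x t) (fun t => sg * y t) (fun t => th t + sh))
    as (t1 & t2 & Ht1 & Ht12 & Ht2 & Hcone & Hends); try lra.
  { intros w Hw. destruct (Hpsi w ltac:(lra)) as [A B].
    split; [apply Hcsh, A|]. split; [apply Hsh, B | apply Hoff, Hw]. }
  { intros t Ht. destruct (Harc t Ht) as (_ & _ & A & B). split; [apply Hcsh, A | apply Hsh, B]. }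
  assert (Habs : forall z, Rabs (sg * z) = Rabs z).
  { intro z. rewrite Rabs_mult. replace (Rabs sg) with 1; [ring|].
    destruct Hsg as [-> | ->]; [rewrite Rabs_pos_eq | rewrite Rabs_left]; lra. }
  assert (Hbox : forall t, t1 <= t <= t2 -> solution_at (field1 P) Q x y t /\ 0 < Rabs (x t) < eta /\
     Rabs (x t) < r /\ Rabs (y t) < r).
  { intros t Ht. destruct (Harc t ltac:(lra)) as (S & B & _). apply in_ball0_Rabs in B.
    destruct (Hcone t Ht) as [X _]. split; [exact S|].
    assert (0 < Rabs (x t)).
    { rewrite <- Habs. apply Rabs_pos_lt. lra. }
    lra. }
  assert (Hexp' : forall t, t1 <= t <= t2 -> let w := y t + P (x t) (y t) in
    Rabs (P1 (x t) (y t) * w + (1 + P2 (x t) (y t)) * Q (x t) (y t) - x t ^ m * (a * x t ^ S m + b * w))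
      <= K * ((x t ^ S m) ^ 2 + w ^ 2)).
  { intros t Ht w. destruct (Harc t ltac:(lra)) as (_ & B & _). apply in_ball0_Rabs in B.
    apply Hexp; [lra | lra | reflexivity]. }
  assert (Hedge : forall t, t1 <= t <= t2 -> sg * y t = sg * x t \/ sg * y t = - (sg * x t) ->
     Rabs (y t) = Rabs (x t)).
  { intros t _ E. rewrite <- (Habs (y t)), <- (Habs (x t)).
    destruct E as [-> | ->]; [|rewrite Rabs_Ropp]; reflexivity. }
  destruct (Hcone t1 ltac:(lra)) as [X1 _]. destruct (Hcone t2 ltac:(lra)) as [X2 _].
  assert (HE1 := Hedge t1 ltac:(lra)). assert (HE2 := Hedge t2 ltac:(lra)).
  assert (Hsg2 : sg * sg = 1) by (destruct Hsg as [-> | ->]; ring).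
  (* Both senses of rotation have to be excluded: the outer curve stops the arcs that start with
     [sg y > 0], the inner curve those that start with [sg y < 0]. *)
  destruct Hends as [[E1 E2]|[E1 E2]].
  - assert (0 < sg * y t2); [|lra].
    apply (barrier_blocks P P1 P2 Q r C eta sg c0 0 t1 t2 m x y); auto; try lra.
    + intros p q Hp Hq. apply HgA; [lra | exact Hq].
    + intros t Ht w Hw. destruct (Hcone t Ht) as [Xt _]. destruct (Hbox t Ht) as (_ & Bt & _).
      set (G := P1 (x t) (y t) * w + (1 + P2 (x t) (y t)) * Q (x t) (y t)
        - (INR (S m) * c0 * x t ^ m + INR (S (S m)) * 0 * x t ^ S m) * w).
      assert (H : x t * G < 0) by (apply HA; [lra | exact Hw | exact (Hexp' t Ht)]).
      clearbody G. apply (Rmult_lt_reg_l (- (sg * x t))); [lra|].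
      replace (- (sg * x t) * (sg * G)) with (- ((sg * sg) * (x t * G))) by ring.
      rewrite Hsg2. lra.
  - assert (0 < - sg * y t2); [|lra].
    apply (barrier_blocks P P1 P2 Q r C eta (- sg) c k t1 t2 m x y); auto; try lra.
    + intros p q Hp Hq. apply HgB; [lra | exact Hq].
    + intros t Ht w Hw. destruct (Hcone t Ht) as [Xt _]. destruct (Hbox t Ht) as (_ & Bt & _).
      set (G := P1 (x t) (y t) * w + (1 + P2 (x t) (y t)) * Q (x t) (y t)
        - (INR (S m) * c * x t ^ m + INR (S (S m)) * k * x t ^ S m) * w).
      assert (H : 0 < x t * G) by (apply HB; [lra | lra | exact Hw | exact (Hexp' t Ht)]).
      clearbody G. apply (Rmult_lt_reg_l (- (sg * x t))); [lra|].
      replace (- (sg * x t) * (- sg * G)) with ((sg * sg) * (x t * G)) by ring.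
      rewrite Hsg2. lra.
Qed.

(** * A strict Lyapunov function *)

(** Here [alpha = - a]. The first two terms are the energy of the linear part without [b]; up to the
    error their derivative is [s b mu w^2], which gives nothing in the direction of [X]. The term in
    [e] supplies [- e alpha mu X^2], and the term in [D] supplies [- D |w|^3]. The prefix [s]
    cancels the time orientation. *)
Definition lyapunov (alpha n s e D x X w : R) : R :=
  w ^ 2 / 2 + alpha / (2 * n) * X ^ 2 + s * (e * (X * w) - D * (x * (w * Rabs w))).

(* The derivative of [lyapunov] along [x' = s w], [X' = s n mu w], [w' = s G]. *)
Definition lyapunov_dot (alpha n s e D x X mu w G : R) : R :=
  s * (w * G + alpha * mu * X * w) + e * (n * mu * w ^ 2 + X * G)
  - D * (Rabs w ^ 3 + 2 * x * Rabs w * G).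

(** Chebyshev's sum inequality for the equally ordered pairs [(p, q)] and [(p^2, q^2)]; it reduces
    the mixed cubic errors to pure cubes. *)
Lemma cubic_power_sum (p q : R) :
  0 <= p -> 0 <= q -> (p + q) * (p ^ 2 + q ^ 2) <= 2 * (p ^ 3 + q ^ 3).
Proof.
  intros Hp Hq. assert (0 <= (p + q) * (p - q) ^ 2) by (apply Rmult_le_pos; [lra | apply pow2_ge_0]).
  nra.
Qed.

(** Young's inequality bounds [b X w] by [alpha X^2 / 2] plus a multiple of [w^2], and [e] is so
    small that half of [|b| w^2] absorbs that multiple. The other two bounds on [e] keep the
    Lyapunov function positive definite. *)
Lemma exists_lyapunov_weight (alpha b n : R) :
  0 < alpha -> 0 < n -> b <> 0 ->
  exists e, 0 < e /\ e <= 1 / 4 /\ e * (4 * n) <= alpha /\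
    forall X w, - Rabs b * w ^ 2 + e * (n * w ^ 2 - alpha * X ^ 2 + b * (X * w))
      <= - (Rabs b / 2) * w ^ 2 - e * alpha / 2 * X ^ 2.
Proof.
  intros Ha Hn Hb. assert (Hb' := Rabs_pos_lt b Hb).
  set (q := n + b ^ 2 / (2 * alpha)).
  assert (Hq0 : 0 <= b ^ 2 / (2 * alpha)).
  { apply Rdiv_le_0_compat; [apply pow2_ge_0 | lra]. }
  assert (Hq : 0 < q) by (unfold q; lra).
  destruct (exists_small5 (1 / 4) (alpha / (4 * n)) (Rabs b / (2 * q)) 1 1)
    as (e & He & L1 & L2 & L3 & _); try lra; try (apply Rdiv_lt_0_compat; lra).
  exists e. split; [exact He|]. split; [exact L1|]. split.
  { apply (Rmult_le_compat_r (4 * n)) in L2; [|lra].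
    replace (alpha / (4 * n) * (4 * n)) with alpha in L2 by (field; lra). exact L2. }
  intros X w.
  assert (L3' : e * q <= Rabs b / 2).
  { apply (Rmult_le_compat_r q) in L3; [|lra].
    replace (Rabs b / (2 * q) * q) with (Rabs b / 2) in L3 by (field; lra). exact L3. }
  assert (A : b * (X * w) <= alpha / 2 * X ^ 2 + b ^ 2 / (2 * alpha) * w ^ 2).
  { apply Rmult_le_reg_l with (2 * alpha); [lra|].
    replace (2 * alpha * (alpha / 2 * X ^ 2 + b ^ 2 / (2 * alpha) * w ^ 2))
      with (alpha ^ 2 * X ^ 2 + b ^ 2 * w ^ 2) by (field; lra).
    pose proof (pow2_ge_0 (alpha * X - b * w)). nra. }
  assert (B := Rmult_le_compat_r (w ^ 2) _ _ (pow2_ge_0 w) L3').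
  apply (Rmult_le_compat_l e) in A; [|lra]. unfold q in B. lra.
Qed.

(* The term in [D] makes the derivative negative on the axis [x = 0], where [mu] vanishes
   and the cubic errors would otherwise dominate. *)
Lemma lyapunov_estimates (alpha b n s K : R) :
  0 < alpha -> 0 < n -> 0 < K -> b <> 0 -> s = 1 \/ s = - 1 -> s * b < 0 ->
  exists e D c C r : R, 0 < c /\ 0 < C /\ 0 < r /\
    forall x mu w G : R, let X := x * mu in
      Rabs x <= r -> 0 <= mu <= 1 ->
      Rabs (G - mu * (- alpha * X + b * w)) <= K * (X ^ 2 + w ^ 2) ->
      c * (X ^ 2 + w ^ 2) <= lyapunov alpha n s e D x X w <= C * (X ^ 2 + w ^ 2) /\
      - C * (mu * (X ^ 2 + w ^ 2) + Rabs w ^ 3) <= lyapunov_dot alpha n s e D x X mu w G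
        <= - c * (mu * (X ^ 2 + w ^ 2) + Rabs w ^ 3).
Proof.
  intros Ha Hn HK Hb Hs Hsb.
  destruct (exists_lyapunov_weight alpha b n Ha Hn Hb) as (e & He & He4 & Hen & Hquad).
  assert (Hbp := Rabs_pos_lt b Hb). set (B := Rabs b) in *.
  (* [H] is the coefficient of [|w|^3] caused by the quadratic error of the field. The value
     [D = H + 2] beats it and leaves [- 2 |w|^3], half of which pays for the terms that are small
     with [x]. *)
  set (H := 2 * K * (1 + e)). assert (HH : 0 < H) by (unfold H; nra).
  set (D := H + 2). assert (HD : 0 < D) by (unfold D; lra).
  set (c0 := Rmin (B / 2) (e * alpha / 2)).
  assert (Hc0 : 0 < c0) by (apply Rmin_pos; [lra | nra]).
  assert (Hc01 : c0 <= B / 2) by apply Rmin_l. assert (Hc02 : c0 <= e * alpha / 2) by apply Rmin_r.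
  (* [U] collects the coefficients that come with a factor [|x|]; the summand [8 D] serves the
     positivity of the function, where [8 D |x| <= 1] is used. *)
  set (U := H + 2 * D * (alpha + B) + 4 * D * K + 8 * D).
  assert (HU : 0 < U).
  { assert (0 < 2 * D * (alpha + B)) by (repeat apply Rmult_lt_0_compat; lra).
    assert (0 < 4 * D * K) by (repeat apply Rmult_lt_0_compat; lra). unfold U; lra. }
  set (an := alpha / (2 * n)).
  assert (Han : 0 < an) by (apply Rdiv_lt_0_compat; lra).
  assert (Han' : 2 * e <= an).
  { apply Rmult_le_reg_r with (2 * n); [lra|]. unfold an.
    replace (alpha / (2 * n) * (2 * n)) with alpha by (field; lra). lra. }
  destruct (exists_small5 (c0 / 2 / U) (1 / U) 1 1 1) as (r & Hr & L1 & L2 & L3 & _); try lra;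
    try (apply Rdiv_lt_0_compat; lra).
  assert (L1' : r * U <= c0 / 2).
  { apply (Rmult_le_compat_r U) in L1; [|lra].
    replace (c0 / 2 / U * U) with (c0 / 2) in L1 by (field; lra). exact L1. }
  assert (L2' : r * U <= 1).
  { apply (Rmult_le_compat_r U) in L2; [|lra].
    replace (1 / U * U) with 1 in L2 by (field; lra). exact L2. }
  set (c := Rmin (c0 / 2) (Rmin 1 (Rmin (1 / 8) (an / 2)))).
  assert (Hc : 0 < c) by (unfold c; repeat apply Rmin_pos; lra).
  assert (Hc1 : c <= c0 / 2) by apply Rmin_l.
  assert (Hc2 : c <= 1) by (unfold c; eapply Rle_trans; [apply Rmin_r | apply Rmin_l]).
  assert (Hc34 : c <= Rmin (1 / 8) (an / 2)) by (unfold c; eapply Rle_trans; [apply Rmin_r | apply Rmin_r]).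
  assert (Hc3 := Rle_trans _ _ _ Hc34 (Rmin_l _ _)). assert (Hc4 := Rle_trans _ _ _ Hc34 (Rmin_r _ _)).
  set (C := 2 * B + alpha + n + 2 * U + 2 + an).
  exists e, D, c, C, r.
  split; [exact Hc|]. split; [unfold C; lra|]. split; [exact Hr|].
  intros x mu w G X Hx Hmu HG.
  set (g := G - mu * (- alpha * X + b * w)) in *.
  assert (HGe : G = mu * (- alpha * X + b * w) + g) by (unfold g; ring). clearbody g.
  assert (Hx0 := Rabs_pos x). assert (HXp := Rabs_pos X). assert (Hwp := Rabs_pos w).
  assert (HX2 : Rabs X ^ 2 = X ^ 2) by apply pow2_abs. assert (Hw2 : Rabs w ^ 2 = w ^ 2) by apply pow2_abs.
  assert (HXa : Rabs X = Rabs x * mu) by (unfold X; rewrite Rabs_mult, (Rabs_pos_eq mu); lra).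
  assert (HxU : Rabs x * U <= r * U) by (apply Rmult_le_compat_r; lra).
  assert (Hs1 : Rabs s = 1) by (destruct Hs as [-> | ->]; [rewrite Rabs_pos_eq | rewrite Rabs_left]; lra).
  set (Y := X ^ 2 + w ^ 2) in *. assert (HY : 0 <= Y) by (unfold Y; pose proof (pow2_ge_0 X); pose proof (pow2_ge_0 w); lra).
  assert (HXw : Rabs X * Rabs w <= Y / 2).
  { unfold Y. rewrite <- HX2, <- Hw2. pose proof (pow2_ge_0 (Rabs X - Rabs w)). lra. }
  assert (HxD : 8 * D * Rabs x <= 1).
  { assert (Rabs x * (8 * D) <= Rabs x * U).
    { apply Rmult_le_compat_l; [exact Hx0|].
      assert (0 < 2 * D * (alpha + B)) by (repeat apply Rmult_lt_0_compat; lra).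
      assert (0 < 4 * D * K) by (repeat apply Rmult_lt_0_compat; lra). unfold U; lra. }
    lra. }
  split.
  - assert (HV : Rabs (s * (e * (X * w) - D * (x * (w * Rabs w)))) <= e * (Y / 2) + w ^ 2 / 8).
    { rewrite Rabs_mult, Hs1, Rmult_1_l. unfold Rminus.
      apply Rabs_plus_le.
      - rewrite !Rabs_mult, (Rabs_pos_eq e) by lra. apply Rmult_le_compat_l; lra.
      - rewrite Rabs_Ropp, !Rabs_mult, Rabs_Rabsolu, (Rabs_pos_eq D) by lra.
        replace (D * (Rabs x * (Rabs w * Rabs w))) with (8 * D * Rabs x * (w ^ 2 / 8)) by (rewrite <- Hw2; field).
        pose proof (pow2_ge_0 w).
        rewrite <- (Rmult_1_l (w ^ 2 / 8)) at 2. apply Rmult_le_compat_r; lra. }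
    apply Rabs_le_between in HV. unfold lyapunov. fold an.
    set (Z := s * (e * (X * w) - D * (x * (w * Rabs w)))) in *. clearbody Z.
    assert (P1 := pow2_ge_0 X). assert (P2 := pow2_ge_0 w).
    assert (Q1 : c * X ^ 2 <= an / 2 * X ^ 2) by (apply Rmult_le_compat_r; lra).
    assert (Q2 : c * w ^ 2 <= 1 / 8 * w ^ 2) by (apply Rmult_le_compat_r; lra).
    assert (Q3 : e * X ^ 2 <= an / 2 * X ^ 2) by (apply Rmult_le_compat_r; lra).
    assert (Q4 : e * w ^ 2 <= 1 / 4 * w ^ 2) by (apply Rmult_le_compat_r; lra).
    assert (Q5 : 0 <= an * X ^ 2) by (apply Rmult_le_pos; lra).
    assert (Q6 : (1 + an) * Y <= C * Y).
    { apply Rmult_le_compat_r; [exact HY | unfold C; lra]. }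
    assert (Q7 : 0 <= an * w ^ 2) by (apply Rmult_le_pos; lra).
    assert (Q8 : e * X ^ 2 <= 1 / 4 * X ^ 2) by (apply Rmult_le_compat_r; lra).
    unfold Y in *. split; lra.
  - assert (Hcube : (Rabs X + Rabs w) * Y <= 2 * (Rabs X ^ 3 + Rabs w ^ 3)).
    { unfold Y. rewrite <- HX2, <- Hw2. apply cubic_power_sum; assumption. }
    (* Because [|X| = |x| mu], the cube of [X] is a small multiple of the dissipation [mu Y]; the
       cube of [w] has no such factor and is left to the term in [D]. *)
    assert (HX3 : Rabs X ^ 3 = Rabs x * (mu * X ^ 2)).
    { rewrite <- HX2. replace (Rabs X ^ 3) with (Rabs X * Rabs X ^ 2) by ring. rewrite HXa at 1. ring. }
    set (W := Rabs w ^ 3) in *. assert (HW : 0 <= W) by (apply pow_le, Hwp).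
    assert (HmY : 0 <= mu * Y) by (apply Rmult_le_pos; lra).
    assert (HmX : mu * X ^ 2 <= mu * Y).
    { apply Rmult_le_compat_l; [lra|]. unfold Y. pose proof (pow2_ge_0 w). lra. }
    assert (HmX0 : 0 <= mu * X ^ 2) by (apply Rmult_le_pos; [lra | apply pow2_ge_0]).
    assert (E1 : Rabs ((s * w + e * X) * g) <= H * (Rabs x * (mu * Y) + W)).
    { eapply Rle_trans; [apply Rabs_mult_le; [|exact HG]|].
      - apply Rabs_plus_le with (A := Rabs w) (B := e * Rabs X); rewrite Rabs_mult;
          [rewrite Hs1; lra | rewrite (Rabs_pos_eq e); lra].
      - apply Rle_trans with ((1 + e) * K * ((Rabs X + Rabs w) * Y)).
        + replace ((Rabs w + e * Rabs X) * (K * Y)) with (K * ((Rabs w + e * Rabs X) * Y)) by ring.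
          replace ((1 + e) * K * ((Rabs X + Rabs w) * Y)) with (K * (((1 + e) * (Rabs X + Rabs w)) * Y)) by ring.
          apply Rmult_le_compat_l; [lra|]. apply Rmult_le_compat_r; [exact HY|].
          assert (0 <= e * Rabs w) by (apply Rmult_le_pos; lra). lra.
        + apply Rle_trans with ((1 + e) * K * (2 * (Rabs X ^ 3 + W))).
          * apply Rmult_le_compat_l; [apply Rmult_le_pos; lra | exact Hcube].
          * unfold H. replace ((1 + e) * K * (2 * (Rabs X ^ 3 + W))) with (2 * K * (1 + e) * (Rabs X ^ 3 + W)) by ring.
            apply Rmult_le_compat_l; [fold H; lra|]. rewrite HX3.
            apply Rplus_le_compat_r. apply Rmult_le_compat_l; assumption. }
    assert (E2 : Rabs (Rabs w * (mu * (- alpha * X + b * w))) <= (alpha + B) * (mu * Y)).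
    { rewrite !Rabs_mult, Rabs_Rabsolu, (Rabs_pos_eq mu) by lra.
      assert (T : Rabs (- alpha * X + b * w) <= alpha * Rabs X + B * Rabs w).
      { apply Rabs_plus_le; rewrite Rabs_mult; [rewrite Rabs_Ropp, (Rabs_pos_eq alpha); lra | apply Rle_refl]. }
      assert (Rabs w * Rabs (- alpha * X + b * w) <= (alpha + B) * Y).
      { apply Rle_trans with (Rabs w * (alpha * Rabs X + B * Rabs w)); [apply Rmult_le_compat_l; assumption|].
        assert (Rabs w ^ 2 <= Y) by (unfold Y; rewrite Hw2; pose proof (pow2_ge_0 X); lra).
        assert (B * Rabs w ^ 2 <= B * Y) by (apply Rmult_le_compat_l; lra).
        assert (alpha * (Rabs X * Rabs w) <= alpha * (Y / 2)) by (apply Rmult_le_compat_l; lra).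
        assert (0 <= alpha * Y) by (apply Rmult_le_pos; lra). lra. }
      replace (Rabs w * (mu * Rabs (- alpha * X + b * w))) with (mu * (Rabs w * Rabs (- alpha * X + b * w))) by ring.
      replace ((alpha + B) * (mu * Y)) with (mu * ((alpha + B) * Y)) by ring.
      apply Rmult_le_compat_l; lra. }
    assert (E3 : Rabs (Rabs w * g) <= 2 * K * (mu * Y + W)).
    { rewrite Rabs_mult, Rabs_Rabsolu.
      apply Rle_trans with (Rabs w * (K * Y)); [apply Rmult_le_compat_l; assumption|].
      assert (Rabs w * Y <= 2 * (mu * Y + W)).
      { assert (Rabs x * (mu * X ^ 2) <= mu * Y).
        { apply Rle_trans with (1 * (mu * X ^ 2)); [apply Rmult_le_compat_r; lra | lra]. }
        assert (0 <= Rabs X * Y) by (apply Rmult_le_pos; assumption). lra. }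
      replace (Rabs w * (K * Y)) with (K * (Rabs w * Y)) by ring.
      apply (Rmult_le_compat_l K) in H0; lra. }
    assert (E4 : Rabs (D * (2 * x * Rabs w * G)) <= Rabs x * (2 * D * (alpha + B) + 4 * D * K) * (mu * Y + W)).
    { replace (D * (2 * x * Rabs w * G)) with (2 * D * x * (Rabs w * (mu * (- alpha * X + b * w)) + Rabs w * g))
        by (rewrite HGe; ring).
      rewrite !Rabs_mult, (Rabs_pos_eq 2), (Rabs_pos_eq D) by lra.
      apply Rle_trans with (2 * D * Rabs x * ((alpha + B) * (mu * Y) + 2 * K * (mu * Y + W))).
      - apply Rmult_le_compat_l; [repeat apply Rmult_le_pos; lra|]. apply Rabs_plus_le; assumption.
      - replace (Rabs x * (2 * D * (alpha + B) + 4 * D * K) * (mu * Y + W))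
          with (2 * D * Rabs x * ((alpha + B) * (mu * Y + W) + 2 * K * (mu * Y + W))) by ring.
        apply Rmult_le_compat_l; [repeat apply Rmult_le_pos; lra|]. apply Rplus_le_compat_r. apply Rmult_le_compat_l; lra. }
    assert (Hsb' : s * b = - B).
    { unfold B. destruct Hs as [-> | ->]; [rewrite Rabs_left | rewrite Rabs_pos_eq]; lra. }
    assert (Edot : lyapunov_dot alpha n s e D x X mu w G =
      mu * (- B * w ^ 2 + e * (n * w ^ 2 - alpha * X ^ 2 + b * (X * w))) - D * W
      + (s * w + e * X) * g - D * (2 * x * Rabs w * G)).
    { unfold lyapunov_dot. fold W. rewrite <- Hsb'. rewrite HGe at 1 2. ring. }
    rewrite Edot. set (Z1 := (s * w + e * X) * g) in *. set (Z2 := D * (2 * x * Rabs w * G)) in *.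
    clearbody Z1 Z2. clear Edot HGe HG.
    apply Rabs_le_between in E1, E4.
    assert (HU1 : H * (Rabs x * (mu * Y)) + Rabs x * (2 * D * (alpha + B) + 4 * D * K) * (mu * Y + W)
       <= Rabs x * U * (mu * Y + W)).
    { assert (0 <= Rabs x * (H + 8 * D) * W) by (repeat apply Rmult_le_pos; lra).
      assert (0 <= Rabs x * (8 * D) * (mu * Y)) by (repeat apply Rmult_le_pos; lra). unfold U. lra. }
    split.
    + assert (Hlow : - (B + B + alpha + n) * Y <= - B * w ^ 2 + e * (n * w ^ 2 - alpha * X ^ 2 + b * (X * w))).
      { assert (P1 := pow2_ge_0 X). assert (P2 := pow2_ge_0 w).
        assert (T : Rabs (b * (X * w)) <= B * (Y / 2)) by (rewrite !Rabs_mult; apply Rmult_le_compat_l; [lra | exact HXw]).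
        apply Rabs_le_between in T.
        assert (T1 : 0 <= n * w ^ 2) by (apply Rmult_le_pos; lra). assert (T2 : 0 <= alpha * X ^ 2) by (apply Rmult_le_pos; lra).
        assert (T3 : 0 <= B * Y) by (apply Rmult_le_pos; lra).
        assert (T4 : e * (alpha * X ^ 2 + B * (Y / 2)) <= 1 * (alpha * X ^ 2 + B * (Y / 2))) by (apply Rmult_le_compat_r; lra).
        assert (T5 : e * - (alpha * X ^ 2 + B * (Y / 2)) <= e * (n * w ^ 2 - alpha * X ^ 2 + b * (X * w)))
          by (apply Rmult_le_compat_l; lra).
        assert (T6 : 0 <= alpha * w ^ 2) by (apply Rmult_le_pos; lra). assert (T7 : 0 <= n * Y) by (apply Rmult_le_pos; lra).
        assert (T8 : 0 <= B * X ^ 2) by (apply Rmult_le_pos; lra). unfold Y in *. lra. }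
      apply (Rmult_le_compat_l mu) in Hlow; [|lra].
      assert (Rabs x * U * (mu * Y + W) <= 1 * (mu * Y + W)) by (apply Rmult_le_compat_r; lra).
      assert (H * W + D * W <= 2 * U * W).
      { assert (H + D <= 2 * U).
        { assert (0 < 2 * D * (alpha + B)) by (repeat apply Rmult_lt_0_compat; lra).
          assert (0 < 4 * D * K) by (repeat apply Rmult_lt_0_compat; lra). unfold U; lra. }
        rewrite <- Rmult_plus_distr_r. apply Rmult_le_compat_r; assumption. }
      assert (0 <= (2 * U + 1 + an) * (mu * Y)) by (apply Rmult_le_pos; lra).
      assert (0 <= (2 * B + alpha + n + 1 + an) * W) by (apply Rmult_le_pos; lra).
      unfold C. lra.
    + assert (Hup := Hquad X w).
      assert (P1 := pow2_ge_0 X). assert (P2 := pow2_ge_0 w).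
      assert (T1 : c0 * w ^ 2 <= B / 2 * w ^ 2) by (apply Rmult_le_compat_r; lra).
      assert (T2 : c0 * X ^ 2 <= e * alpha / 2 * X ^ 2) by (apply Rmult_le_compat_r; lra).
      assert (Hup' : - B * w ^ 2 + e * (n * w ^ 2 - alpha * X ^ 2 + b * (X * w)) <= - c0 * Y)
        by (unfold Y; lra).
      apply (Rmult_le_compat_l mu) in Hup'; [|lra].
      assert (T3 : Rabs x * U * (mu * Y) <= c0 / 2 * (mu * Y)) by (apply Rmult_le_compat_r; lra).
      assert (T4 : Rabs x * U * W <= 1 * W) by (apply Rmult_le_compat_r; lra).
      assert (T5 : c * (mu * Y) <= c0 / 2 * (mu * Y)) by (apply Rmult_le_compat_r; lra).
      assert (T6 : c * W <= 1 * W) by (apply Rmult_le_compat_r; lra).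
      unfold D at 1. lra.
Qed.

(** Up to the error, the left-hand side is [- mu (alpha X^2 - b X w + n w^2)]. The discriminant
    makes this form definite, and [l], its determinant divided by its trace, lies below its least
    eigenvalue. The error is multiplied by [X = x mu], which provides the factor [mu]; the small [x]
    keeps its cost to half of [l]. *)
Lemma rotation_estimate (alpha b n K : R) :
  0 < alpha -> 0 < n -> 0 < K -> b ^ 2 < 4 * alpha * n ->
  exists c r : R, 0 < c /\ 0 < r /\
    forall x mu w G : R, let X := x * mu in
      Rabs x <= r -> 0 <= mu <= 1 ->
      Rabs (G - mu * (- alpha * X + b * w)) <= K * (X ^ 2 + w ^ 2) ->
      X * G - n * mu * w ^ 2 <= - c * mu * (X ^ 2 + w ^ 2).
Proof.
  intros Ha Hn HK Hdisc.
  set (l := (4 * alpha * n - b ^ 2) / (4 * (alpha + n))).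
  assert (Hl : 0 < l) by (apply Rdiv_lt_0_compat; lra).
  assert (El : 4 * (alpha + n) * l = 4 * alpha * n - b ^ 2) by (unfold l; field; lra).
  assert (Hla : l < alpha) by (pose proof (pow2_ge_0 b); nra).
  exists (l / 2), (l / (2 * K)). split; [lra|]. split; [apply Rdiv_lt_0_compat; lra|].
  intros x mu w G X Hx Hmu HG.
  set (g := G - mu * (- alpha * X + b * w)) in *.
  assert (HGe : G = mu * (- alpha * X + b * w) + g) by (unfold g; ring). clearbody g.
  assert (P1 := pow2_ge_0 X). assert (P2 := pow2_ge_0 w).
  set (Y := X ^ 2 + w ^ 2) in *. assert (HY : 0 <= Y) by (unfold Y; lra).
  assert (HF : l * Y <= alpha * X ^ 2 - b * (X * w) + n * w ^ 2).
  { apply Rmult_le_reg_l with (4 * (alpha - l)); [lra|].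
    assert (S := pow2_ge_0 (2 * (alpha - l) * X - b * w)).
    assert (4 * (alpha - l) * (n - l) = b ^ 2 + 4 * l ^ 2) by nra.
    assert (0 <= (4 * l ^ 2) * w ^ 2) by (pose proof (pow2_ge_0 l); apply Rmult_le_pos; lra).
    assert (4 * (alpha - l) * (n - l) * w ^ 2 = (b ^ 2 + 4 * l ^ 2) * w ^ 2) by (rewrite H; ring).
    unfold Y. lra. }
  assert (HxK : Rabs x * K <= l / 2).
  { apply (Rmult_le_compat_r K) in Hx; [|lra].
    replace (l / (2 * K) * K) with (l / 2) in Hx by (field; lra). exact Hx. }
  assert (HXg : X * g <= mu * (l / 2 * Y)).
  { eapply Rle_trans; [apply RRle_abs|]. unfold X at 1. rewrite !Rabs_mult, (Rabs_pos_eq mu) by lra.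
    apply Rle_trans with (Rabs x * mu * (K * Y)).
    - apply Rmult_le_compat_l; [|exact HG]. apply Rmult_le_pos; [apply Rabs_pos | lra].
    - replace (Rabs x * mu * (K * Y)) with (mu * (Rabs x * K * Y)) by ring.
      apply Rmult_le_compat_l; [lra|]. apply Rmult_le_compat_r; lra. }
  apply (Rmult_le_compat_l mu) in HF; [|lra]. rewrite HGe. lra.
Qed.

(** The function [u |u|] is differentiable at 0 too, with difference quotient [|h|], so the
    corrector causes no trouble when [w] changes sign. *)
Lemma is_derive_mult_abs (w : R -> R) (t dw : R) :
  is_derive w t dw -> is_derive (fun s => w s * Rabs (w s)) t (2 * Rabs (w t) * dw).
Proof.
  intro Hw.
  assert (H : is_derive (fun u : R => u * Rabs u) (w t) (2 * Rabs (w t))).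
  { destruct (Req_dec (w t) 0) as [E|E].
    - rewrite E, Rabs_R0, Rmult_0_r. apply is_derive_Reals. intros eps He.
      exists (mkposreal eps He). intros h Hh Hhe. simpl in Hhe.
      rewrite Rplus_0_l, Rabs_R0. replace ((h * Rabs h - 0 * 0) / h - 0) with (Rabs h) by (field; exact Hh).
      rewrite Rabs_Rabsolu. exact Hhe.
    - assert (HA := is_derive_Rabs (fun u => u) (w t) 1 (@is_derive_id R_AbsRing (w t)) E).
      replace (2 * Rabs (w t)) with (1 * Rabs (w t) + w t * (sign (w t) * 1)).
      + apply (is_derive_mult (fun u => u) Rabs); [apply @is_derive_id | exact HA | intros; apply Rmult_comm].
      + unfold Rabs. destruct (Rcase_abs (w t)).
        * rewrite sign_eq_m1 by assumption. ring.
        * rewrite sign_eq_1 by lra. ring. }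
  replace (2 * Rabs (w t) * dw) with (scal dw (2 * Rabs (w t))) by apply Rmult_comm.
  apply (is_derive_comp (fun u : R => u * Rabs u) w); assumption.
Qed.

(* [w] stands for [x' / s]; the time orientation [s] is chosen so that orbits converge. *)
Definition reduced_at (alpha b K s rho : R) (m : nat) (x w : R -> R) (t : R) : Prop :=
  Rabs (x t) <= rho /\ is_derive x t (s * w t) /\
  exists G, is_derive w t (s * G) /\
    Rabs (G - x t ^ m * (- alpha * x t ^ S m + b * w t)) <= K * ((x t ^ S m) ^ 2 + w t ^ 2).

(** The dissipation is controlled from both sides by the same quantity: the upper bound gives decay,
    while the lower one limits its speed, on which the positivity of [V] and the return to the axis
    rest. *)
Definition strict_lyapunov (alpha b K s rho c C : R) (m : nat) (V : R -> R -> R) : Prop :=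
  forall (x w : R -> R) (t : R), reduced_at alpha b K s rho m x w t ->
    c * ((x t ^ S m) ^ 2 + w t ^ 2) <= V (x t) (w t) <= C * ((x t ^ S m) ^ 2 + w t ^ 2) /\
    exists l, is_derive (fun t => V (x t) (w t)) t l /\
      - C * (x t ^ m * ((x t ^ S m) ^ 2 + w t ^ 2) + Rabs (w t) ^ 3) <= l
        <= - c * (x t ^ m * ((x t ^ S m) ^ 2 + w t ^ 2) + Rabs (w t) ^ 3).

(** The angle is that of [(X, w)], read within one of the half-planes [x > 0] and [x < 0], where it
    stays bounded; [s] undoes the time orientation. *)
Definition rotating (alpha b K s rho c : R) (m : nat) : Prop :=
  forall (x w : R -> R) (t : R), reduced_at alpha b K s rho m x w t -> x t <> 0 ->
    exists l, is_derive (fun t => s * atan (w t / x t ^ S m)) t l /\ l <= - c * x t ^ m.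

Lemma even_pow_range (x : R) (m : nat) : Nat.Even m -> Rabs x <= 1 -> 0 <= x ^ m <= 1.
Proof.
  intros [k ->] Hx. split.
  - rewrite pow_mult. apply pow_le, pow2_ge_0.
  - eapply Rle_trans; [apply RRle_abs | apply pow_le_1, Hx].
Qed.

Lemma exists_strict_lyapunov (alpha b s K : R) (m : nat) :
  0 < alpha -> 0 < K -> b <> 0 -> s = 1 \/ s = - 1 -> s * b < 0 -> Nat.Even m ->
  exists V c C r, 0 < c /\ 0 < C /\ 0 < r /\
    forall rho, rho <= r -> rho <= 1 -> strict_lyapunov alpha b K s rho c C m V.
Proof.
  intros Ha HK Hb Hs Hsb Hm.
  assert (Hn : 0 < INR (S m)) by (apply lt_0_INR; lia).
  destruct (lyapunov_estimates alpha b (INR (S m)) s K Ha Hn HK Hb Hs Hsb)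
    as (e & D & c & C & r & Hc & HC & Hr & H).
  exists (fun x w => lyapunov alpha (INR (S m)) s e D x (x ^ S m) w), c, C, r.
  split; [exact Hc|]. split; [exact HC|]. split; [exact Hr|].
  intros rho Hrho Hrho1 x w t (Hx & Dx & G & Dw & HG).
  assert (Hmu := even_pow_range (x t) m Hm ltac:(lra)).
  destruct (H (x t) (x t ^ m) (w t) G ltac:(lra) Hmu HG) as [H1 H2].
  split; [exact H1|].
  exists (lyapunov_dot alpha (INR (S m)) s e D (x t) (x t ^ S m) (x t ^ m) (w t) G).
  split; [|exact H2].
  set (n := INR (S m)) in *.
  assert (DX : is_derive (fun t => x t ^ S m) t (n * (s * w t) * x t ^ m)) by (apply is_derive_power, Dx).
  assert (DQ := is_derive_mult_abs w t _ Dw).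
  assert (Hs2 : s * s = 1) by (destruct Hs as [-> | ->]; ring).
  unfold lyapunov.
  replace (lyapunov_dot alpha n s e D (x t) (x t ^ S m) (x t ^ m) (w t) G) with
    (/ 2 * (2 * (s * G) * w t ^ 1) + alpha / (2 * n) * (2 * (n * (s * w t) * x t ^ m) * (x t ^ S m) ^ 1)
     + s * (e * (n * (s * w t) * x t ^ m * w t + x t ^ S m * (s * G))
            - D * (s * w t * (w t * Rabs (w t)) + x t * (2 * Rabs (w t) * (s * G))))).
  - apply (is_derive_plus (fun t => w t ^ 2 / 2 + alpha / (2 * n) * (x t ^ S m) ^ 2)).
    + apply (is_derive_plus (fun t => w t ^ 2 / 2)).
      * apply (is_derive_ext (fun t => / 2 * w t ^ 2)); [intro u; apply Rmult_comm|].
        apply is_derive_scal, (is_derive_power w t (s * G) 1), Dw.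
      * apply is_derive_scal, (is_derive_power (fun t => x t ^ S m) t _ 1), DX.
    + apply is_derive_scal.
      apply (is_derive_minus (fun t => e * (x t ^ S m * w t))); apply is_derive_scal.
      * apply (is_derive_mult (fun t => x t ^ S m) w); [exact DX | exact Dw | intros; apply Rmult_comm].
      * apply (is_derive_mult x (fun t => w t * Rabs (w t))); [exact Dx | exact DQ | intros; apply Rmult_comm].
  - unfold lyapunov_dot.
    replace (Rabs (w t) ^ 3) with (w t ^ 2 * Rabs (w t)) by (rewrite <- (pow2_abs (w t)); ring).
    replace (s * (e * (n * (s * w t) * x t ^ m * w t + x t ^ S m * (s * G))
            - D * (s * w t * (w t * Rabs (w t)) + x t * (2 * Rabs (w t) * (s * G)))))
      with (s * s * (e * (n * w t * x t ^ m * w t + x t ^ S m * G)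
            - D * (w t * (w t * Rabs (w t)) + x t * (2 * Rabs (w t) * G)))) by ring.
    rewrite Hs2. field. lra.
Qed.

(** The derivative of [atan (w / X)] is [(X w' - w X') / (X^2 + w^2)], whose numerator is [s] times
    the expression bounded in [rotation_estimate]. *)
Lemma exists_rotation (alpha b s K : R) (m : nat) :
  0 < alpha -> 0 < K -> b ^ 2 < 4 * alpha * INR (S m) -> s = 1 \/ s = - 1 -> Nat.Even m ->
  exists c r, 0 < c /\ 0 < r /\ forall rho, rho <= r -> rho <= 1 -> rotating alpha b K s rho c m.
Proof.
  intros Ha HK Hdisc Hs Hm.
  assert (Hn : 0 < INR (S m)) by (apply lt_0_INR; lia).
  destruct (rotation_estimate alpha b (INR (S m)) K Ha Hn HK Hdisc) as (c & r & Hc & Hr & H).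
  exists c, r. split; [exact Hc|]. split; [exact Hr|].
  intros rho Hrho Hrho1 x w t (Hx & Dx & G & Dw & HG) Hx0.
  assert (Hmu := even_pow_range (x t) m Hm ltac:(lra)).
  specialize (H (x t) (x t ^ m) (w t) G ltac:(lra) Hmu HG).
  change (x t * x t ^ m) with (x t ^ S m) in H.
  set (n := INR (S m)) in *.
  assert (DX : is_derive (fun t => x t ^ S m) t (n * (s * w t) * x t ^ m)) by (apply is_derive_power, Dx).
  assert (HX : x t ^ S m <> 0) by (apply pow_nonzero, Hx0).
  assert (Hs2 : s * s = 1) by (destruct Hs as [-> | ->]; ring).
  set (X := x t ^ S m) in *. set (mu := x t ^ m) in *.
  assert (HX2 : 0 < X ^ 2) by (apply pow2_gt_0, HX).
  assert (HY : 0 < X ^ 2 + w t ^ 2) by (pose proof (pow2_ge_0 (w t)); lra).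
  assert (Dq : is_derive (fun t => w t / x t ^ S m) t ((s * G * X - w t * (n * (s * w t) * mu)) / X ^ 2))
    by (apply (is_derive_div w (fun t => x t ^ S m)); assumption).
  assert (Dat : is_derive atan (w t / X) (/ (1 + (w t / X) ^ 2))).
  { apply is_derive_Reals. apply derivable_pt_lim_atan. }
  assert (Dc := is_derive_comp atan (fun t => w t / x t ^ S m) t _ _ Dat Dq).
  exists ((X * G - n * mu * w t ^ 2) / (X ^ 2 + w t ^ 2)). split.
  - replace ((X * G - n * mu * w t ^ 2) / (X ^ 2 + w t ^ 2))
      with (s * ((s * G * X - w t * (n * (s * w t) * mu)) / X ^ 2 * / (1 + (w t / X) ^ 2))).
    + apply is_derive_scal. exact Dc.
    + replace (s * ((s * G * X - w t * (n * (s * w t) * mu)) / X ^ 2 * / (1 + (w t / X) ^ 2)))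
        with ((s * s) * ((G * X - w t * (n * w t * mu)) / X ^ 2 * / (1 + (w t / X) ^ 2))).
      * rewrite Hs2. field. repeat split; assumption || lra.
      * field. repeat split; assumption || lra.
  - apply Rle_div_l; [exact HY|]. lra.
Qed.

(** Gronwall's argument: [g t * exp (M t)] is nondecreasing. *)
Lemma positive_of_derive_ge (g : R -> R) (M t0 : R) :
  0 < g t0 -> (forall t, t0 <= t -> exists l, is_derive g t l /\ - M * g t <= l) ->
  forall t, t0 <= t -> 0 < g t.
Proof.
  intros H0 Hd t Ht.
  assert (H : g t0 * exp (M * t0) <= g t * exp (M * t)).
  { apply (derive_nonneg_le (fun t => g t * exp (M * t))); [exact Ht|].
    intros u Hu. destruct (Hd u ltac:(lra)) as (l & Dl & Hl).
    exists (l * exp (M * u) + g u * (M * exp (M * u))). split.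
    - pose proof (exp_pos (M * u)).
      replace (l * exp (M * u) + g u * (M * exp (M * u))) with ((l + M * g u) * exp (M * u)) by ring.
      apply Rmult_le_pos; lra.
    - apply (is_derive_mult g (fun t => exp (M * t))); [exact Dl | | intros; apply Rmult_comm].
      apply (is_derive_comp exp (fun t => M * t)); [apply is_derive_exp|].
      auto_derive; [trivial | ring]. }
  pose proof (exp_pos (M * t0)). pose proof (exp_pos (M * t)).
  apply Rnot_le_lt. intro Hn. nra.
Qed.

(** The reciprocal [1 / g] grows at rate at least [c] from a positive value, so it exceeds [c t]. *)
Lemma decay_of_derive_le (g : R -> R) (c : R) :
  0 < c -> (forall t, 0 <= t -> 0 < g t) ->
  (forall t, 0 <= t -> exists l, is_derive g t l /\ l <= - c * g t ^ 2) ->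
  forall t, 0 <= t -> g t * (c * t) < 1.
Proof.
  intros Hc Hpos Hd t Ht.
  assert (H : / g 0 - c * 0 <= / g t - c * t).
  { apply (derive_nonneg_le (fun t => / g t - c * t)); [exact Ht|].
    intros u Hu. destruct (Hd u ltac:(lra)) as (l & Dl & Hl). specialize (Hpos u ltac:(lra)).
    exists (- l / g u ^ 2 - c). split.
    - enough (c <= - l / g u ^ 2) by lra. apply Rle_div_r; [apply pow_lt, Hpos | lra].
    - apply (is_derive_minus (fun t => / g t) (fun t => c * t)).
      + apply is_derive_inv; [exact Dl | lra].
      + auto_derive; [trivial | ring]. }
  assert (H0 := Hpos 0 (Rle_refl 0)). specialize (Hpos t Ht).
  apply Rinv_0_lt_compat in H0.
  assert (c * t < / g t) by lra.
  apply (Rmult_lt_compat_l (g t)) in H1; [|exact Hpos]. rewrite Rinv_r in H1; lra.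
Qed.

(** * Convergence and rotation of the orbits *)

Section Orbit.

Variables (alpha b K s rho c C c2 : R) (m : nat) (V : R -> R -> R) (x w : R -> R).

Hypothesis rho_le_1 : rho <= 1.
Hypothesis c_pos : 0 < c.
Hypothesis C_pos : 0 < C.
Hypothesis c2_pos : 0 < c2.
Hypothesis s_sign : s = 1 \/ s = - 1.
Hypothesis m_even : Nat.Even m.
Hypothesis V_lyapunov : strict_lyapunov alpha b K s rho c C m V.
Hypothesis field_rotating : rotating alpha b K s rho c2 m.
Hypothesis orbit : forall t, 0 <= t -> reduced_at alpha b K s rho m x w t.

Let v (t : R) : R := V (x t) (w t).

(** With [Y = X^2 + w^2], the bounds [|w|^3 <= |w| Y] and [c Y <= v] limit the relative rate of
    decrease of [v] to [(C / c) (x^m + |w|)]. Stated without a logarithm, this does not presuppose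
    [v > 0]. *)
Lemma lyapunov_slow_decrease (t : R) :
  0 <= t -> exists l, is_derive v t l /\ - (C / c) * (x t ^ m + Rabs (w t)) * v t <= l /\ l <= 0.
Proof.
  intro Ht. destruct (V_lyapunov x w t (orbit t Ht)) as ((HV & _) & l & Dl & Hl1 & Hl2).
  destruct (orbit t Ht) as (Hx & _).
  assert (Hmu := even_pow_range (x t) m m_even ltac:(lra)).
  assert (Hw := Rabs_pos (w t)). assert (Hw2 := pow2_abs (w t)).
  assert (HX := pow2_ge_0 (x t ^ S m)). assert (HW := pow2_ge_0 (w t)).
  set (Y := (x t ^ S m) ^ 2 + w t ^ 2) in *. assert (HY : w t ^ 2 <= Y) by (unfold Y; lra).
  assert (HY0 : 0 <= Y) by lra.
  assert (HW3 : Rabs (w t) ^ 3 <= Rabs (w t) * Y).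
  { replace (Rabs (w t) ^ 3) with (Rabs (w t) * Rabs (w t) ^ 2) by ring.
    apply Rmult_le_compat_l; lra. }
  assert (HW30 : 0 <= Rabs (w t) ^ 3) by (apply pow_le, Hw).
  assert (HmY : 0 <= x t ^ m * Y) by (apply Rmult_le_pos; lra).
  exists l. split; [exact Dl|]. split.
  - replace (- (C / c) * (x t ^ m + Rabs (w t)) * v t) with (- ((C / c) * (x t ^ m + Rabs (w t)) * v t)) by ring.
    apply Rle_trans with (- ((C / c) * (x t ^ m + Rabs (w t)) * (c * Y))).
    + apply Ropp_le_contravar, Rmult_le_compat_l; [|exact HV].
      apply Rmult_le_pos; [apply Rlt_le, Rdiv_lt_0_compat; assumption | lra].
    + replace (- (C / c * (x t ^ m + Rabs (w t)) * (c * Y))) with (- C * (x t ^ m * Y + Rabs (w t) * Y)) by (field; lra).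
      eapply Rle_trans; [|exact Hl1].
      assert (C * Rabs (w t) ^ 3 <= C * (Rabs (w t) * Y)) by (apply Rmult_le_compat_l; lra). lra.
  - assert (0 <= c * (x t ^ m * Y + Rabs (w t) ^ 3)) by (apply Rmult_le_pos; lra). lra.
Qed.

Hypothesis w_bound : forall t, 0 <= t -> Rabs (w t) <= 1.
Hypothesis v_start : 0 < v 0.

(** Both [x^m] and [|w|] are at most 1, so the relative rate of decrease is at most [2 C / c] and
    [v] cannot vanish in finite time. *)
Lemma lyapunov_positive (t : R) : 0 <= t -> 0 < v t.
Proof.
  apply (positive_of_derive_ge v (2 * (C / c)) 0 v_start).
  intros u Hu. destruct (lyapunov_slow_decrease u Hu) as (l & Dl & Hl & _).
  exists l. split; [exact Dl|].
  destruct (orbit u Hu) as (Hx & _).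
  assert (Hmu := even_pow_range (x u) m m_even ltac:(lra)). assert (Hw1 := w_bound u Hu).
  assert (Hv : 0 <= v u).
  { destruct (V_lyapunov x w u (orbit u Hu)) as ((HV & _) & _).
    eapply Rle_trans; [|exact HV]. apply Rmult_le_pos; [lra|].
    apply Rplus_le_le_0_compat; apply pow2_ge_0. }
  assert (HCc : 0 < C / c) by (apply Rdiv_lt_0_compat; assumption).
  eapply Rle_trans; [|exact Hl].
  assert (C / c * ((x u ^ m + Rabs (w u)) * v u) <= C / c * (2 * v u)).
  { apply Rmult_le_compat_l; [lra|]. apply Rmult_le_compat_r; lra. }
  lra.
Qed.

(** The bounds [X^4 <= mu X^2] and [w^4 <= |w|^3] give [v^2 <= C^2 Y^2 <= 2 C^2 (mu Y + |w|^3)] with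
    [Y = X^2 + w^2], hence [v' <= - q v^2] for [q = c / (2 C^2)]. *)
Lemma lyapunov_decay : exists q, 0 < q /\ forall t, 0 <= t -> v t * (q * t) < 1.
Proof.
  exists (c / (2 * C ^ 2)).
  assert (HC2 : 0 < C ^ 2) by (apply pow_lt; assumption).
  assert (Hq : 0 < c / (2 * C ^ 2)) by (apply Rdiv_lt_0_compat; lra).
  split; [exact Hq|].
  apply decay_of_derive_le; [exact Hq | apply lyapunov_positive|].
  intros t Ht. destruct (V_lyapunov x w t (orbit t Ht)) as ((HV1 & HV2) & l & Dl & _ & Hl).
  exists l. split; [exact Dl|]. eapply Rle_trans; [exact Hl|].
  destruct (orbit t Ht) as (Hx & _).
  assert (Hmu := even_pow_range (x t) m m_even ltac:(lra)). assert (Hw1 := w_bound t Ht).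
  assert (Hpos := lyapunov_positive t Ht). fold (v t) in HV1, HV2.
  assert (Hw := Rabs_pos (w t)). assert (Hw2 := pow2_abs (w t)).
  set (mu := x t ^ m) in *. set (X := x t ^ S m) in *. set (p := Rabs (w t)) in *.
  assert (HX2 : 0 <= X ^ 2) by apply pow2_ge_0.
  assert (HXmu : X ^ 2 <= mu).
  { replace (X ^ 2) with ((x t) ^ 2 * (mu * mu)) by (unfold X, mu; simpl; ring).
    assert (x t ^ 2 <= 1).
    { rewrite <- pow2_abs. assert (Hxp := Rabs_pos (x t)). nra. }
    assert (mu * mu <= mu) by nra. pose proof (pow2_ge_0 (x t)). nra. }
  assert (Hvsq : v t ^ 2 <= C ^ 2 * (X ^ 2 + w t ^ 2) ^ 2).
  { rewrite <- Rpow_mult_distr. apply pow_incr. lra. }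
  assert (Hsum : (X ^ 2 + w t ^ 2) ^ 2 <= 2 * (mu * (X ^ 2 + w t ^ 2) + p ^ 3)).
  { rewrite <- Hw2.
    assert (A1 : X ^ 2 * X ^ 2 <= mu * X ^ 2) by (apply Rmult_le_compat_r; assumption).
    assert (A2 : p ^ 4 <= p ^ 3).
    { replace (p ^ 4) with (p ^ 3 * p) by ring. rewrite <- (Rmult_1_r (p ^ 3)) at 2.
      apply Rmult_le_compat_l; [apply pow_le, Hw | exact Hw1]. }
    assert (A3 : 0 <= mu * p ^ 2) by (apply Rmult_le_pos; [lra | apply pow2_ge_0]).
    assert (A4 := pow2_ge_0 (X ^ 2 - p ^ 2)). lra. }
  assert (Hfin : c / (2 * C ^ 2) * v t ^ 2 <= c * (mu * (X ^ 2 + w t ^ 2) + p ^ 3)).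
  { apply Rle_trans with (c / (2 * C ^ 2) * (C ^ 2 * (2 * (mu * (X ^ 2 + w t ^ 2) + p ^ 3)))).
    - apply Rmult_le_compat_l; [lra|]. eapply Rle_trans; [exact Hvsq|].
      apply Rmult_le_compat_l; lra.
    - right. field. lra. }
  lra.
Qed.

(* If [x] kept its sign, the bounded angle [s atan (w / x^(m+1))] would decrease at rate at
   least [c2 x^m]; since [|w| = |x'|] and [w] changes sign at most once, [ln v] would then
   have bounded variation, against [v -> 0]. *)
Lemma orbit_returns_to_axis (t0 : R) : 0 <= t0 -> exists t, t0 < t /\ x t = 0.
Proof.
  intro Ht0. destruct (classic (exists t, t0 < t /\ x t = 0)) as [H|H]; [exact H|].
  exfalso.
  assert (Hnz : forall t, t0 < t -> x t <> 0) by (intros t Ht E; apply H; exists t; split; assumption).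
  clear H.
  assert (Hxc : forall t, 0 <= t -> continuous x t).
  { intros t Ht. destruct (orbit t Ht) as (_ & Dx & _).
    apply (ex_derive_continuous x). eexists. exact Dx. }
  assert (Hs2 : s * s = 1) by (destruct s_sign as [-> | ->]; ring).
  set (t1 := t0 + 1).
  assert (Hsg : exists sg, (sg = 1 \/ sg = - 1) /\ 0 < sg * x t1).
  { assert (Hx1 := Hnz t1 ltac:(unfold t1; lra)). destruct (Rlt_or_le 0 (x t1)).
    - exists 1. split; [left; reflexivity | lra].
    - exists (- 1). split; [right; reflexivity | lra]. }
  destruct Hsg as (sg & Hsg & Hsg1).
  assert (Hsg2 : sg * sg = 1) by (destruct Hsg as [-> | ->]; ring).
  assert (Hside : forall t, t1 <= t -> 0 < sg * x t).
  { intros t Ht. apply Rnot_le_lt. intro Hn.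
    destruct (first_zero (fun u => sg * x u) t1 t) as (z & Hz & Ez & _); try assumption.
    - intros u Hu. apply (continuous_scal_r sg x). apply Hxc. unfold t1 in *; lra.
    - apply (Hnz z); [unfold t1 in *; lra|]. destruct Hsg as [-> | ->]; lra. }
  set (A := fun t => s * atan (w t / x t ^ S m)).
  (* Chosen so that the derivative of [- q A] is at least [(C / c) x^m]. *)
  set (q := C / c / c2). assert (HCc : 0 < C / c) by (apply Rdiv_lt_0_compat; assumption).
  assert (Hq : 0 < q) by (apply Rdiv_lt_0_compat; assumption).
  assert (HA : forall t, t1 <= t -> exists l, is_derive A t l /\ l <= - c2 * x t ^ m).
  { intros t Ht. apply field_rotating; [apply orbit; unfold t1 in *; lra | apply Hnz; unfold t1 in *; lra]. }
  assert (Hmu : forall t, t1 <= t -> 0 < x t ^ m <= 1).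
  { intros t Ht. destruct (orbit t ltac:(unfold t1 in *; lra)) as (Hx & _).
    assert (Hmu := even_pow_range (x t) m m_even ltac:(lra)).
    assert (x t ^ m <> 0) by (apply pow_nonzero, Hnz; unfold t1 in *; lra). lra. }
  (* As [x^(m+1)] has the sign of [x], the sign of [A] is that of [sg x' = sg s w]. Since [A]
     decreases, this sign changes at most once, so [|w|] is eventually [x'] up to a fixed sign. *)
  assert (Hsw : forall t, t1 <= t -> (0 < A t -> Rabs (w t) = sg * (s * w t)) /\ (A t <= 0 -> Rabs (w t) = - (sg * (s * w t)))).
  { intros t Ht. specialize (Hside t Ht). specialize (Hmu t Ht).
    set (X := x t ^ S m).
    assert (HX : 0 < sg * X).
    { unfold X. simpl. rewrite <- Rmult_assoc. apply Rmult_lt_0_compat; lra. }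
    set (z := w t / X). assert (HXn : X <> 0) by (intro E; rewrite E in HX; lra).
    assert (Hz : w t = z * X) by (unfold z; field; exact HXn).
    assert (Hpr : sg * (s * w t) = (s * z) * (sg * X)) by (rewrite Hz; ring).
    assert (HAt : A t = s * atan z) by reflexivity.
    assert (Hat : (0 < z -> 0 < atan z) /\ (z < 0 -> atan z < 0)).
    { split; intro Hz0; [rewrite <- atan_0 at 1 | rewrite <- atan_0]; apply atan_increasing; exact Hz0. }
    destruct Hat as [Hat1 Hat2].
    assert (Habsw : Rabs (w t) = Rabs (sg * (s * w t))).
    { rewrite !Rabs_mult. replace (Rabs sg) with 1; [replace (Rabs s) with 1; [ring|]|].
      - destruct s_sign as [-> | ->]; [rewrite Rabs_pos_eq | rewrite Rabs_left]; lra.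
      - destruct Hsg as [-> | ->]; [rewrite Rabs_pos_eq | rewrite Rabs_left]; lra. }
    rewrite Habsw, Hpr, HAt. split; intro HA0.
    - apply Rabs_pos_eq. apply Rmult_le_pos; [|lra].
      apply Rnot_lt_le. intro Hn. destruct s_sign as [E | E]; rewrite E in *; [specialize (Hat2 ltac:(lra)) | specialize (Hat1 ltac:(lra))]; lra.
    - apply Rabs_left1. assert (s * z <= 0).
      2: { assert (0 <= - (s * z) * (sg * X)) by (apply Rmult_le_pos; lra). lra. }
      apply Rnot_lt_le. intro Hn. destruct s_sign as [E | E]; rewrite E in *; [specialize (Hat1 ltac:(lra)) | specialize (Hat2 ltac:(lra))]; lra. }
  (* When [|w|] is the derivative of [ze sg x], the derivative of [Z] is at least
     [(C / c) (x^m + |w|)], so [v exp Z] is nondecreasing. As [Z] is bounded above, [v] stays away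
     from 0, against its decay. *)
  assert (Hbound : forall (ze u0 : R), (ze = 1 \/ ze = - 1) -> t1 <= u0 ->
     (forall t, u0 <= t -> Rabs (w t) = ze * (sg * (s * w t))) -> False).
  { intros ze u0 Hze Hu0 Hw.
    set (Z := fun t => - q * A t + C / c * ze * (sg * x t)).
    assert (Hmono : forall t, u0 <= t -> v u0 * exp (Z u0) <= v t * exp (Z t)).
    { intros t Ht. apply (derive_nonneg_le (fun t => v t * exp (Z t))); [exact Ht|].
      intros u Hu. destruct (lyapunov_slow_decrease u ltac:(unfold t1 in *; lra)) as (l & Dl & Hl & _).
      destruct (HA u ltac:(lra)) as (la & Da & Hla).
      destruct (orbit u ltac:(unfold t1 in *; lra)) as (_ & Dx & _).
      assert (HDZ : is_derive Z u (- q * la + C / c * ze * (sg * (s * w u)))).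
      { apply (is_derive_plus (fun t => - q * A t)).
        - apply (is_derive_scal A u (- q)), Da.
        - apply (is_derive_scal (fun t => sg * x t) u (C / c * ze)), is_derive_scal, Dx. }
      exists (l * exp (Z u) + v u * ((- q * la + C / c * ze * (sg * (s * w u))) * exp (Z u))).
      split.
      - pose proof (exp_pos (Z u)). specialize (Hw u ltac:(lra)).
        assert (Hv := lyapunov_positive u ltac:(unfold t1 in *; lra)).
        replace (l * exp (Z u) + v u * ((- q * la + C / c * ze * (sg * (s * w u))) * exp (Z u)))
          with ((l + v u * (- q * la + C / c * (ze * (sg * (s * w u))))) * exp (Z u)) by ring.
        apply Rmult_le_pos; [|lra]. rewrite <- Hw.
        assert (E : C / c * x u ^ m <= - q * la).
        { apply (Rmult_le_compat_l q) in Hla; [|lra].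
          replace (q * (- c2 * x u ^ m)) with (- (C / c * x u ^ m)) in Hla by (unfold q; field; lra). lra. }
        assert (v u * (C / c * x u ^ m + C / c * Rabs (w u)) <= v u * (- q * la + C / c * Rabs (w u)))
          by (apply Rmult_le_compat_l; lra).
        lra.
      - apply (is_derive_mult v (fun t => exp (Z t))); [exact Dl | | intros; apply Rmult_comm].
        apply (is_derive_comp exp Z); [apply is_derive_exp | exact HDZ]. }
    (* The constants come from [|atan| < pi / 2 <= 2] and [|x| <= rho <= 1]. *)
    assert (HZ : forall t, u0 <= t -> Z t <= q * 2 + C / c).
    { intros t Ht. unfold Z, A.
      assert (Hat := atan_bound (w t / x t ^ S m)). assert (Hpi := PI_4).
      destruct (orbit t ltac:(unfold t1 in *; lra)) as (Hx & _).
      assert (T1 : - (s * atan (w t / x t ^ S m)) <= 2) by (destruct s_sign as [-> | ->]; lra).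
      assert (T2 : ze * (sg * x t) <= 1).
      { apply Rabs_le_between in Hx. destruct Hze as [-> | ->], Hsg as [-> | ->]; lra. }
      apply (Rmult_le_compat_l q) in T1; [|lra]. apply (Rmult_le_compat_l (C / c)) in T2; [|lra]. lra. }
    destruct lyapunov_decay as (k & Hk & Hdec).
    set (h := v u0 * exp (Z u0) / exp (q * 2 + C / c)).
    assert (Hh : 0 < h).
    { apply Rdiv_lt_0_compat; [apply Rmult_lt_0_compat|]; try apply exp_pos.
      apply lyapunov_positive. unfold t1 in *; lra. }
    assert (Hvh : forall t, u0 <= t -> h <= v t).
    { intros t Ht. apply Rle_div_l; [apply exp_pos|]. eapply Rle_trans; [apply Hmono, Ht|].
      apply Rmult_le_compat_l; [apply Rlt_le, lyapunov_positive; unfold t1 in *; lra|].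
      destruct (Rle_lt_or_eq_dec _ _ (HZ t Ht)) as [L|E]; [apply Rlt_le, exp_increasing, L | rewrite E; lra]. }
    set (t := Rmax u0 (/ (h * k))).
    assert (Htu : u0 <= t) by apply Rmax_l. assert (Htk : / (h * k) <= t) by apply Rmax_r.
    assert (Hhk : 0 < h * k) by (apply Rmult_lt_0_compat; assumption).
    specialize (Hvh t Htu). specialize (Hdec t ltac:(unfold t1 in *; lra)).
    assert (1 <= h * (k * t)).
    { rewrite <- Rmult_assoc. apply (Rmult_le_compat_l (h * k)) in Htk; [|lra]. rewrite Rinv_r in Htk; lra. }
    assert (0 <= k * t) by (apply Rmult_le_pos; unfold t1 in *; lra).
    assert (h * (k * t) <= v t * (k * t)) by (apply Rmult_le_compat_r; assumption). lra. }
  destruct (classic (exists u, t1 <= u /\ A u <= 0)) as [(u & Hu & HAu)|Hno].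
  - apply (Hbound (- 1) u); [right; reflexivity | exact Hu|].
    intros t Ht. assert (HAt : A t <= 0).
    { apply Rle_trans with (2 := HAu).
      assert (- A u <= - A t); [|lra].
      apply (derive_nonneg_le (fun t => - A t)); [exact Ht|].
      intros z Hz. destruct (HA z ltac:(lra)) as (l & Dl & Hl). exists (- l). split.
      - specialize (Hmu z ltac:(lra)). assert (0 <= c2 * x z ^ m) by (apply Rmult_le_pos; lra). lra.
      - apply (is_derive_opp A), Dl. }
    rewrite (proj2 (Hsw t ltac:(lra)) HAt). ring.
  - apply (Hbound 1 t1); [left; reflexivity | lra|].
    intros t Ht. rewrite Rmult_1_l. apply Hsw; [exact Ht|]. apply Rnot_le_lt. intro Hn.
    apply Hno. exists t. split; assumption.
Qed.

End Orbit.

(** * Continuous polar angle along an orbit *)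

Lemma exists_polar_angle (x y : R) : (x, y) <> (0, 0) -> exists th, polar_angle th x y.
Proof.
  intro Hne.
  assert (Hx := pow2_ge_0 x). assert (Hy := pow2_ge_0 y).
  assert (Hpos : 0 < x ^ 2 + y ^ 2).
  { destruct (Req_dec (x ^ 2 + y ^ 2) 0) as [E|E]; [|lra].
    exfalso. apply Hne. f_equal; apply Rsqr_0_uniq; unfold Rsqr; lra. }
  set (rho := sqrt (x ^ 2 + y ^ 2)). assert (Hr : 0 < rho) by (apply sqrt_lt_R0, Hpos).
  assert (Hr2 : rho ^ 2 = x ^ 2 + y ^ 2) by (apply pow2_sqrt; lra).
  assert (Hu2 : (x / rho) ^ 2 + (y / rho) ^ 2 = 1).
  { replace ((x / rho) ^ 2 + (y / rho) ^ 2) with ((x ^ 2 + y ^ 2) / rho ^ 2) by (field; lra).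
    rewrite Hr2. field. lra. }
  assert (Hu : - 1 <= x / rho <= 1).
  { pose proof (pow2_ge_0 (y / rho)). split; nra. }
  assert (Hcos := cos_acos _ Hu). assert (Hsin := sin_acos _ Hu).
  replace (1 - (x / rho)²) with ((y / rho)²) in Hsin by (rewrite !Rsqr_pow2; lra).
  rewrite sqrt_Rsqr_abs in Hsin.
  destruct (Rle_or_lt 0 y) as [Hy0|Hy0].
  - exists (acos (x / rho)), rho. rewrite Hcos, Hsin.
    rewrite Rabs_pos_eq by (apply Rdiv_le_0_compat; assumption).
    split; [exact Hr|]. split; field; lra.
  - exists (- acos (x / rho)), rho. rewrite cos_neg, sin_neg, Hcos, Hsin.
    assert (y / rho < 0) by (apply Rdiv_neg_pos; assumption).
    rewrite Rabs_left by assumption. split; [exact Hr|]. split; field; lra.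
Qed.

Lemma derive_zero_constant (g : R -> R) (t : R) :
  0 <= t -> (forall u, 0 <= u <= t -> is_derive g u 0) -> g t = g 0.
Proof.
  intros Ht H. apply Rle_antisym.
  - enough (- g 0 <= - g t) by lra. apply (derive_nonneg_le (fun u => - g u)); [exact Ht|].
    intros u Hu. exists (- 0). split; [lra|]. apply (is_derive_opp g), H, Hu.
  - apply derive_nonneg_le; [exact Ht|]. intros u Hu. exists 0. split; [lra | apply H, Hu].
Qed.

(** The angle is the primitive of the angular velocity from a correct initial value. It remains a
    polar angle because the coordinates of [(x, y) / rho] in the frame rotated by [th] have zero
    derivative. *)
Lemma angle_lift (x y dx dy : R -> R) :
  (forall t, 0 <= t -> is_derive x t (dx t) /\ is_derive y t (dy t)) ->
  (forall t, 0 <= t -> continuous dx t /\ continuous dy t) ->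
  (forall t, 0 <= t -> 0 < x t ^ 2 + y t ^ 2) ->
  exists th : R -> R, forall t, 0 <= t ->
    polar_angle (th t) (x t) (y t) /\
    is_derive th t ((x t * dy t - y t * dx t) / (x t ^ 2 + y t ^ 2)).
Proof.
  intros Hd Hc Hpos.
  destruct (exists_polar_angle (x 0) (y 0)) as [th0 Hth0].
  { intro E. injection E as E1 E2. specialize (Hpos 0 (Rle_refl 0)). rewrite E1, E2 in Hpos. lra. }
  set (g := fun t => (x t * dy t - y t * dx t) / (x t ^ 2 + y t ^ 2)).
  (* The positive part extends the integrand continuously to negative times, as
     [is_derive_primitive] asks for continuity on the whole line. *)
  set (pos := fun t : R => (t + Rabs t) / 2).
  assert (Hpos_nn : forall t, 0 <= pos t).
  { intro t. unfold pos. pose proof (Rle_abs (- t)) as H. rewrite Rabs_Ropp in H. lra. }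
  assert (Hpos_id : forall t, 0 <= t -> pos t = t).
  { intros t Ht. unfold pos. rewrite Rabs_pos_eq by exact Ht. field. }
  assert (Hxc : forall t, 0 <= t -> continuous x t).
  { intros t Ht. apply (ex_derive_continuous x). exists (dx t). apply (Hd t Ht). }
  assert (Hyc : forall t, 0 <= t -> continuous y t).
  { intros t Ht. apply (ex_derive_continuous y). exists (dy t). apply (Hd t Ht). }
  assert (Hgc : forall t, 0 <= t -> continuous g t).
  { intros t Ht. apply continuity_pt_filterlim. unfold g.
    assert (C1 := proj2 (continuity_pt_filterlim _ _) (Hxc t Ht)).
    assert (C2 := proj2 (continuity_pt_filterlim _ _) (Hyc t Ht)).
    assert (C3 := proj2 (continuity_pt_filterlim _ _) (proj1 (Hc t Ht))).
    assert (C4 := proj2 (continuity_pt_filterlim _ _) (proj2 (Hc t Ht))).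
    apply (continuity_pt_div (fun t => x t * dy t - y t * dx t) (fun t => x t ^ 2 + y t ^ 2)).
    - apply (continuity_pt_minus (fun t => x t * dy t) (fun t => y t * dx t));
        apply continuity_pt_mult; assumption.
    - apply (continuity_pt_plus (fun t => x t ^ 2) (fun t => y t ^ 2)); simpl.
      + apply (continuity_pt_mult x (fun t => x t * 1)); [exact C1|].
        apply (continuity_pt_mult x (fun _ => 1)); [exact C1 | apply continuity_pt_const; intros ? ?; reflexivity].
      + apply (continuity_pt_mult y (fun t => y t * 1)); [exact C2|].
        apply (continuity_pt_mult y (fun _ => 1)); [exact C2 | apply continuity_pt_const; intros ? ?; reflexivity].
    - apply Rgt_not_eq, Hpos, Ht. }
  assert (Hgp : forall t, continuous (fun u => g (pos u)) t).
  { intro t. apply (continuous_comp pos g); [|apply Hgc, Hpos_nn].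
    unfold pos, Rdiv. apply (continuous_scal_l (fun t => t + Rabs t) (/ 2) t).
    apply (continuous_plus (fun t : R => t) Rabs); [apply continuous_id | apply continuous_Rabs]. }
  set (th := fun t => th0 + RInt (fun u => g (pos u)) 0 t).
  assert (Hth : forall t, 0 <= t -> is_derive th t (g t)).
  { intros t Ht. rewrite <- (Hpos_id t Ht) at 2. apply (is_derive_primitive (fun u => g (pos u))), Hgp. }
  exists th. intros t Ht. split; [|apply Hth, Ht].
  assert (H0 : th 0 = th0).
  { unfold th. rewrite RInt_point. unfold zero; simpl. ring. }
  set (rho := fun t => sqrt (x t ^ 2 + y t ^ 2)).
  assert (Hrho : forall u, 0 <= u -> 0 < rho u) by (intros u Hu; apply sqrt_lt_R0, Hpos, Hu).
  assert (Hrho2 : forall u, 0 <= u -> rho u ^ 2 = x u ^ 2 + y u ^ 2)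
    by (intros u Hu; apply pow2_sqrt; specialize (Hpos u Hu); lra).
  set (dr := fun u => (x u * dx u + y u * dy u) / rho u).
  assert (Hdr : forall u, 0 <= u -> is_derive rho u (dr u)).
  { intros u Hu. destruct (Hd u Hu) as [D1 D2].
    replace (dr u) with ((INR 2 * dx u * x u ^ 1 + INR 2 * dy u * y u ^ 1) / (2 * sqrt (x u ^ 2 + y u ^ 2))).
    - apply (is_derive_sqrt (fun t => x t ^ 2 + y t ^ 2)); [|apply Hpos, Hu].
      apply (is_derive_plus (fun t => x t ^ 2) (fun t => y t ^ 2)); apply (is_derive_pow _ 2); assumption.
    - unfold dr. fold (rho u). simpl. field. apply Rgt_not_eq, Hrho, Hu. }
  assert (Hcs : forall u, 0 <= u ->
     is_derive (fun u => cos (th u)) u (- sin (th u) * g u) /\ is_derive (fun u => sin (th u)) u (cos (th u) * g u)).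
  { intros u Hu. split.
    - replace (- sin (th u) * g u) with (scal (g u) (- sin (th u))) by apply Rmult_comm.
      apply (is_derive_comp cos th); [apply is_derive_cos | apply Hth, Hu].
    - replace (cos (th u) * g u) with (scal (g u) (cos (th u))) by apply Rmult_comm.
      apply (is_derive_comp sin th); [apply is_derive_sin | apply Hth, Hu]. }
  (* The component of [(x, y) / rho] orthogonal to the direction [th], initially 0; the component
     along [th], initially 1, comes next. *)
  assert (HS : (y t * cos (th t) - x t * sin (th t)) / rho t = (y 0 * cos (th 0) - x 0 * sin (th 0)) / rho 0).
  { apply (derive_zero_constant (fun t => (y t * cos (th t) - x t * sin (th t)) / rho t)); [exact Ht|].
    intros u [Hu _]. destruct (Hd u Hu) as [D1 D2]. destruct (Hcs u Hu) as [D3 D4].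
    replace 0 with (((dy u * cos (th u) + y u * (- sin (th u) * g u) - (dx u * sin (th u) + x u * (cos (th u) * g u))) * rho u
        - (y u * cos (th u) - x u * sin (th u)) * dr u) / rho u ^ 2).
    - apply (is_derive_div (fun t => y t * cos (th t) - x t * sin (th t)) rho);
        [| apply Hdr, Hu | apply Rgt_not_eq, Hrho, Hu].
      apply (is_derive_minus (fun t => y t * cos (th t)) (fun t => x t * sin (th t)));
        [apply (is_derive_mult y (fun t => cos (th t))) | apply (is_derive_mult x (fun t => sin (th t)))];
        try assumption; intros; apply Rmult_comm.
    - unfold dr, g. rewrite <- (Hrho2 u Hu).
      replace ((dy u * cos (th u) + y u * (- sin (th u) * ((x u * dy u - y u * dx u) / rho u ^ 2)) -
         (dx u * sin (th u) + x u * (cos (th u) * ((x u * dy u - y u * dx u) / rho u ^ 2)))) * rho u -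
         (y u * cos (th u) - x u * sin (th u)) * ((x u * dx u + y u * dy u) / rho u))
       with ((dy u * cos (th u) - dx u * sin (th u)) * (rho u ^ 2 - (x u ^ 2 + y u ^ 2)) / rho u)
       by (field; apply Rgt_not_eq, Hrho, Hu).
      rewrite (Hrho2 u Hu), Rminus_diag. unfold Rdiv. ring. }
  assert (HC : (x t * cos (th t) + y t * sin (th t)) / rho t = (x 0 * cos (th 0) + y 0 * sin (th 0)) / rho 0).
  { apply (derive_zero_constant (fun t => (x t * cos (th t) + y t * sin (th t)) / rho t)); [exact Ht|].
    intros u [Hu _]. destruct (Hd u Hu) as [D1 D2]. destruct (Hcs u Hu) as [D3 D4].
    replace 0 with (((dx u * cos (th u) + x u * (- sin (th u) * g u) + (dy u * sin (th u) + y u * (cos (th u) * g u))) * rho u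
        - (x u * cos (th u) + y u * sin (th u)) * dr u) / rho u ^ 2).
    - apply (is_derive_div (fun t => x t * cos (th t) + y t * sin (th t)) rho);
        [| apply Hdr, Hu | apply Rgt_not_eq, Hrho, Hu].
      apply (is_derive_plus (fun t => x t * cos (th t)) (fun t => y t * sin (th t)));
        [apply (is_derive_mult x (fun t => cos (th t))) | apply (is_derive_mult y (fun t => sin (th t)))];
        try assumption; intros; apply Rmult_comm.
    - unfold dr, g. rewrite <- (Hrho2 u Hu).
      replace ((dx u * cos (th u) + x u * (- sin (th u) * ((x u * dy u - y u * dx u) / rho u ^ 2)) +
         (dy u * sin (th u) + y u * (cos (th u) * ((x u * dy u - y u * dx u) / rho u ^ 2)))) * rho u -
         (x u * cos (th u) + y u * sin (th u)) * ((x u * dx u + y u * dy u) / rho u))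
       with ((dx u * cos (th u) + dy u * sin (th u)) * (rho u ^ 2 - (x u ^ 2 + y u ^ 2)) / rho u)
       by (field; apply Rgt_not_eq, Hrho, Hu).
      rewrite (Hrho2 u Hu), Rminus_diag. unfold Rdiv. ring. }
  rewrite H0 in HS, HC. destruct Hth0 as (r0 & Hr0 & Ex & Ey).
  assert (Esc := sin2_cos2 th0). unfold Rsqr in Esc.
  assert (ER0 : rho 0 = r0).
  { unfold rho. rewrite Ex, Ey.
    replace ((r0 * cos th0) ^ 2 + (r0 * sin th0) ^ 2) with (r0 ^ 2 * (sin th0 * sin th0 + cos th0 * cos th0)) by ring.
    rewrite Esc, Rmult_1_r. apply sqrt_pow2. lra. }
  rewrite ER0, Ex, Ey in HS, HC.
  replace ((r0 * sin th0 * cos th0 - r0 * cos th0 * sin th0) / r0) with 0 in HS by (field; lra).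
  replace ((r0 * cos th0 * cos th0 + r0 * sin th0 * sin th0) / r0)
    with (sin th0 * sin th0 + cos th0 * cos th0) in HC by (field; lra).
  rewrite Esc in HC. assert (Hrt := Hrho t Ht).
  assert (HS' : y t * cos (th t) - x t * sin (th t) = 0).
  { replace (y t * cos (th t) - x t * sin (th t)) with ((y t * cos (th t) - x t * sin (th t)) / rho t * rho t) by (field; lra).
    rewrite HS. ring. }
  assert (HC' : x t * cos (th t) + y t * sin (th t) = rho t).
  { replace (x t * cos (th t) + y t * sin (th t)) with ((x t * cos (th t) + y t * sin (th t)) / rho t * rho t) by (field; lra).
    rewrite HC. ring. }
  assert (Est := sin2_cos2 (th t)). unfold Rsqr in Est.
  exists (rho t). split; [exact Hrt|]. split.
  - rewrite <- HC'. replace (x t) with (x t * (sin (th t) * sin (th t) + cos (th t) * cos (th t))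
       + (y t * cos (th t) - x t * sin (th t)) * sin (th t)) at 1 by (rewrite Est, HS'; ring). ring.
  - rewrite <- HC'. replace (y t) with (y t * (sin (th t) * sin (th t) + cos (th t) * cos (th t))
       - (y t * cos (th t) - x t * sin (th t)) * cos (th t)) at 1 by (rewrite Est, HS'; ring). ring.
Qed.

(** At the zeros of the cosine [Th] crosses upwards only, so after reaching such a level it stays
    above it. These levels are spaced by [pi], hence each new return raises the level by at least
    [pi], whatever [Th] does between returns. *)
Lemma winding_unbounded (Th : R -> R) :
  (forall t, 0 <= t -> continuous Th t) ->
  (forall t, 0 <= t -> cos (Th t) = 0 -> exists l, 0 < l /\ is_derive Th t l) ->
  (forall t, 0 <= t -> exists t', t < t' /\ cos (Th t') = 0) ->
  forall M, exists T, 0 <= T /\ forall t, T < t -> M < Th t.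
Proof.
  intros Hc Hd Hr. pose proof PI_RGT_0 as Hpi.
  assert (Hup : forall t1 t, 0 <= t1 -> cos (Th t1) = 0 -> t1 < t -> Th t1 < Th t).
  { intros t1 t Ht1 E Ht. apply Rlt_0_minus.
    apply (crosses_upward_only (fun u => Th u - Th t1) t1 t); [| | lra | lra].
    - intros u Hu. apply (continuous_minus Th (fun _ => _)); [apply Hc; lra | apply continuous_const].
    - intros u Hu Eu. replace (Th t1) with (Th u) in E by lra.
      destruct (Hd u ltac:(lra) E) as (l & Hl & Dl). exists l. split; [exact Hl|].
      rewrite <- (Rminus_0_r l).
      apply (is_derive_minus Th (fun _ => _)); [exact Dl | apply @is_derive_const]. }
  destruct (Hr 0 (Rle_refl 0)) as (t0 & Ht0 & E0).
  assert (Hn : forall k : nat, exists t, 0 <= t /\ cos (Th t) = 0 /\ Th t0 + INR k * PI <= Th t).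
  { induction k as [|k (t & Ht & E & L)].
    - exists t0. simpl. split; [lra|]. split; [exact E0 | lra].
    - destruct (Hr t Ht) as (t' & Htt' & E'). exists t'. split; [lra|]. split; [exact E'|].
      assert (Hlt := Hup t t' Ht E Htt').
      destruct (cos_eq_0_0 _ E) as [z Ez]. destruct (cos_eq_0_0 _ E') as [z' Ez'].
      assert (Hz : (z < z')%Z).
      { apply lt_IZR. apply Rmult_lt_reg_r with PI; lra. }
      assert (IZR z + 1 <= IZR z') by (rewrite <- plus_IZR; apply IZR_le; lia).
      rewrite S_INR. assert ((IZR z + 1) * PI <= IZR z' * PI) by (apply Rmult_le_compat_r; lra). lra. }
  intro M.
  destruct (archimed ((M - Th t0) / PI)) as [Hk _].
  set (k := Z.to_nat (up ((M - Th t0) / PI))).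
  assert (Hk' : (M - Th t0) / PI < INR k).
  { eapply Rlt_le_trans; [exact Hk|]. unfold k. rewrite INR_IZR_INZ. apply IZR_le. lia. }
  destruct (Hn k) as (t & Ht & E & L). exists t. split; [exact Ht|].
  intros u Hu. assert (H := Hup t u Ht E Hu).
  apply Rlt_div_l in Hk'; [|exact Hpi]. lra.
Qed.

(** * Proof of the theorem *)

(** Being 1-Lipschitz, the projection onto [[- r, r]] extends a Lipschitz field from a square to the
    whole plane with the same constant. *)
Definition clamp (r z : R) : R := Rmax (- r) (Rmin z r).

Lemma clamp_range (r z : R) : 0 < r -> Rabs (clamp r z) <= r.
Proof.
  intro Hr. unfold clamp. apply Rabs_le. split; [apply Rmax_l|].
  apply Rmax_lub; [lra | apply Rmin_r].
Qed.

Lemma clamp_id (r z : R) : Rabs z <= r -> clamp r z = z.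
Proof.
  intro Hz. apply Rabs_le_between in Hz. unfold clamp. rewrite Rmin_left, Rmax_right; lra.
Qed.

Lemma clamp_lipschitz (r z z' : R) : Rabs (clamp r z' - clamp r z) <= Rabs (z' - z).
Proof.
  unfold clamp, Rmax, Rmin.
  repeat (destruct (Rle_dec _ _)); unfold Rabs; repeat (destruct (Rcase_abs _)); lra.
Qed.

Lemma clamped_lipschitz (f : R -> R -> R) (r L : R) :
  0 < r -> 0 <= L -> lipschitz2 f r L -> lipschitz_plane (fun x y => f (clamp r x) (clamp r y)) L.
Proof.
  intros Hr HL Hf x y x' y'.
  eapply Rle_trans; [apply Hf; apply clamp_range, Hr|].
  apply Rmult_le_compat_l; [exact HL|]. apply Rplus_le_compat; apply clamp_lipschitz.
Qed.

Lemma flat_germ_lipschitz (f f1 f2 : R -> R -> R) (r C : R) :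
  0 < r -> 0 < C -> flat_germ f f1 f2 r C -> lipschitz2 f r (4 * C * r).
Proof.
  intros Hr HC Hf x y x' y' Hx Hy Hx' Hy'.
  destruct (flat_germ_gradient_bound f f1 f2 r C x y Hf Hx Hy) as [B1 B2].
  destruct Hf as (H & _). specialize (H x y x' y' Hx Hy Hx' Hy').
  rewrite <- (pow2_abs (x' - x)), <- (pow2_abs (y' - y)) in H.
  assert (Dx : Rabs (x' - x) <= 2 * r).
  { unfold Rminus. eapply Rle_trans; [apply Rabs_triang|]. rewrite Rabs_Ropp. lra. }
  assert (Dy : Rabs (y' - y) <= 2 * r).
  { unfold Rminus. eapply Rle_trans; [apply Rabs_triang|]. rewrite Rabs_Ropp. lra. }
  assert (Px := Rabs_pos (x' - x)). assert (Py := Rabs_pos (y' - y)).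
  set (p := Rabs (x' - x)) in *. set (q := Rabs (y' - y)) in *.
  assert (G : C * (Rabs x + Rabs y) <= 2 * C * r).
  { replace (2 * C * r) with (C * (r + r)) by ring. apply Rmult_le_compat_l; lra. }
  assert (T1 : Rabs (f1 x y * (x' - x)) <= 2 * C * r * p) by (apply Rabs_mult_le; [lra | apply Rle_refl]).
  assert (T2 : Rabs (f2 x y * (y' - y)) <= 2 * C * r * q) by (apply Rabs_mult_le; [lra | apply Rle_refl]).
  assert (T3 : C * (p ^ 2 + q ^ 2) <= C * (2 * r * p + 2 * r * q)).
  { apply Rmult_le_compat_l; [lra|]. nra. }
  replace (f x' y' - f x y) with
    ((f x' y' - f x y - (f1 x y * (x' - x) + f2 x y * (y' - y))) + (f1 x y * (x' - x) + f2 x y * (y' - y))) by ring.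
  eapply Rle_trans; [apply Rabs_plus_le; [exact H | apply Rabs_plus_le; eassumption]|]. lra.
Qed.

(** The curve is a global solution of the clamped field; it satisfies the original equation wherever
    the clamp is the identity. *)
Lemma ode_solution_in_box (X1 X2 : R -> R -> R) (r L x0 y0 : R) :
  0 < r -> 0 < L -> lipschitz2 X1 r L -> lipschitz2 X2 r L ->
  exists x y : R -> R, x 0 = x0 /\ y 0 = y0 /\
    (forall t, continuous x t /\ continuous y t) /\
    forall t, Rabs (x t) <= r -> Rabs (y t) <= r -> solution_at X1 X2 x y t.
Proof.
  intros Hr HL H1 H2.
  destruct (ode_global_solution _ _ L x0 y0 HL
    (clamped_lipschitz X1 r L Hr (Rlt_le _ _ HL) H1) (clamped_lipschitz X2 r L Hr (Rlt_le _ _ HL) H2))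
    as (x & y & Ex & Ey & H).
  exists x, y. split; [exact Ex|]. split; [exact Ey|]. split.
  - intro t. destruct (H t) as [D1 D2]. split.
    + apply (ex_derive_continuous x). eexists. exact D1.
    + apply (ex_derive_continuous y). eexists. exact D2.
  - intros t Hx Hy. destruct (H t) as [D1 D2].
    rewrite (clamp_id r (x t) Hx), (clamp_id r (y t) Hy) in D1, D2. split; assumption.
Qed.

Lemma lipschitz2_scal (f : R -> R -> R) (r L s : R) :
  s = 1 \/ s = - 1 -> lipschitz2 f r L -> lipschitz2 (fun x y => s * f x y) r L.
Proof.
  intros Hs Hf x y x' y' Hx Hy Hx' Hy'.
  replace (s * f x' y' - s * f x y) with (s * (f x' y' - f x y)) by ring.
  rewrite Rabs_mult. replace (Rabs s) with 1.
  - rewrite Rmult_1_l. apply Hf; assumption.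
  - destruct Hs as [-> | ->]; [rewrite Rabs_pos_eq | rewrite Rabs_left]; lra.
Qed.

Lemma field1_lipschitz (P P1 P2 : R -> R -> R) (r C : R) :
  0 < r -> 0 < C -> flat_germ P P1 P2 r C -> lipschitz2 (field1 P) r (1 + 4 * C * r).
Proof.
  intros Hr HC HP x y x' y' Hx Hy Hx' Hy'. unfold field1.
  assert (H := flat_germ_lipschitz P P1 P2 r C Hr HC HP x y x' y' Hx Hy Hx' Hy').
  replace (y' + P x' y' - (y + P x y)) with ((y' - y) + (P x' y' - P x y)) by ring.
  eapply Rle_trans; [apply Rabs_plus_le; [apply Rle_refl | exact H]|].
  pose proof (Rabs_pos (x' - x)). lra.
Qed.

(** On such a square [|P|] is at most an eighth of [|x| + |y|], so smallness passes between [(x, y)]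
    and [(x, w)] in both directions. *)
Lemma y_of_w (P P1 P2 : R -> R -> R) (r C x y : R) :
  0 < r -> 0 < C -> flat_germ P P1 P2 r C -> C * r <= 1 / 8 -> Rabs x <= r -> Rabs y <= r ->
  Rabs y <= 2 * Rabs (y + P x y) + Rabs x / 4 /\ Rabs (y + P x y) <= 2 * (Rabs x + Rabs y).
Proof.
  intros Hr HC HP HCr Hx Hy.
  assert (HB := flat_germ_bound P P1 P2 r C x y HP Hx Hy).
  assert (Px := Rabs_pos x). assert (Py := Rabs_pos y).
  rewrite <- (pow2_abs x), <- (pow2_abs y) in HB.
  assert (E : C * (Rabs x ^ 2 + Rabs y ^ 2) <= 1 / 8 * (Rabs x + Rabs y)).
  { apply Rle_trans with (C * (r * Rabs x + r * Rabs y)).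
    - apply Rmult_le_compat_l; [lra|].
      assert (Rabs x * Rabs x <= r * Rabs x) by (apply Rmult_le_compat_r; lra).
      assert (Rabs y * Rabs y <= r * Rabs y) by (apply Rmult_le_compat_r; lra). lra.
    - replace (C * (r * Rabs x + r * Rabs y)) with (C * r * (Rabs x + Rabs y)) by ring.
      apply Rmult_le_compat_r; lra. }
  split.
  - pose proof (Rabs_triang (y + P x y) (- P x y)) as T. rewrite Rabs_Ropp in T.
    replace (y + P x y + - P x y) with y in T by ring. lra.
  - eapply Rle_trans; [apply Rabs_triang|]. lra.
Qed.

Lemma reduced_of_solution (P P1 P2 Q : R -> R -> R) (r C a b r' K s rho : R) (m : nat) (x y : R -> R) (t : R) :
  flat_germ P P1 P2 r C -> nilpotent_expansion P P1 P2 Q a b m r' K ->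
  rho < r -> rho <= r' -> Rabs (x t) <= rho -> Rabs (y t) <= rho ->
  solution_at (fun x y => s * field1 P x y) (fun x y => s * Q x y) x y t ->
  reduced_at (- a) b K s rho m x (fun t => y t + P (x t) (y t)) t.
Proof.
  intros HP Hexp Hr Hr' Hx Hy [Dx Dy]. split; [exact Hx|]. split; [exact Dx|].
  exists (P1 (x t) (y t) * (y t + P (x t) (y t)) + (1 + P2 (x t) (y t)) * Q (x t) (y t)). split.
  - replace (s * (P1 (x t) (y t) * (y t + P (x t) (y t)) + (1 + P2 (x t) (y t)) * Q (x t) (y t)))
      with (P1 (x t) (y t) * (s * field1 P (x t) (y t)) + (1 + P2 (x t) (y t)) * (s * Q (x t) (y t)))
      by (unfold field1; ring).
    apply (is_derive_along P P1 P2 r C); try assumption; try lra. apply HP.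
  - rewrite Ropp_involutive. apply Hexp; [lra | lra | reflexivity].
Qed.

Lemma is_lim_0_eps (f : R -> R) :
  (forall e, 0 < e -> exists T, forall t, T < t -> Rabs (f t) < e) -> is_lim f p_infty 0.
Proof.
  intro H. apply is_lim_spec. intro e. destruct (H e (cond_pos e)) as [T HT].
  exists T. intros t Ht. rewrite Rminus_0_r. apply HT, Ht.
Qed.

Lemma Rabs_lt_of_pow (x d : R) (k : nat) : 0 < d -> (x ^ S k) ^ 2 < (d ^ S k) ^ 2 -> Rabs x < d.
Proof.
  intros Hd H. apply Rnot_le_lt. intro Hn.
  assert (d ^ S k <= Rabs x ^ S k) by (apply pow_incr; lra).
  assert (0 < d ^ S k) by (apply pow_lt, Hd).
  rewrite <- (pow2_abs (x ^ S k)), <- RPow_abs in H.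
  assert ((d ^ S k) ^ 2 <= (Rabs x ^ S k) ^ 2) by (apply pow_incr; lra). lra.
Qed.

Lemma in_ball0_of_Rabs (eta x y : R) : 0 < eta -> x ^ 2 + y ^ 2 < eta ^ 2 -> in_ball0 eta x y.
Proof.
  intros He H. unfold in_ball0. rewrite <- (sqrt_pow2 eta) by lra.
  apply sqrt_lt_1_alt. split; [|exact H]. apply Rplus_le_le_0_compat; apply pow2_ge_0.
Qed.

Lemma spirals_ext (X1 X2 Y1 Y2 : R -> R -> R) :
  (forall x y, X1 x y = Y1 x y) -> (forall x y, X2 x y = Y2 x y) ->
  spirals_to_origin X1 X2 -> spirals_to_origin Y1 Y2.
Proof.
  intros E1 E2 H eta Heta. destruct (H eta Heta) as (r & Hr & Hsp). exists r. split; [exact Hr|].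
  intros x0 y0 Hb Hne. destruct (Hsp x0 y0 Hb Hne) as (x & y & th & Hx & Hy & Ht & Hl).
  exists x, y, th. split; [exact Hx|]. split; [exact Hy|]. split; [|exact Hl].
  intros t Ht0. destruct (Ht t Ht0) as ([D1 D2] & Hrest). split; [|exact Hrest].
  rewrite E1 in D1. rewrite E2 in D2. split; assumption.
Qed.

Lemma nilpotent_spirals (P P1 P2 Q Q1 Q2 : R -> R -> R) (r C a b r' K s : R) (m : nat) :
  0 < r -> 0 < C -> 0 < r' -> 0 < K -> b <> 0 -> Nat.Even m ->
  flat_germ P P1 P2 r C -> flat_germ Q Q1 Q2 r C -> nilpotent_expansion P P1 P2 Q a b m r' K ->
  b ^ 2 + 4 * a * INR (S m) < 0 -> s = 1 \/ s = - 1 -> s * b < 0 ->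
  spirals_to_origin (fun x y => s * field1 P x y) (fun x y => s * Q x y).
Proof.
  intros Hr HC Hr' HK Hb Hm HP HQ Hexp Hdisc Hs Hsb eta Heta.
  assert (Hn : 0 < INR (S m)) by (apply lt_0_INR; lia).
  assert (Ha : 0 < - a).
  { pose proof (pow2_ge_0 b). apply Rnot_le_lt. intro. assert (0 <= a * INR (S m)) by (apply Rmult_le_pos; lra). lra. }
  destruct (exists_strict_lyapunov (- a) b s K m Ha HK Hb Hs Hsb Hm) as (V & c & CV & rL & Hc & HCV & HrL & HL).
  destruct (exists_rotation (- a) b s K m Ha HK ltac:(lra) Hs Hm) as (c2 & rR & Hc2 & HrR & HR).
  assert (HC8 : 0 < / (8 * C)) by (apply Rinv_0_lt_compat; lra).
  destruct (exists_small5 (r / 2) r' (Rmin rL rR) (1 / 4) (/ (8 * C)))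
    as (rho & Hrho & L1 & L2 & L3 & L4 & L5); try lra.
  { apply Rmin_pos; assumption. }
  assert (L6 := Rle_trans _ _ _ L3 (Rmin_r _ _)). apply Rle_trans with (2 := Rmin_l _ _) in L3.
  specialize (HL rho L3 ltac:(lra)). specialize (HR rho L6 ltac:(lra)).
  assert (HCrho : C * rho <= 1 / 8).
  { apply (Rmult_le_compat_l C) in L5; [|lra].
    replace (C * / (8 * C)) with (1 / 8) in L5 by (field; lra). exact L5. }
  assert (HPr := flat_germ_weaken P P1 P2 r C rho C ltac:(lra) (Rle_refl C) HP).
  assert (HQr := flat_germ_weaken Q Q1 Q2 r C rho C ltac:(lra) (Rle_refl C) HQ).
  set (eta' := Rmin eta rho).
  assert (Heta' : 0 < eta') by (apply Rmin_pos; assumption).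
  assert (He1 : eta' <= eta) by apply Rmin_l. assert (He2 : eta' <= rho) by apply Rmin_r.
  (* If [|x| < d] and [|w| < d], then [|y| <= 2 d + d / 4 < eta' / 2], so the point lies in the ball
     of radius [eta']. The level [v0] below is such that [V < v0] forces these two bounds. *)
  set (d := eta' / 8). assert (Hd : 0 < d) by (unfold d; lra).
  assert (Hdn : 0 < (d ^ S m) ^ 2) by (apply pow_lt, pow_lt, Hd).
  assert (Hdn1 : (d ^ S m) ^ 2 <= d ^ 2).
  { apply pow_incr. split; [apply pow_le; lra|]. rewrite <- (Rmult_1_r d) at 2. simpl.
    apply Rmult_le_compat_l; [lra|]. rewrite <- (pow1 m). apply pow_incr. unfold d; lra. }
  set (v0 := c * (d ^ S m) ^ 2). assert (Hv0 : 0 < v0) by (apply Rmult_lt_0_compat; assumption).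
  (* For a starting point within [r0] one has [X^2 <= r0] and [w^2 <= 4 r0], hence
     [V <= 5 CV r0 < v0]. *)
  destruct (exists_small5 (d / 2) (v0 / (20 * CV)) 1 1 1) as (r0 & Hr0 & M1 & M2 & _); try lra.
  { apply Rdiv_lt_0_compat; lra. }
  exists r0. split; [exact Hr0|].
  intros x0 y0 Hb0 Hne.
  destruct (ode_solution_in_box (fun x y => s * field1 P x y) (fun x y => s * Q x y) rho (1 + 4 * C * rho) x0 y0)
    as (x & y & Ex0 & Ey0 & Hcont & Hsol).
  { exact Hrho. } { assert (0 < C * rho) by (apply Rmult_lt_0_compat; lra). lra. }
  { apply lipschitz2_scal; [exact Hs|]. apply (field1_lipschitz P P1 P2); assumption. }
  { apply lipschitz2_scal; [exact Hs|].
    apply (lipschitz2_weaken Q rho (4 * C * rho)); [apply Rle_refl | lra |].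
    apply (flat_germ_lipschitz Q Q1 Q2); assumption. }
  set (w := fun t => y t + P (x t) (y t)).
  assert (Hred : forall t, Rabs (x t) <= rho -> Rabs (y t) <= rho -> reduced_at (- a) b K s rho m x w t).
  { intros t Hx Hy. apply (reduced_of_solution P P1 P2 Q r C a b r' K); try assumption; try lra.
    apply Hsol; assumption. }
  set (v := fun t => V (x t) (w t)).
  assert (Hbox : forall z z' : R, z ^ 2 + z' ^ 2 <= eta' ^ 2 -> Rabs z <= eta' /\ Rabs z' <= eta').
  { intros z z' H. pose proof (pow2_ge_0 z). pose proof (pow2_ge_0 z').
    rewrite <- (Rabs_pos_eq eta') by lra. split; apply Rsqr_le_abs_0; rewrite !Rsqr_pow2; lra. }
  apply in_ball0_Rabs in Hb0. destruct Hb0 as [Hx0 Hy0].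
  assert (Hstart : v 0 < v0).
  { assert (Hx1 : Rabs (x 0) <= rho) by (rewrite Ex0; unfold d in *; lra).
    assert (Hy1 : Rabs (y 0) <= rho) by (rewrite Ey0; unfold d in *; lra).
    destruct (HL x w 0 (Hred 0 Hx1 Hy1)) as ((_ & HV) & _). fold (v 0) in HV.
    destruct (y_of_w P P1 P2 rho C (x 0) (y 0) Hrho HC HPr HCrho Hx1 Hy1) as [_ Hw].
    fold (w 0) in Hw. rewrite Ex0, Ey0 in Hw. rewrite Ex0 in HV.
    assert (Px := Rabs_pos x0). assert (Py := Rabs_pos y0).
    assert (HX : (x0 ^ S m) ^ 2 <= Rabs x0).
    { rewrite <- (pow2_abs (x0 ^ S m)), <- RPow_abs.
      assert (A1 : Rabs x0 ^ S m <= Rabs x0).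
      { rewrite <- (Rmult_1_r (Rabs x0)) at 2. simpl. apply Rmult_le_compat_l; [lra|].
        rewrite <- (pow1 m). apply pow_incr. unfold d in *; lra. }
      assert (A2 : 0 <= Rabs x0 ^ S m) by (apply pow_le; lra).
      set (z := Rabs x0 ^ S m) in *. assert (Hz1 : z <= 1) by (unfold d in *; lra).
      assert (z * z <= z * 1) by (apply Rmult_le_compat_l; assumption). lra. }
    assert (HW : w 0 ^ 2 <= 4 * r0).
    { rewrite <- pow2_abs. assert (Pw := Rabs_pos (w 0)). unfold d in *.
      assert (Hw1 : Rabs (w 0) <= 1) by lra.
      assert (Rabs (w 0) * Rabs (w 0) <= Rabs (w 0) * 1) by (apply Rmult_le_compat_l; assumption). lra. }
    eapply Rle_lt_trans; [exact HV|].
    apply Rle_lt_trans with (CV * (5 * r0)); [apply Rmult_le_compat_l; lra|].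
    assert (M2' : r0 * (20 * CV) <= v0) by (apply Rle_div_r; [lra | exact M2]). 
    assert (0 < CV * r0) by (apply Rmult_lt_0_compat; assumption). lra. }
  (* [V] is known to decrease only while the orbit is in the square, so confinement and decrease are
     proved together. *)
  assert (Htrap : forall t, 0 <= t -> x t ^ 2 + y t ^ 2 < eta' ^ 2).
  { apply (trapping (fun t => x t ^ 2 + y t ^ 2)).
    - intros t _. destruct (Hcont t) as [C1 C2].
      apply (continuous_plus (fun t => x t ^ 2) (fun t => y t ^ 2)).
      + apply (continuous_mult x (fun t => x t * 1)); [exact C1|].
        apply (continuous_mult x (fun _ => 1)); [exact C1 | apply continuous_const].
      + apply (continuous_mult y (fun t => y t * 1)); [exact C2|].
        apply (continuous_mult y (fun _ => 1)); [exact C2 | apply continuous_const].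
    - rewrite Ex0, Ey0, <- (pow2_abs x0), <- (pow2_abs y0).
      assert (Px := Rabs_pos x0). assert (Py := Rabs_pos y0).
      assert (Hx2 : Rabs x0 ^ 2 <= (eta' / 8) ^ 2) by (apply pow_incr; unfold d in *; lra).
      assert (Hy2 : Rabs y0 ^ 2 <= (eta' / 8) ^ 2) by (apply pow_incr; unfold d in *; lra).
      assert (0 < eta' ^ 2) by (apply pow_lt, Heta'). lra.
    - intros t Ht Hin.
      assert (Hbx : forall u, 0 <= u <= t -> reduced_at (- a) b K s rho m x w u).
      { intros u Hu. destruct (Hbox _ _ (Hin u Hu)). apply Hred; lra. }
      assert (Hvt : v t < v0).
      { apply Rle_lt_trans with (2 := Hstart).
        enough (- v 0 <= - v t) by lra.
        apply (derive_nonneg_le (fun t => - v t)); [exact Ht|].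
        intros u Hu. destruct (HL x w u (Hbx u Hu)) as (_ & l & Dl & _ & Hl).
        destruct (Hbx u Hu) as (Hxu & _).
        assert (Hmu := even_pow_range (x u) m Hm ltac:(lra)).
        exists (- l). split; [|apply (is_derive_opp v), Dl].
        assert (0 <= x u ^ m * ((x u ^ S m) ^ 2 + w u ^ 2)).
        { apply Rmult_le_pos; [lra|]. apply Rplus_le_le_0_compat; apply pow2_ge_0. }
        assert (0 <= Rabs (w u) ^ 3) by (apply pow_le, Rabs_pos).
        assert (0 <= c * (x u ^ m * ((x u ^ S m) ^ 2 + w u ^ 2) + Rabs (w u) ^ 3)) by (apply Rmult_le_pos; lra).
        lra. }
      destruct (HL x w t (Hbx t ltac:(lra))) as ((HV & _) & _). fold (v t) in HV.
      assert (HY : (x t ^ S m) ^ 2 + w t ^ 2 < (d ^ S m) ^ 2).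
      { apply Rmult_lt_reg_l with c; [exact Hc|]. fold v0. lra. }
      assert (PX := pow2_ge_0 (x t ^ S m)). assert (PW := pow2_ge_0 (w t)).
      assert (Hxt : Rabs (x t) < d) by (apply (Rabs_lt_of_pow _ _ m Hd); lra).
      assert (Hwt : Rabs (w t) < d).
      { apply (Rabs_lt_of_pow _ _ 0 Hd). rewrite !pow_1. lra. }
      destruct (Hbox _ _ (Hin t ltac:(lra))) as [B1 B2].
      destruct (y_of_w P P1 P2 rho C (x t) (y t) Hrho HC HPr HCrho ltac:(lra) ltac:(lra)) as [Hyt _].
      fold (w t) in Hyt.
      assert (Px := Rabs_pos (x t)). assert (Py := Rabs_pos (y t)).
      rewrite <- (pow2_abs (x t)), <- (pow2_abs (y t)).
      assert (Hx2 : Rabs (x t) ^ 2 <= (eta' / 8) ^ 2) by (apply pow_incr; unfold d in *; lra).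
      assert (Hy2 : Rabs (y t) ^ 2 <= (eta' / 2) ^ 2) by (apply pow_incr; unfold d in *; lra).
      assert (0 < eta' ^ 2) by (apply pow_lt, Heta'). lra. }
  assert (Hin : forall t, 0 <= t -> Rabs (x t) <= rho /\ Rabs (y t) <= rho).
  { intros t Ht. destruct (Hbox (x t) (y t)); [apply Rlt_le, Htrap, Ht | lra]. }
  assert (Horb : forall t, 0 <= t -> reduced_at (- a) b K s rho m x w t).
  { intros t Ht. apply Hred; apply Hin, Ht. }
  assert (Hwb : forall t, 0 <= t -> Rabs (w t) <= 1).
  { intros t Ht. destruct (Hin t Ht) as [B1 B2].
    destruct (y_of_w P P1 P2 rho C (x t) (y t) Hrho HC HPr HCrho B1 B2) as [_ Hw]. fold (w t) in Hw. lra. }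
  assert (Hvlow : forall t, 0 <= t -> c * ((x t ^ S m) ^ 2 + w t ^ 2) <= v t)
    by (intros t Ht; apply (HL x w t (Horb t Ht))).
  assert (Hv0pos : 0 < v 0).
  { apply Rlt_le_trans with (2 := Hvlow 0 (Rle_refl 0)). apply Rmult_lt_0_compat; [exact Hc|].
    assert (PX := pow2_ge_0 (x 0 ^ S m)). assert (PW := pow2_ge_0 (w 0)).
    destruct (Req_dec (x 0) 0) as [E|E].
    - destruct (Req_dec (w 0) 0) as [E'|E'].
      + exfalso. destruct (Hin 0 (Rle_refl 0)) as [B1 B2].
        destruct (y_of_w P P1 P2 rho C (x 0) (y 0) Hrho HC HPr HCrho B1 B2) as [Hy _].
        fold (w 0) in Hy. rewrite E, E', Rabs_R0 in Hy.
        assert (y 0 = 0) by (apply Rabs_eq_0; pose proof (Rabs_pos (y 0)); lra).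
        apply Hne. f_equal; lra.
      + assert (0 < w 0 ^ 2) by (apply pow2_gt_0, E'). lra.
    - assert (0 < (x 0 ^ S m) ^ 2) by (apply pow2_gt_0, pow_nonzero, E). lra. }
  assert (Hvpos := lyapunov_positive (- a) b K s rho c CV m V x w ltac:(lra) Hc HCV Hm HL Horb Hwb Hv0pos).
  destruct (lyapunov_decay (- a) b K s rho c CV m V x w ltac:(lra) Hc HCV Hm HL Horb Hwb Hv0pos) as (q & Hq & Hdec).
  assert (Hret := orbit_returns_to_axis (- a) b K s rho c CV c2 m V x w ltac:(lra) Hc HCV Hc2 Hs Hm HL HR Horb Hwb Hv0pos).
  (* At the origin [V] is at most 0, while it stays positive along the orbit; this makes the polar
     angle meaningful at all times. *)
  assert (Hnz : forall t, 0 <= t -> 0 < x t ^ 2 + y t ^ 2).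
  { intros t Ht. assert (A := pow2_ge_0 (x t)). assert (B := pow2_ge_0 (y t)).
    destruct (Req_dec (x t ^ 2 + y t ^ 2) 0) as [E|E]; [|lra]. exfalso.
    assert (E1 : x t = 0) by (apply Rsqr_0_uniq; rewrite Rsqr_pow2; lra).
    assert (E2 : y t = 0) by (apply Rsqr_0_uniq; rewrite Rsqr_pow2; lra).
    destruct (HL x w t (Horb t Ht)) as ((_ & HV) & _). fold (v t) in HV. specialize (Hvpos t Ht).
    assert (E3 : w t = 0).
    { unfold w. rewrite E1, E2. destruct HP as (_ & _ & _ & E0 & _). rewrite E0. ring. }
    rewrite E1, E3, pow_i, pow_i in HV by lia. unfold v in *. lra. }
  assert (Hder : forall t, 0 <= t -> is_derive x t (s * field1 P (x t) (y t)) /\ is_derive y t (s * Q (x t) (y t))).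
  { intros t Ht. apply Hsol; apply Hin, Ht. }
  (* Continuity of [f] along the orbit is obtained by subtracting [y] from the differentiable
     function [y + f (x, y)]. *)
  assert (Hcomp : forall (f f1 f2 : R -> R -> R) t, flat_germ f f1 f2 r C -> 0 <= t ->
     continuous (fun t => f (x t) (y t)) t).
  { intros f f1 f2 t (Hf & _) Ht. destruct (Hder t Ht) as [D1 D2]. destruct (Hin t Ht) as [B1 B2].
    assert (H := is_derive_along f f1 f2 r C x y t _ _ Hf ltac:(lra) ltac:(lra) D1 D2).
    apply (continuous_ext (fun t => (y t + f (x t) (y t)) - y t)).
    - intro u. match goal with |- @eq _ ?p ?q => change (@eq R p q) end. ring.
    - apply (continuous_minus (fun t => y t + f (x t) (y t)) y); [|apply Hcont].
      apply (ex_derive_continuous (fun t => y t + f (x t) (y t))). eexists. exact H. }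
  destruct (angle_lift x y (fun t => s * field1 P (x t) (y t)) (fun t => s * Q (x t) (y t)) Hder) as (th & Hth).
  { intros t Ht. split.
    - apply (continuous_scal_r s (fun t => field1 P (x t) (y t))).
      apply (continuous_plus y (fun t => P (x t) (y t))); [apply Hcont | apply (Hcomp P P1 P2); assumption].
    - apply (continuous_scal_r s (fun t => Q (x t) (y t))). apply (Hcomp Q Q1 Q2); assumption. }
  { exact Hnz. }
  assert (Hthc : forall t, 0 <= t -> continuous th t).
  { intros t Ht. apply (ex_derive_continuous th). eexists. apply (Hth t Ht). }
  (* On the y-axis the derivative of [- s th] is [(y + P (0, y)) / y], positive near 0; this fixes
     the sense of rotation. *)
  assert (Hwind : forall M, exists T, 0 <= T /\ forall t, T < t -> M < - s * th t).
  { apply (winding_unbounded (fun t => - s * th t)).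
    - intros t Ht. apply (continuous_scal_r (- s) th). apply Hthc, Ht.
    - intros t Ht E. destruct (Hth t Ht) as ((rr & Hrr & Ex & Ey) & Dth).
      assert (E' : cos (th t) = 0).
      { destruct Hs as [-> | ->]; [rewrite <- cos_neg|]; rewrite <- E; f_equal; ring. }
      rewrite E', Rmult_0_r in Ex.
      eexists. split; [|apply (is_derive_scal th t (- s)), Dth].
      rewrite Ex. specialize (Hnz t Ht). rewrite Ex in Hnz.
      assert (Hy : y t <> 0) by (intro Ey0'; rewrite Ey0' in Hnz; lra).
      unfold field1.
      assert (Hs2 : s * s = 1) by (destruct Hs as [-> | ->]; ring).
      replace (- s * ((0 * (s * Q 0 (y t)) - y t * (s * (y t + P 0 (y t)))) / (0 ^ 2 + y t ^ 2)))
        with (s * s * (y t * (y t + P 0 (y t)) / y t ^ 2)) by (field; exact Hy).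
      rewrite Hs2, Rmult_1_l. apply Rdiv_lt_0_compat; [|apply pow2_gt_0, Hy].
      destruct (Hin t Ht) as [B1 B2].
      assert (HB := flat_germ_bound P P1 P2 rho C 0 (y t) HPr ltac:(rewrite Rabs_R0; lra) B2).
      assert (Py := Rabs_pos_lt (y t) Hy). assert (Hy2 := pow2_gt_0 (y t) Hy).
      assert (HPy : Rabs (y t * P 0 (y t)) <= 1 / 8 * y t ^ 2).
      { rewrite Rabs_mult. apply Rle_trans with (Rabs (y t) * (C * (0 ^ 2 + y t ^ 2)));
          [apply Rmult_le_compat_l; lra|].
        replace (Rabs (y t) * (C * (0 ^ 2 + y t ^ 2))) with (C * Rabs (y t) * y t ^ 2) by ring.
        apply Rmult_le_compat_r; [lra|]. apply Rle_trans with (C * rho); [apply Rmult_le_compat_l; lra | exact HCrho]. }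
      apply Rabs_le_between in HPy. lra.
    - intros t Ht. destruct (Hret t Ht) as (t' & Htt' & Ext). exists t'. split; [exact Htt'|].
      destruct (Hth t' ltac:(lra)) as ((rr & Hrr & Ex & Ey) & _). rewrite Ext in Ex.
      assert (E : cos (th t') = 0).
      { symmetry in Ex. apply Rmult_integral in Ex. destruct Ex; [lra | assumption]. }
      destruct Hs as [-> | ->]; [rewrite <- cos_neg|]; rewrite <- E; f_equal; ring. }
  (* The decay [v t < 1 / (q t)] makes both [X] and [w] small; [x] is recovered from its power, and
     the threshold [g] is at most [e'^2] so that it serves [w] as well. *)
  assert (Hsmall : forall e, 0 < e -> exists T, 0 <= T /\ forall t, T < t -> Rabs (x t) < e /\ Rabs (w t) < e).
  { intros e He.
    set (e' := Rmin e 1). assert (He' : 0 < e') by (apply Rmin_pos; lra).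
    assert (Ee : e' <= e) by apply Rmin_l. assert (Ee1 : e' <= 1) by apply Rmin_r.
    set (g := (e' ^ S m) ^ 2). assert (Hg : 0 < g) by (apply pow_lt, pow_lt, He').
    assert (Hge : g <= e' ^ 2).
    { apply pow_incr. split; [apply pow_le; lra|]. rewrite <- (Rmult_1_r e') at 2. simpl.
      apply Rmult_le_compat_l; [lra|]. rewrite <- (pow1 m). apply pow_incr. lra. }
    assert (Hcgq : 0 < c * g * q) by (apply Rmult_lt_0_compat; [apply Rmult_lt_0_compat|]; assumption).
    exists (/ (c * g * q)). split; [apply Rlt_le, Rinv_0_lt_compat, Hcgq|].
    intros t Ht. assert (Ht0 : 0 < t) by (pose proof (Rinv_0_lt_compat _ Hcgq); lra).
    specialize (Hdec t ltac:(lra)). specialize (Hvlow t ltac:(lra)). fold (v t) in Hdec.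
    assert (Hqt : 0 < q * t) by (apply Rmult_lt_0_compat; assumption).
    assert (H1 : 1 < c * g * (q * t)).
    { apply (Rmult_lt_compat_l (c * g * q)) in Ht; [|exact Hcgq]. rewrite Rinv_r in Ht; lra. }
    assert (Hvg : v t < c * g).
    { apply Rmult_lt_reg_r with (q * t); [exact Hqt | lra]. }
    assert (HY : (x t ^ S m) ^ 2 + w t ^ 2 < g).
    { apply Rmult_lt_reg_l with c; [exact Hc | lra]. }
    assert (PX := pow2_ge_0 (x t ^ S m)). assert (PW := pow2_ge_0 (w t)).
    split.
    - apply Rlt_le_trans with (2 := Ee). apply (Rabs_lt_of_pow _ _ m He'). fold g. lra.
    - apply Rlt_le_trans with (2 := Ee). apply (Rabs_lt_of_pow _ _ 0 He'). rewrite !pow_1. lra. }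
  exists x, y, th. split; [exact Ex0|]. split; [exact Ey0|]. split; [|split; [|split]].
  - intros t Ht. split; [apply Hsol; apply Hin, Ht|]. split.
    + apply Rlt_le_trans with (2 := He1). apply in_ball0_of_Rabs; [exact Heta' | apply Htrap, Ht].
    + split; [apply Hthc, Ht | apply (Hth t Ht)].
  - apply is_lim_0_eps. intros e He. destruct (Hsmall e He) as (T & _ & HT). exists T.
    intros t Ht. apply HT, Ht.
  - apply is_lim_0_eps. intros e He. destruct (Hsmall (e / 4) ltac:(lra)) as (T & HT0 & HT). exists T.
    intros t Ht. destruct (HT t Ht) as [A B]. destruct (Hin t ltac:(lra)) as [B1 B2].
    destruct (y_of_w P P1 P2 rho C (x t) (y t) Hrho HC HPr HCrho B1 B2) as [Hy _]. fold (w t) in Hy. lra.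
  - destruct Hs as [-> | ->]; [right | left]; apply is_lim_spec; intro M.
    + destruct (Hwind (- M)) as (T & _ & HT). exists T. intros t Ht. specialize (HT t Ht). lra.
    + destruct (Hwind M) as (T & _ & HT). exists T. intros t Ht. specialize (HT t Ht). lra.
Qed.

(** As [Q] has zero 1-jet and [|F| <= |x|], the function [f] is [O (x^2)] and cannot begin with
    [a x]. This provides the [m >= 1] asked for by [gap_sign]. *)
Lemma andreev_number_ge_2 (P P1 P2 Q Q1 Q2 : R -> R -> R) (F : R -> R) (r C a : R) (m : nat) :
  0 < r -> 0 < C -> flat_germ P P1 P2 r C -> flat_germ Q Q1 Q2 r C -> implicit_branch P F ->
  leading_term (f_fun Q F) a (2 * S m - 1) -> (1 <= m)%nat.
Proof.
  intros Hr HC HP HQ HF (Ha & Cf & Hf). destruct m as [|m]; [exfalso | lia].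
  destruct (implicit_branch_bound P P1 P2 F r C Hr HC HP HF) as (r1 & Hr1 & HF').
  apply locally_0_Rabs in Hf. destruct Hf as (r2 & Hr2 & Hf). simpl in Hf.
  set (M := Rabs Cf + 2 * C). assert (HCf := Rabs_pos Cf). assert (HM : 0 < M) by (unfold M; lra).
  assert (Ha' := Rabs_pos_lt a Ha).
  destruct (exists_small5 (r1 / 2) (r2 / 2) (r / 2) (Rabs a / (2 * M)) 1) as (x & Hx & L1 & L2 & L3 & L4 & _); try lra.
  { apply Rdiv_lt_0_compat; lra. }
  assert (Ex : Rabs x = x) by (apply Rabs_pos_eq; lra).
  destruct (HF' x ltac:(lra)) as [HFx _]. specialize (Hf x ltac:(lra)). unfold f_fun in Hf.
  assert (HB := flat_germ_bound Q Q1 Q2 r C x (F x) HQ ltac:(lra) ltac:(lra)).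
  rewrite <- (pow2_abs (F x)) in HB. rewrite Ex in *.
  assert (HFp := Rabs_pos (F x)).
  assert (HF2 : Rabs (F x) ^ 2 <= x ^ 2) by (apply pow_incr; lra).
  assert (HB' : C * (x ^ 2 + Rabs (F x) ^ 2) <= C * (2 * x ^ 2)) by (apply Rmult_le_compat_l; lra).
  pose proof (Rabs_triang (Q x (F x)) (- (Q x (F x) - a * (x * 1)))) as HT. rewrite Rabs_Ropp in HT.
  replace (Q x (F x) + - (Q x (F x) - a * (x * 1))) with (a * x) in HT by ring.
  rewrite Rabs_mult, Ex in HT. rewrite Rmult_1_r in Hf.
  pose proof (RRle_abs Cf).
  assert (Cf * (x * x) <= Rabs Cf * (x * x)) by (apply Rmult_le_compat_r; [apply Rle_0_sqr | assumption]).
  assert (L4' : x * M <= Rabs a / 2).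
  { apply (Rmult_le_compat_r M) in L4; [|lra].
    replace (Rabs a / (2 * M) * M) with (Rabs a / 2) in L4 by (field; lra). exact L4. }
  apply (Rmult_le_compat_r x) in L4'; [|lra].
  assert (Rabs a * x <= x * M * x).
  { eapply Rle_trans; [exact HT|]. replace (x * M * x) with (C * (2 * x ^ 2) + Rabs Cf * (x * x)) by (unfold M; ring).
    rewrite Rmult_1_r. lra. }
  assert (0 < Rabs a * x) by (apply Rmult_lt_0_compat; lra). lra.
Qed.

Theorem theorem7 (P Q : R -> R -> R) (F : R -> R) (n beta : nat)
  (hP : analytic2_near0 P) (hQ : analytic2_near0 Q)
  (hjP : jet_zero 1 P) (hjQ : jet_zero 1 Q)
  (hiso : isolated_singular_point (field1 P) Q)
  (hmono : monodromic (field1 P) Q)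
  (hF : implicit_branch P F)
  (hn : andreev_number Q F n) (hodd : Nat.Odd n)
  (hbeta : vanishing_order (Phi_fun P Q F) beta)
  (hbn : beta = (n - 1)%nat) :
  focus (field1 P) Q.
Proof.
  destruct (analytic2_flat_germ P hP hjP) as (P1 & P2 & rP & CP & HrP & HCP & HP).
  destruct (analytic2_flat_germ Q hQ hjQ) as (Q1 & Q2 & rQ & CQ & HrQ & HCQ & HQ).
  set (r := Rmin rP rQ). set (C := Rmax CP CQ).
  assert (Hr : 0 < r) by (apply Rmin_pos; assumption).
  assert (HC : 0 < C) by (apply Rlt_le_trans with CP; [exact HCP | apply Rmax_l]).
  apply (flat_germ_weaken P P1 P2 rP CP r C (Rmin_l _ _) (Rmax_l _ _)) in HP.
  apply (flat_germ_weaken Q Q1 Q2 rQ CQ r C (Rmin_r _ _) (Rmax_r _ _)) in HQ.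
  destruct hn as [Hn1 [a Hf]]. destruct hbeta as [b Hphi].
  destruct n as [|m]; [lia|]. replace (S m - 1)%nat with m in hbn by lia. subst beta.
  assert (Hm : (1 <= m)%nat) by (apply (andreev_number_ge_2 P P1 P2 Q Q1 Q2 F r C a); assumption).
  assert (Hme : Nat.Even m) by (apply Nat.Odd_succ; exact hodd).
  assert (Hb : b <> 0) by apply Hphi.
  destruct (field_expansion P P1 P2 Q Q1 Q2 F r C a b m Hr HC HP HQ hF Hf Hphi)
    as (r' & K & Hr' & HK & Hexp).
  assert (Hdisc := monodromic_discriminant P P1 P2 Q r C a b r' K m Hr HC Hr' HK Hm Hb HP Hexp hmono).
  destruct hiso as (E1 & E2 & _). split; [exact E1|]. split; [exact E2|].
  (* The sign of [b] decides the stability: with [s b < 0], orbits converge in forward time if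
     [b < 0] and in backward time if [b > 0]. *)
  destruct (Rdichotomy b 0 Hb) as [Hneg|Hpos]; [left | right].
  - apply (spirals_ext (fun x y => 1 * field1 P x y) (fun x y => 1 * Q x y)); [intros; ring | intros; ring |].
    apply (nilpotent_spirals P P1 P2 Q Q1 Q2 r C a b r' K 1 m); try assumption; [left; reflexivity | lra].
  - apply (spirals_ext (fun x y => - 1 * field1 P x y) (fun x y => - 1 * Q x y)); [intros; ring | intros; ring |].
    apply (nilpotent_spirals P P1 P2 Q Q1 Q2 r C a b r' K (- 1) m); try assumption; [right; reflexivity | lra].
Qed.
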